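(* Assume hypotheses (i)–(v) of the context, and let $x(t),\xi(\nu,t)$, $t\in\mathbb{R}$, be a solution of finite constant energy $E$ of $$\frac{d}{dt}\frac{\partial \mathcal{L}_0}{\partial\dot x}-\frac{\partial \mathcal{L}_0}{\partial x}=\frac{\partial f}{\partial x}\int\kappa\,\xi\,d\nu,\qquad \rho\,(\ddot\xi+\nu^2\xi)=\kappa f(x),$$ with initial values $x|_{t=0}=x_0$, $\xi|_{t=0}=\xi_0(\nu)$, $\dot x|_{t=0}=\dot x_0$, $\dot\xi|_{t=0}=\dot\xi_0(\nu)$. Then the functions $\psi(t)=f(x(t))$ and $\varphi(t)=\int\kappa(\nu)\,\xi(\nu,t)\,d\nu$ are bounded, and their Fourier transforms $\hat\psi=\mathcal{F}(\psi)$, $\hat\varphi=\mathcal{F}(\varphi)$ are such that (1) $\hat a\hat\psi\in L_2$, $\hat w\hat\psi\in L_1$, and $\operatorname{sing\,supp}\hat\psi\cap\sigma=\emptyset$; (2) $\hat\varphi=\hat w_\diamond^+\hat\psi+\hat\vartheta^+=\hat w_\diamond^-\hat\psi+\hat\vartheta^-$ for some $\hat\vartheta^+\in\hat{\mathcal{C}}_0^+$ and $\hat\vartheta^-\in\hat{\mathcal{C}}_0^-$.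
   Context: Mechanical setting. $\int$ means $\int_{-\infty}^{+\infty}$. $M$ is a smooth $m$-dimensional manifold with local coordinates $x$; $\mathcal{L}_0(x,\dot x)=\frac12\langle A(x)\dot x,\dot x\rangle-V_0(x)$, with $A$ determining a Riemannian metric, $V_0,f:M\to\mathbb{R}$. $\rho,\kappa,\xi_0,\dot\xi_0$ are real functions of $\nu\in\mathbb{R}$, $\xi(\nu,t)$ is real. $\kappa/\sqrt\rho$ is extended by zero to $\mathbb{R}\setminus\operatorname{supp}\rho$. Energy: $$E=\tfrac12\langle A\dot x,\dot x\rangle+\tfrac12\int\rho\dot\xi^2\,d\nu+V_0(x)+\tfrac12\int\rho\nu^2\xi^2\,d\nu-f(x)\int\kappa\xi\,d\nu .$$ Function spaces. $\mathcal{C}_b$: bounded uniformly continuous functions $\mathbb{R}\to\mathbb{C}$ with the sup-norm. $\mathcal{C}_0^{\pm}\subset\mathcal{C}_b$: functions tending to zero at $\pm\infty$; $\mathcal{C}_0=\mathcal{C}_0^+\cap\mathcal{C}_0^-$. $\mathcal{M}$: finite complex Radon measures on $\mathbb{R}$ (identified with their densities, as distributions); $L_1\subset\mathcal{M}$. Fourier transform: $\mathcal{F}(\psi)=\hat\psi(\lambda)=\int e^{-i\lambda\tau}\psi(\tau)\,d\tau$, $\mathcal{F}^{-1}(\hat\psi)(\tau)=\frac1{2\pi}\int e^{i\lambda\tau}\hat\psi(\lambda)\,d\lambda$, in the sense of distributions. $\hat{\mathcal{C}}_b=\mathcal{F}(\mathcal{C}_b)$, $\hat{\mathcal{C}}_0^\pm=\mathcal{F}(\mathcal{C}_0^\pm)$,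 $\hat{\mathcal{M}}=\mathcal{F}(\mathcal{M})\subset\mathcal{C}_b$. For $\hat\mu=\mathcal{F}(\mu)\in\hat{\mathcal{M}}$, $\hat\varphi=\mathcal{F}(\varphi)\in\hat{\mathcal{C}}_b$ the product is $\hat\mu\hat\varphi=\mathcal{F}(\mu*\varphi)\in\hat{\mathcal{C}}_b$, where $(\mu*\varphi)(t)=\int\varphi(t-\tau)\,\mu(\tau)\,d\tau$. Singular support. For $\hat\varphi\in\hat{\mathcal{C}}_b$ and $\lambda\in\mathbb{R}$: $\lambda\notin\operatorname{sing\,supp}^\pm(\hat\varphi)$ iff there is an open interval $I\ni\lambda$ such that $\hat\mu\hat\varphi\in\hat{\mathcal{C}}_0^\pm$ for every $\hat\mu\in\hat{\mathcal{M}}$ with $\operatorname{supp}\hat\mu\subset I$. $\operatorname{sing\,supp}(\hat\varphi)=\operatorname{sing\,supp}^+(\hat\varphi)\cup\operatorname{sing\,supp}^-(\hat\varphi)$. Thermostat data. $\hat a(\nu)=\kappa(\nu)/\sqrt{\rho(\nu)}$, $\hat w(\nu)=\frac{2\pi\hat a^2(\nu)}{i\nu}$, $\sigma=\{s\in\mathbb{R}:\hat a(s)\ne0\}$, $w=\mathcal{F}^{-1}(\hat w)$ (which lies in $L_1$ under (v)). $w_\diamond^\pm(\tau)=\pm\frac12(w(\tau)-w(-\tau))$ if $\pm\tau>0$ and $w_\diamond^\pm(\tau)=0$ if $\pm\tau<0$; $\hat w_\diamond^\pm=\mathcal{F}(w_\diamond^\pm)$. Hypotheses: (i) $A,V_0,f$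 are smooth, $A$ is positive definite, $\rho\ge0$, $\operatorname{supp}\kappa\subset\operatorname{supp}\rho$. (ii) $\int\frac{\kappa^2}{\rho}\,d\nu$ and $K:=\int\frac{\kappa^2}{\rho\nu^2}\,d\nu$ are finite. (iii) $V(x)=V_0(x)-Kf^2(x)/2$ is bounded from below; either $f$ is bounded or $V\to\infty$ as $|f|\to\infty$; the sets $\{x\in M:V\le E\}$ are compact. (iv) $\int\rho\,(\dot\xi_0^2+\nu^2\xi_0^2)\,d\nu<\infty$. (v) $\hat a$ and $\hat a'=d\hat a/d\nu$ belong to $\hat{\mathcal{M}}$, and $\hat a(0)=\hat w(0)=0$. *)

(* Defs.v *)
From HB Require Import structures.
From mathcomp Require Import all_boot all_order all_algebra.
From mathcomp Require Import all_classical all_reals all_analysis.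
From mathcomp Require Import complex.
Set Implicit Arguments.
Unset Strict Implicit.
Unset Printing Implicit Defensive.
Import Order.TTheory GRing.Theory Num.Theory.
Import numFieldNormedType.Exports.

Local Open Scope classical_set_scope.
Local Open Scope complex_scope.
Local Open Scope ring_scope.

Notation leb R := (@lebesgue_measure R).

Section Manifold.
Context {R : realType} {m : nat}.

(* [g] has continuous iterated partial derivatives up to order [n] on the
   (open) set [U]. *)
Fixpoint class_C (n : nat) (U : set 'rV[R]_m) (g : 'rV[R]_m -> R) : Prop :=
  (forall y, U y -> {for y, continuous g}) /\
  match n with
  | 0%N => True
  | n'.+1 => forall k : 'I_m,
      (forall y, U y -> derivable g y (delta_mx 0 k)) /\
      class_C n' U (fun y => 'D_(delta_mx 0 k) g y)
  end.

Definition smooth_on U g := forall n, class_C n U g.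

Record smooth_atlas (M : topologicalType) := SmoothAtlas {
  chart : Type;
  dom : chart -> set M;
  cmap : chart -> M -> 'rV[R]_m;
  cinv : chart -> 'rV[R]_m -> M;
  atlas_hausdorff : hausdorff_space M;
  atlas_second_countable : @second_countable M;
  atlas_cover : forall x, exists i, dom i x;
  dom_open : forall i, open (dom i);
  codom_open : forall i, open (cmap i @` dom i);
  cmapK : forall i x, dom i x -> cinv i (cmap i x) = x;
  cmap_continuous : forall i x, dom i x -> {for x, continuous (cmap i)};
  cinv_continuous : forall i x, dom i x ->
    {for cmap i x, continuous (cinv i)};
  transition_smooth : forall i j (k : 'I_m),
    smooth_on (cmap i @` (dom i `&` dom j))
              (fun y => cmap j (cinv i y) 0 k) }.

Context {M : topologicalType} (S : smooth_atlas M).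

Definition smooth_fun (g : M -> R) :=
  forall i, smooth_on (cmap i @` dom (s := S) i) (g \o cinv i).

(* [metric i y] is the matrix of the metric at the point with coordinates [y]
   in the chart [i]; [metric_change] says that the local expressions define
   one tensor, the tangent vector [v] in the chart [i] being the directional
   derivative along [v] of the transition map in the chart [j]. *)
Record riemannian_metric := RiemannianMetric {
  metric : chart S -> 'rV[R]_m -> 'M[R]_m;
  metric_sym : forall i x, dom i x ->
    (metric i (cmap i x))^T = metric i (cmap i x);
  metric_posdef : forall i x (v : 'rV[R]_m), dom i x -> v != 0 ->
    0 < (v *m metric i (cmap i x) *m v^T) 0 0;
  metric_smooth : forall i (k l : 'I_m),
    smooth_on (cmap i @` dom i) (fun y => metric i y k l);
  metric_change : forall i j x (v : 'rV[R]_m), dom i x -> dom j x ->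
    let Jv : 'rV[R]_m := 'D_v (cmap j \o cinv i) (cmap i x) in
    (Jv *m metric j (cmap j x) *m Jv^T) 0 0 =
    (v *m metric i (cmap i x) *m v^T) 0 0 }.

Context (A : riemannian_metric).

Definition kinetic (i : chart S) (y v : 'rV[R]_m) : R :=
  2^-1 * (v *m metric A i y *m v^T) 0 0.

Definition lagrangian (V0 : M -> R) (i : chart S) (y v : 'rV[R]_m) : R :=
  kinetic i y v - V0 (cinv i y).

Definition twice_derivable {V : normedModType R} (q : R -> V) (t : R) :=
  derivable q t 1 /\ derivable (derive1 q) t 1.

(* d/dt (dL/dv) - dL/dy = F * df/dy, in every chart, as long as the curve [x]
   stays in its domain. *)
Definition euler_lagrange (V0 f : M -> R) (x : R -> M) (F : R -> R) :=
  continuous x /\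
  forall i t, dom (s := S) i (x t) ->
    let q := cmap i \o x in
    twice_derivable q t /\
    forall k : 'I_m,
      derive1 (fun s => 'D_(delta_mx 0 k) (fun v => lagrangian V0 i (q s) v)
                          (derive1 q s)) t
      - 'D_(delta_mx 0 k) (fun y => lagrangian V0 i y (derive1 q t)) (q t)
      = 'D_(delta_mx 0 k) (f \o cinv i) (q t) * F t.

End Manifold.

Section Thermostat.
Context {R : realType}.
Implicit Types (rho kappa : R -> R).

(* Division in [\bar R]: kappa^2 / 0 is +oo when kappa != 0, and 0 / 0 = 0, so
   finiteness forces kappa = 0 almost everywhere on the set rho = 0. *)
Definition int_k2r rho kappa : \bar R :=
  (\int[leb R]_nu ((kappa nu ^+ 2)%:E / (rho nu)%:E))%E.

Definition int_k2rn rho kappa : \bar R :=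
  (\int[leb R]_nu ((kappa nu ^+ 2)%:E / (rho nu * nu ^+ 2)%:E))%E.

Definition coupling kappa (xi : R -> R -> R) (t : R) : R :=
  \int[leb R]_nu (kappa nu * xi nu t).

Definition oscillators rho kappa (g : R -> R) (xi : R -> R -> R) :=
  {ae leb R, forall nu, forall t : R,
    twice_derivable (xi nu) t /\
    rho nu * (derive1n 2 (xi nu) t + nu ^+ 2 * xi nu t) = kappa nu * g t}.

Definition finite_oscillator_energy rho kappa (xi : R -> R -> R) (t : R) :=
  [/\ (leb R).-integrable setT
        (fun nu => (rho nu * derive1 (xi nu) t ^+ 2)%:E),
      (leb R).-integrable setT
        (fun nu => (rho nu * nu ^+ 2 * xi nu t ^+ 2)%:E) &
      (leb R).-integrable setT (fun nu => (kappa nu * xi nu t)%:E)].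

(* The kinetic term is written in a chart [i] whose domain contains [x t]; it
   does not depend on the choice of [i]. *)
Definition energy {m : nat} {M : topologicalType} {S : @smooth_atlas R m M}
    (A : riemannian_metric S) (V0 f : M -> R) rho kappa
    (x : R -> M) (xi : R -> R -> R) (i : chart S) (t : R) : R :=
  let q := cmap i \o x in
  kinetic A i (q t) (derive1 q t)
  + 2^-1 * \int[leb R]_nu (rho nu * derive1 (xi nu) t ^+ 2)
  + V0 (x t)
  + 2^-1 * \int[leb R]_nu (rho nu * nu ^+ 2 * xi nu t ^+ 2)
  - f (x t) * coupling kappa xi t.

End Thermostat.

Section Fourier.
Context {R : realType}.
Notation C := R[i].

Definition cabs (z : C) : R := ComplexField.Normc.normc z.

(* e^(ix) *)
Definition cis (x : R) : C := cos x +i* sin x.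

Definition supp {T : topologicalType} {V : nmodType} (g : T -> V) : set T :=
  closure [set x | g x != 0].

Definition cint (g : R -> C) : C :=
  (\int[leb R]_t complex.Re (g t)) +i* (\int[leb R]_t complex.Im (g t)).

Notation charge_R := (charge (measurableTypeR R) R).

(* Integral against a finite signed measure, through its Jordan decomposition
   (which does not depend on the chosen Hahn decomposition). *)
Definition charge_int (nu : charge_R) (g : R -> R) : R :=
  let: exist P HP := cid (Hahn_decomposition nu) in
  let: exist N PN := cid HP in
  \int[jordan_pos PN]_t g t - \int[jordan_neg PN]_t g t.

(* Finite complex Borel (equivalently, Radon) measures on R. *)
Record cmeasure := CMeasure { mu_re : charge_R; mu_im : charge_R }.

Definition cmint (mu : cmeasure) (g : R -> C) : C :=
  let re t := complex.Re (g t) in let im t := complex.Im (g t) in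
  (charge_int (mu_re mu) re - charge_int (mu_im mu) im)
  +i* (charge_int (mu_im mu) re + charge_int (mu_re mu) im).

Definition fourier (g : R -> C) (lam : R) : C :=
  cint (fun t => cis (- (lam * t)) * g t).

Definition fourier_measure (mu : cmeasure) (lam : R) : C :=
  cmint mu (fun t => cis (- (lam * t))).

Definition Mhat : set (R -> C) := range fourier_measure.

Definition conv (mu : cmeasure) (phi : R -> C) (t : R) : C :=
  cmint mu (fun tau => phi (t - tau)).

Definition Cb (phi : R -> C) :=
  (exists B : R, forall t, cabs (phi t) <= B) /\
  (forall e : R, 0 < e -> exists2 d : R, 0 < d &
     forall s t, `|s - t| < d -> cabs (phi s - phi t) < e).

(* C_0^+ and C_0^- for [F] the neighborhood filter of +oo and of -oo. *)
Definition C0 (F : set_system R) (phi : R -> C) :=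
  Cb phi /\ cabs (phi t) @[t --> F] --> (0 : R).

Definition rapidly_decreasing (g : R -> R) :=
  (forall n t, derivable (derive1n n g) t 1) /\
  (forall k n, exists B : R, forall t, `|t ^+ k * derive1n n g t| <= B).

Record schwartz := Schwartz {
  schwartz_fun :> R -> C;
  schwartz_re : rapidly_decreasing (fun t => complex.Re (schwartz_fun t));
  schwartz_im : rapidly_decreasing (fun t => complex.Im (schwartz_fun t)) }.

(* Tempered distributions are handled as functionals on Schwartz functions;
   linearity and continuity need not be imposed, as all those that occur are
   Fourier transforms of bounded functions. *)
Definition tdist := schwartz -> C.

Definition FT (phi : R -> C) : tdist :=
  fun eta => cint (fun t => phi t * fourier eta t).

Definition C0hat (F : set_system R) : set tdist := FT @` C0 F.

(* [T] is (the distribution with density) a function in L_p. *)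
Definition Lhat (p : \bar R) : set tdist := [set T | exists g : R -> C,
  [/\ (fun t => complex.Re (g t)) \in Lfun (leb R) p,
      (fun t => complex.Im (g t)) \in Lfun (leb R) p &
      forall eta : schwartz, T eta = cint (fun lam => g lam * eta lam)]].

(* [P] is the product of [h] in F(measures) and [T] in F(Cb), that is
   F(mu * phi) when h = F(mu) and T = F(phi).  It is unique since F is injective
   on measures and on Cb, and it exists exactly when [h] and [T] are in these
   two spaces. *)
Definition hat_prod (h : R -> C) (T P : tdist) :=
  exists mu phi, [/\ Cb phi, h = fourier_measure mu, T = FT phi &
                     P = FT (conv mu phi)].

Definition hat_prod_in (h : R -> C) (T : tdist) (X : set tdist) :=
  exists2 P, hat_prod h T P & X P.

Definition singsupp_at (F : set_system R) (T : tdist) : set R :=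
  [set lam | ~ exists I : set R, [/\ open I, is_interval I, I lam &
     forall h, Mhat h -> supp h `<=` I -> hat_prod_in h T (C0hat F)]].

Definition singsupp (T : tdist) : set R :=
  singsupp_at +oo T `|` singsupp_at -oo T.

(* At nu = 0 the quotient is 0 by the convention on division by zero. *)
Definition what (ahat : R -> R) (nu : R) : C :=
  (2 * pi * ahat nu ^+ 2)%:C / (0 +i* nu).

(* The inverse Fourier transform of [what ahat], as an absolutely convergent
   integral: [what ahat] is in L_1 when ahat and ahat / nu are in L_2. *)
Definition wfun (ahat : R -> R) (tau : R) : C :=
  ((2 * pi)^-1)%:C * cint (fun lam => cis (lam * tau) * what ahat lam).

Definition wdiamond_plus (w : R -> C) (tau : R) : C :=
  if 0 < tau then (2^-1)%:C * (w tau - w (- tau)) else 0.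

Definition wdiamond_minus (w : R -> C) (tau : R) : C :=
  if tau < 0 then - ((2^-1)%:C * (w tau - w (- tau))) else 0.

End Fourier.

(* Main.v *)
Require Import Defs.
From HB Require Import structures.
From mathcomp Require Import all_boot all_order all_algebra.
From mathcomp Require Import all_classical all_reals all_analysis.
From mathcomp Require Import measurable_realfun.
From mathcomp Require Import complex.
From mathcomp Require Import ring lra.
Import Order.TTheory GRing.Theory Num.Theory.
Import numFieldNormedType.Exports.
Set Implicit Arguments.
Unset Strict Implicit.
Unset Printing Implicit Defensive.
Local Open Scope classical_set_scope.
Local Open Scope complex_scope.
Local Open Scope ring_scope.

(** The oscillators hold a bounded amount of energy at all times, and every
    conclusion measures how this bound limits the force exerted on them.

    Energy. Completing the square in the oscillator variables turns the energy
    into the sum of the kinetic energies, of V (x t) and of a nonnegative term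
    (oscillator_energy_bound). As V is bounded below with compact sublevel sets,
    x stays in a compact set, and the speed of x and the energy of the
    oscillators, the integral of rho xi'^2 + rho nu^2 xi^2, are bounded for all
    times. Hence psi = f (x t) is bounded, and uniformly continuous
    (ucont_observable).

    Square integrability. In the frame rotating at frequency nu, the state of the
    oscillator nu at time t, scaled so that its squared norm is an energy, is its
    initial state plus ahat nu times the integral of psi s * exp (- i nu s) over
    [0, t] (oscillator_solution). Rotations preserve the oscillator energy, so
    that ahat times the transforms of the truncations of psi to [-n, n] is
    bounded in L2 uniformly in n. Write a for the measure with transform ahat. By Plancherel, the regularized convolutions
    of a with these truncations are bounded in L2, and by Fatou's lemma so is
    u = a * psi (conv_L2). Therefore the distribution ahat psihat, the transform
    of u, is a function g in L2 (FT_conv_L2).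

    Integrability. Since ahat vanishes at 0 and its derivative is the transform of
    a measure, so is b nu = ahat nu / nu (quotient_measure), and b is square
    integrable since K is finite. As what = - 2 pi i b ahat, the product
    what psihat is - 2 pi i b g, the product of two functions of L2.

    Singular support. Being uniformly continuous and in L2, u tends to 0 at
    infinity (ucont_L2_vanish). Where ahat does not vanish, 1 / ahat is locally
    the transform of a measure (local_inverse, bernstein_measure); so the
    convolutions of psi with the measures whose spectrum lies near such a point
    factor through u, and also tend to 0 at infinity (regular_point).

    Response. Inserting the solution for xi in phi gives the sum of the free motion
    of the oscillators, which tends to 0 by the Riemann-Lebesgue lemma, and of the
    integral of psi (t - r) W r over r in [0, t], where W is the sine transform of
    b ahat. As b ahat is both integrable and the transform of a measure, W is
    integrable (L1_St_fourier); so the integral differs from the convolution of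
    psi with the causal half of W by a tail that tends to 0 as t tends to +oo, and
    from the convolution with the anticausal half by one that tends to 0 as t tends
    to -oo (response_split). These halves are the kernels w_diamond, because w
    differs from W by an even function.

    Fourier analysis on the line rests on the pair formed by the Abel kernel
    exp (- e |t|) and its transform, the Poisson kernel: Abel means of an inverse
    transform are Poisson averages (abel_inversion). Complex measures are
    handled as finite combinations of finite positive measures, which reduces
    dominated convergence and Fubini's theorem for them to the positive case. *)

(** * Real-valued integration *)

(** Estimates are carried out on real-valued integrands, so that differences and
    products of integrals involve no case analysis on infinities. *)
Notation L1 mu f := (integrable mu setT (EFin \o f)).

(** The Borel structure is spelled out so that all measurability goals on the
    line mention the same one. *)
Notation Rmeas f := (measurable_fun [set: measurableTypeR _] f).

Section RealIntegrals.
Context d (T : measurableType d) (R : realType).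
Variable mu : {measure set T -> \bar R}.
Implicit Types f g h : T -> R.

Lemma L1_meas f : L1 mu f -> measurable_fun setT f.
Proof. by move=> /measurable_int /measurable_EFinP. Qed.

Lemma eq_L1 f g : f =1 g -> L1 mu f -> L1 mu g.
Proof. by move=> fg; have -> : f = g by apply/funext. Qed.

Lemma L1_le f g : measurable_fun setT f -> L1 mu g ->
  (forall x, `|f x| <= g x) -> L1 mu f.
Proof.
move=> mf ig fg; apply: le_integrable ig => //; first exact/measurable_EFinP.
by move=> x _ /=; rewrite lee_fin (le_trans (fg x))// ler_norm.
Qed.

Lemma L1D f g : L1 mu f -> L1 mu g -> L1 mu (fun x => f x + g x).
Proof. by move=> If Ig; apply: (integrableD measurableT If Ig). Qed.

Lemma L1B f g : L1 mu f -> L1 mu g -> L1 mu (fun x => f x - g x).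
Proof. by move=> If Ig; apply: (integrableB measurableT If Ig). Qed.

Lemma L1Z c f : L1 mu f -> L1 mu (fun x => c * f x).
Proof. by move=> If; apply: (integrableZl measurableT c If). Qed.

Lemma L1N f : L1 mu f -> L1 mu (fun x => - f x).
Proof. by move=> If; apply: (integrableN If). Qed.

Lemma L1_abs f : L1 mu f -> L1 mu (fun x => `|f x|).
Proof. by move=> If; apply: (integrable_norm If). Qed.

Lemma L1_bdM f g (B : R) : measurable_fun setT f -> (forall x, `|f x| <= B) ->
  L1 mu g -> L1 mu (fun x => f x * g x).
Proof.
move=> mf fB ig; apply: (@L1_le _ (fun x => B * `|g x|)).
- by apply: measurable_funM => //; exact: L1_meas.
- by apply: L1Z; exact: L1_abs.
- by move=> x; rewrite normrM ler_wpM2r.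
Qed.

Lemma L1_sqM f g : measurable_fun setT f -> measurable_fun setT g ->
  L1 mu (fun x => f x ^+ 2) -> L1 mu (fun x => g x ^+ 2) ->
  L1 mu (fun x => f x * g x).
Proof.
move=> mf mg If Ig; apply: (@L1_le _ (fun x => f x ^+ 2 + g x ^+ 2)).
- exact: measurable_funM.
- exact: L1D.
- move=> x; rewrite ler_norml; apply/andP; split;
  have := sqr_ge0 (f x + g x); have := sqr_ge0 (f x - g x); nra.
Qed.

Lemma L1_sqD f g : measurable_fun setT f -> measurable_fun setT g ->
  L1 mu (fun x => f x ^+ 2) -> L1 mu (fun x => g x ^+ 2) ->
  L1 mu (fun x => (f x + g x) ^+ 2).
Proof.
move=> mf mg If Ig; apply: (@L1_le _ (fun x => 2 * (f x ^+ 2 + g x ^+ 2))).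
- by apply: measurable_funX; exact: measurable_funD.
- by apply: L1Z; exact: L1D.
- by move=> x; rewrite ger0_norm ?sqr_ge0//; have := sqr_ge0 (f x - g x); nra.
Qed.

Lemma RintD f g : L1 mu f -> L1 mu g ->
  \int[mu]_x (f x + g x) = \int[mu]_x f x + \int[mu]_x g x.
Proof. by move=> If Ig; rewrite RintegralD. Qed.

Lemma RintB f g : L1 mu f -> L1 mu g ->
  \int[mu]_x (f x - g x) = \int[mu]_x f x - \int[mu]_x g x.
Proof. by move=> If Ig; rewrite RintegralB. Qed.

Lemma RintZ c f : L1 mu f -> \int[mu]_x (c * f x) = c * \int[mu]_x f x.
Proof. by move=> If; rewrite RintegralZl. Qed.

Lemma eq_Rint f g : f =1 g -> \int[mu]_x f x = \int[mu]_x g x.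
Proof. by move=> fg; apply: eq_Rintegral => x _; exact: fg. Qed.

Lemma RintN f : L1 mu f -> \int[mu]_x (- f x) = - \int[mu]_x f x.
Proof.
by move=> If; rewrite -mulN1r -RintZ//; apply: eq_Rint => x; rewrite mulN1r.
Qed.

Lemma Rint_le f g : L1 mu f -> L1 mu g -> (forall x, f x <= g x) ->
  \int[mu]_x f x <= \int[mu]_x g x.
Proof. by move=> If Ig fg; apply: le_Rintegral. Qed.

Lemma Rint_norm f : L1 mu f -> `|\int[mu]_x f x| <= \int[mu]_x `|f x|.
Proof. by move=> If; apply: le_normr_Rintegral. Qed.

Lemma Rint_norm_le f g : L1 mu f -> L1 mu g -> (forall x, `|f x| <= g x) ->
  `|\int[mu]_x f x| <= \int[mu]_x g x.
Proof.
move=> If Ig fg; apply: (le_trans (Rint_norm If)).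
by apply: Rint_le => //; exact: L1_abs.
Qed.

Lemma Rint_ge0 f : (forall x, 0 <= f x) -> 0 <= \int[mu]_x f x.
Proof. by move=> f0; apply: Rintegral_ge0 => x _; exact: f0. Qed.

Lemma Rint_EFin f : L1 mu f ->
  (\int[mu]_x (f x)%:E)%E = (\int[mu]_x f x)%:E.
Proof. by move=> If; rewrite /Rintegral fineK//; exact: integrable_fin_num. Qed.

Lemma L1_ge0P f C : measurable_fun setT f -> (forall x, 0 <= f x) ->
  (\int[mu]_x (f x)%:E <= C%:E)%E -> L1 mu f /\ \int[mu]_x f x <= C.
Proof.
move=> mf f0 fC.
have If : L1 mu f.
  apply/integrableP; split; first exact/measurable_EFinP.
  apply: le_lt_trans (ltry C); apply: le_trans fC.
  by under eq_integral do rewrite /= ger0_norm//.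
by split=> //; rewrite -lee_fin -Rint_EFin.
Qed.

Lemma L1_ltyP f : measurable_fun setT f -> (forall x, 0 <= f x) ->
  (\int[mu]_x (f x)%:E < +oo)%E -> L1 mu f.
Proof.
move=> mf f0 foo; apply/integrableP; split; first exact/measurable_EFinP.
by under eq_integral do rewrite /= ger0_norm//.
Qed.

Lemma Rint_dct (f_ : nat -> T -> R) f g :
  (forall n, measurable_fun setT (f_ n)) -> measurable_fun setT f ->
  (forall x, f_ n x @[n --> \oo] --> f x) -> L1 mu g ->
  (forall n x, `|f_ n x| <= g x) ->
  L1 mu f /\ (\int[mu]_x f_ n x @[n --> \oo] --> \int[mu]_x f x).
Proof.
move=> mf_ mf f_f ig fg.
have [|||||If _ cf] := @dominated_convergence _ _ _ mu setT measurableT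
    (fun n x => (f_ n x)%:E) (fun x => (f x)%:E) (fun x => (g x)%:E).
- by move=> n; exact/measurable_EFinP.
- exact/measurable_EFinP.
- by apply/aeW => x _; apply: cvg_EFin; [exact: nearW|exact: f_f].
- exact: ig.
- by apply/aeW => x n _ /=; rewrite lee_fin.
split=> //; apply: fine_cvg; rewrite -Rint_EFin//; exact: cf.
Qed.

(** Fatou's lemma as a compactness tool: a common bound on the approximants
    passes to their pointwise limit, together with integrability. *)
Lemma L1_fatou (f_ : nat -> T -> R) f C :
  (forall n, L1 mu (f_ n)) -> measurable_fun setT f ->
  (forall n x, 0 <= f_ n x) ->
  (forall x, f_ n x @[n --> \oo] --> f x) ->
  (forall n, \int[mu]_x f_ n x <= C) ->
  L1 mu f /\ \int[mu]_x f x <= C.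
Proof.
move=> If mf f0 f_f fC.
have fge0 x : 0 <= f x.
  by apply: (cvgr_to_ge (f_f x)); exact: nearW.
apply: L1_ge0P => //.
have mfn n : measurable_fun setT (fun x => (f_ n x)%:E).
  by apply/measurable_EFinP; exact: L1_meas.
have lE x : limn_einf (fun n => (f_ n x)%:E) = (f x)%:E.
  have cE : (f_ n x)%:E @[n --> \oo] --> (f x)%:E.
    by apply: cvg_EFin; [exact: nearW|exact: f_f].
  by have [] := cvg_limn_einf_sup cE.
have := @fatou _ _ _ mu setT measurableT (fun n x => (f_ n x)%:E) mfn.
move=> /(_ (fun n x _ => f0 n x)) fat.
under eq_integral do rewrite -lE.
apply: (le_trans fat); rewrite limn_einf_lim; apply: lime_le.
  exact: is_cvg_einfs.
apply: nearW => n; apply: (@le_trans _ _ (\int[mu]_x (f_ n x)%:E)%E).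
  by apply: ereal_inf_lbound; exists n => /=.
by rewrite Rint_EFin// lee_fin.
Qed.

Lemma ae_eq_Rint f g : measurable_fun setT f -> measurable_fun setT g ->
  {ae mu, forall x, f x = g x} -> \int[mu]_x f x = \int[mu]_x g x.
Proof.
move=> mf mg fg; rewrite /Rintegral; congr fine.
apply: ae_eq_integral => //; try exact/measurable_EFinP.
by apply: filterS fg => x -> _.
Qed.

Lemma ae_eq_L1 f g : measurable_fun setT f -> measurable_fun setT g ->
  {ae mu, forall x, f x = g x} -> L1 mu f -> L1 mu g.
Proof.
move=> mf mg fg /integrableP[_ If]; apply/integrableP; split.
  exact/measurable_EFinP.
apply: le_lt_trans If; rewrite le_eqVlt; apply/orP; left; apply/eqP.
apply: ae_eq_integral => //.
- by apply: measurableT_comp => //; exact/measurable_EFinP.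
- by apply: measurableT_comp => //; exact/measurable_EFinP.
- by apply: filterS fg => x /= -> _.
Qed.

End RealIntegrals.

Section Product.
Context d1 d2 (T1 : measurableType d1) (T2 : measurableType d2) (R : realType).
Variables (m1 : {sigma_finite_measure set T1 -> \bar R})
  (m2 : {sigma_finite_measure set T2 -> \bar R}).
Variables (F : T1 * T2 -> R) (g : T1 -> R) (h : T2 -> R).
Hypothesis mF : measurable_fun setT F.
Hypothesis (Ig : L1 m1 g) (Ih : L1 m2 h).
Hypothesis Fgh : forall x y, `|F (x, y)| <= g x * h y.

(** A product bound on the integrand spares the discussion of iterated
    integrals that the hypotheses of Fubini's theorem would require. *)
Lemma L1_prod : L1 (m1 \x m2)%E F.
Proof.
have mE : measurable_fun setT (EFin \o F) by exact/measurable_EFinP.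
apply/(integrable12ltyP m1 m2 mE).
have gh_ge0 x y : 0 <= g x * h y by apply: le_trans (Fgh x y).
apply: (@le_lt_trans _ _ (\int[m1]_x (`|g x| * \int[m2]_y `|h y|)%:E)%E).
  apply: ge0_le_integral => //.
  - by move=> x _; exact: integral_ge0.
  - apply: (measurable_fun_fubini_tonelli_F (m2 := m2) (abse \o EFin \o F)) => //.
      exact: (measurableT_comp _ mE).
    by move=> z; rewrite /= lee_fin.
  - apply/measurable_EFinP; apply: measurable_funM => //.
    by apply: measurableT_comp => //; exact: L1_meas Ig.
  - move=> x _; rewrite -RintZ; last exact: L1_abs.
    rewrite -Rint_EFin; last by apply: L1Z; exact: L1_abs.
    apply: ge0_le_integral => //.
    + apply/measurable_EFinP; apply: measurableT_comp => //.
      by apply: measurableT_comp => //; exact: pair1_measurable.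
    + apply/measurable_EFinP; apply: measurable_funM => //.
      by apply: measurableT_comp => //; exact: L1_meas Ih.
    + by move=> y _ /=; rewrite lee_fin -normrM (le_trans (Fgh x y))// ler_norm.
rewrite Rint_EFin ?ltry//.
by apply: eq_L1 (L1Z (\int[m2]_y `|h y|) (L1_abs Ig)) => x; rewrite mulrC.
Qed.

Lemma L1_section x : L1 m2 (fun y => F (x, y)).
Proof.
apply: (L1_le _ (L1Z (g x) Ih)) => [|y]; last exact: Fgh.
by apply: measurableT_comp => //; exact: pair1_measurable.
Qed.

Lemma L1_partial : L1 m1 (fun x => \int[m2]_y F (x, y)).
Proof.
have := integrable_fubini_F L1_prod.
apply: eq_integrable => // x _.
by rewrite /fubini_F /= Rint_EFin//; exact: L1_section.
Qed.

End Product.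

Section Fubini.
Context d1 d2 (T1 : measurableType d1) (T2 : measurableType d2) (R : realType).
Variables (m1 : {sigma_finite_measure set T1 -> \bar R})
  (m2 : {sigma_finite_measure set T2 -> \bar R}).

Lemma Rfubini (F : T1 * T2 -> R) (g : T1 -> R) (h : T2 -> R) :
  measurable_fun setT F -> L1 m1 g -> L1 m2 h ->
  (forall x y, `|F (x, y)| <= g x * h y) ->
  \int[m1]_x \int[m2]_y F (x, y) = \int[m2]_y \int[m1]_x F (x, y).
Proof.
move=> mF Ig Ih Fgh.
have mF' : measurable_fun setT (fun z : T2 * T1 => F (z.2, z.1)).
  by apply: measurableT_comp => //; exact: measurable_swap.
have Fhg y x : `|F (x, y)| <= h y * g x by rewrite mulrC.
have := Fubini (L1_prod mF Ig Ih Fgh).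
under eq_integral => x _ do rewrite /= (Rint_EFin (L1_section mF Ih Fgh x)).
rewrite (Rint_EFin (L1_partial mF Ig Ih Fgh)).
under eq_integral => y _ do rewrite /= (Rint_EFin (L1_section mF' Ig Fhg y)).
by rewrite (Rint_EFin (L1_partial mF' Ih Ig Fhg)) => -[].
Qed.

End Fubini.

Section Rmeas.
Context (R : realType).

Lemma RmeasW (f : R -> R) : measurable_fun setT f -> Rmeas f.
Proof. by []. Qed.

Lemma Rmeas_comp d (T : measurableType d) (f : R -> R) (g : T -> R) :
  Rmeas f -> measurable_fun setT g -> measurable_fun setT (fun x => f (g x)).
Proof. by move=> mf mg; apply: (@measurableT_comp _ _ _ _ _ R f _ g). Qed.

Lemma meas_continuous (f : R -> R) : continuous f -> Rmeas f.
Proof. by move=> cf; exact: continuous_measurable_fun. Qed.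

Lemma meas_cos d (T : measurableType d) (f : T -> R) :
  measurable_fun setT f -> measurable_fun setT (fun x => cos (f x)).
Proof. by apply: Rmeas_comp; apply: meas_continuous; exact: continuous_cos. Qed.

Lemma meas_sin d (T : measurableType d) (f : T -> R) :
  measurable_fun setT f -> measurable_fun setT (fun x => sin (f x)).
Proof. by apply: Rmeas_comp; apply: meas_continuous; exact: continuous_sin. Qed.

Lemma meas_expR d (T : measurableType d) (f : T -> R) :
  measurable_fun setT f -> measurable_fun setT (fun x => expR (f x)).
Proof. by apply: Rmeas_comp; apply: meas_continuous; exact: continuous_expR. Qed.

Lemma meas_norm d (T : measurableType d) (f : T -> R) :
  measurable_fun setT f -> measurable_fun setT (fun x => `|f x|).
Proof. by apply: Rmeas_comp; apply: meas_continuous; exact: norm_continuous. Qed.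

Lemma meas_id : Rmeas (fun x : R => x).
Proof. exact: measurable_id. Qed.

Lemma meas_fst : measurable_fun setT
  (fun z : measurableTypeR R * measurableTypeR R => z.1 : R).
Proof. exact: measurable_fst. Qed.

Lemma meas_snd : measurable_fun setT
  (fun z : measurableTypeR R * measurableTypeR R => z.2 : R).
Proof. exact: measurable_snd. Qed.

Lemma meas_inv d (T : measurableType d) (f : T -> R) :
  measurable_fun setT f -> measurable_fun setT (fun x => (f x)^-1).
Proof.
move=> mf; have -> : (fun x => (f x)^-1) = (fun x => f x * ((f x ^+ 2) `^ (-1))).
  apply/funext => x; rewrite powR_inv1 ?sqr_ge0//.
  have [->|f0] := eqVneq (f x) 0; first by rewrite invr0 mul0r.
  by rewrite expr2 invfM mulrA divff// mul1r.
apply: measurable_funM => //.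
by apply: (Rmeas_comp (f := fun y : R => y `^ (-1))); [exact: measurable_powR|exact: measurable_funX].
Qed.

Lemma meas_indic (A : set (measurableTypeR R)) :
  measurable A -> Rmeas (\1_A : R -> R).
Proof. by move=> mA; exact: measurable_indic. Qed.

End Rmeas.

Ltac mftac := repeat first
  [ match goal with H : measurable_fun _ ?f |- measurable_fun _ ?f => exact: H end
  | exact: measurable_cst | exact: meas_id
  | exact: meas_fst | exact: meas_snd
  | apply: measurable_funD | apply: measurable_funM | apply: measurable_funN
  | apply: measurable_funX | apply: meas_cos | apply: meas_sin
  | apply: meas_expR | apply: meas_norm | apply: meas_inv
  | apply: meas_indic | apply: Rmeas_comp
  | assumption ].

(** * Affine changes of variable and the fundamental theorem of calculus *)

Section Affine.
Variable R : realType.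
Implicit Types (f : R -> R) (a b : R).

Lemma eq_L1R f g : f =1 g -> L1 (leb R) f -> L1 (leb R) g.
Proof. by move=> fg; have -> : f = g by apply/funext. Qed.

Lemma measurable_affine a b : measurable_fun setT (fun t : R => a * t + b).
Proof.
by apply: measurable_funD => //; exact: measurable_funM.
Qed.

(** Both sides are measures in A that agree on half-open intervals. *)
Lemma lebesgue_measure_affine a b (A : set R) : a != 0 -> measurable A ->
  leb R A = (`|a|%:E * leb R ((fun t => a * t + b)%R @^-1` A))%E.
Proof.
move=> a0 mA.
pose F : measurableTypeR R -> measurableTypeR R := fun t : R => a * t + b.
have mF : measurable_fun setT F by exact: measurable_affine.
pose pf : {measure set (measurableTypeR R) -> \bar R} :=
  measure_function_pushforward__canonical__measure_function_Measure (leb R) mF.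
pose nu : {measure set (measurableTypeR R) -> \bar R} :=
  mscale (NngNum (normr_ge0 a)) pf.
have -> : leb R A = nu A; last by [].
apply: lebesgue_measure_unique mA => _ [[x y] _ <-] /=.
rewrite /nu /= /mscale /= /pushforward lebesgue_measure_itv/= lte_fin.
have [a_gt0|a_lt0] : 0 < a \/ a < 0.
  by case: (ltgtP a 0) a0 => //; [right|left].
- have -> : (fun t : R => a * t + b) @^-1` `]x, y]%classic =
      `](x - b) / a, (y - b) / a]%classic.
    by apply/seteqP; split=> t /=; rewrite !in_itv/= ltr_pdivrMr// ler_pdivlMr//
      ltrBlDr lerBrDr ![t * a]mulrC.
  rewrite lebesgue_measure_itv/= lte_fin gtr0_norm// ltr_pM2r ?invr_gt0//.
  rewrite ltrD2r; case: ifP => xy; last by rewrite mule0.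
  by rewrite -!EFinB -EFinM; congr EFin; field; exact: lt0r_neq0.
- have -> : (fun t : R => a * t + b) @^-1` `]x, y]%classic =
      `[(y - b) / a, (x - b) / a[%classic.
    by apply/seteqP; split=> t /=; rewrite !in_itv/= ltr_ndivlMr// ler_ndivrMr//
      ltrBlDr lerBrDr ![t * a]mulrC andbC.
  rewrite lebesgue_measure_itv/= lte_fin ltr0_norm// ltr_nM2r ?invr_lt0//.
  rewrite ltrD2r; case: ifP => xy; last by rewrite mule0.
  by rewrite -!EFinB -EFinM; congr EFin; field; exact: ltr0_neq0.
Qed.

Lemma ge0_integral_affine a b (f : R -> \bar R) : a != 0 ->
  measurable_fun setT f -> (forall t, (0 <= f t)%E) ->
  (\int[leb R]_t f t = `|a|%:E * \int[leb R]_t f (a * t + b)%R)%E.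
Proof.
move=> a0 mf f0.
pose F : measurableTypeR R -> measurableTypeR R := fun t : R => a * t + b.
have mF : measurable_fun setT F by exact: measurable_affine.
pose nu : {measure set (measurableTypeR R) -> \bar R} :=
  measure_function_pushforward__canonical__measure_function_Measure (leb R) mF.
transitivity (\int[mscale (NngNum (normr_ge0 a)) nu]_t f t)%E.
  apply: eq_measure_integral => A mA _.
  by first [exact: (lebesgue_measure_affine b a0 mA)
           |exact: (esym (lebesgue_measure_affine b a0 mA))].
rewrite ge0_integral_mscale//=; congr (_ * _)%E.
rewrite /nu /= (ge0_integral_pushforward mF)//.
Qed.

Lemma L1_affine a b f : a != 0 -> L1 (leb R) f ->
  L1 (leb R) (fun t => f (a * t + b)).
Proof.
move=> a0 If; have mf := L1_meas If.
have maf : measurable_fun setT (fun t => f (a * t + b)).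
  by apply: measurableT_comp => //; exact: measurable_affine.
apply/integrableP; split; first exact/measurable_EFinP.
move/integrableP : If => [_].
rewrite (ge0_integral_affine b a0) //=; last first.
  by apply/measurable_EFinP; apply: measurableT_comp.
case: (X in (_ * X)%E) => [r _||]; rewrite ?ltry//.
by rewrite mulry gtr0_sg ?normr_gt0// mul1e.
Qed.

Lemma Rint_affine a b f : a != 0 -> L1 (leb R) f ->
  \int[leb R]_t f t = `|a| * \int[leb R]_t f (a * t + b).
Proof.
move=> a0 If; have mf := L1_meas If.
have Iaf := L1_affine b a0 If.
apply: EFin_inj; rewrite EFinM -!Rint_EFin//.
rewrite integralE [in RHS]integralE muleBr//; last first.
  by rewrite fin_num_adde_defl// fin_numN (integrable_neg_fin_num _ Iaf).
have mEf : measurable_fun setT (EFin \o f) by exact/measurable_EFinP.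
congr (_ - _)%E.
- have := @ge0_integral_affine a b (funepos (EFin \o f)) a0.
  move=> ->//; [congr (_ * _)%E; apply: eq_integral => t _|exact: measurable_funepos].
  by rewrite !funeposE.
- have := @ge0_integral_affine a b (funeneg (EFin \o f)) a0.
  move=> ->//; [congr (_ * _)%E; apply: eq_integral => t _|exact: measurable_funeneg].
  by rewrite !funenegE.
Qed.

Lemma Rint_shift (c : R) f : L1 (leb R) f ->
  \int[leb R]_t f (t - c) = \int[leb R]_t f t.
Proof.
move=> If; rewrite [RHS](@Rint_affine 1 (- c)) ?oner_eq0// normr1 mul1r.
by apply: eq_Rint => t; rewrite mul1r.
Qed.

Lemma Rint_reflect (c : R) f : L1 (leb R) f ->
  \int[leb R]_t f (c - t) = \int[leb R]_t f t.
Proof.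
move=> If; rewrite [RHS](@Rint_affine (-1) c) ?oppr_eq0 ?oner_eq0//.
rewrite normrN1 mul1r.
by apply: eq_Rint => t; rewrite mulN1r addrC.
Qed.

Lemma L1_shift (c : R) f : L1 (leb R) f -> L1 (leb R) (fun t => f (t - c)).
Proof.
move=> If; apply: eq_L1 (@L1_affine 1 (- c) f _ If); rewrite ?oner_eq0//.
by move=> t; rewrite mul1r.
Qed.

Lemma L1_reflect (c : R) f : L1 (leb R) f -> L1 (leb R) (fun t => f (c - t)).
Proof.
move=> If; apply: eq_L1 (@L1_affine (-1) c f _ If); rewrite ?oppr_eq0 ?oner_eq0//.
by move=> t; rewrite mulN1r addrC.
Qed.

End Affine.

Section FTC.
Variable R : realType.
Implicit Types (f F : R -> R) (a b : R).

Lemma is_derive_continuous F (df : R -> R) :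
  (forall x : R, is_derive x (1 : R) F (df x)) -> continuous F.
Proof.
move=> dF x; apply: differentiable_continuous.
by apply/derivable1_diffP; case: (dF x).
Qed.

Lemma FTC_itv f F a b : (forall x : R, is_derive x (1 : R) F (f x)) ->
  continuous f -> a <= b -> \int[leb R]_(x in `[a, b]) f x = F b - F a.
Proof.
move=> dF cf; rewrite le_eqVlt => /predU1P[->|ab].
  by rewrite set_itv1 Rintegral_set1 subrr.
have cF := is_derive_continuous dF.
rewrite /Rintegral (@continuous_FTC2 _ f F)//.
- exact: continuous_subspaceT.
- split=> [x _||]; first by case: (dF x).
  + by apply: cvg_at_right_filter; exact: cF.
  + by apply: cvg_at_left_filter; exact: cF.
- by move=> x _; rewrite derive1E; apply: derive_val.
Qed.

Lemma FTC_0y f F (l : R) : (forall x : R, is_derive x (1 : R) F (f x)) ->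
  continuous f -> (forall x, 0 <= f x) -> F x @[x --> +oo] --> l ->
  (\int[leb R]_(x in `[0%R, +oo[) (f x)%:E = (l - F 0%R)%:E)%E.
Proof.
move=> dF cf f0 Fl; have cF := is_derive_continuous dF.
apply: (@ge0_continuous_FTC2y _ f F 0 l) => //.
- exact: continuous_subspaceT.
- by apply: cvg_at_right_filter; exact: cF.
- by move=> x _; rewrite derive1E; apply: derive_val.
Qed.

Lemma continuous_L1_itv f a b : continuous f ->
  (leb R).-integrable `[a, b] (EFin \o f).
Proof.
move=> cf; apply: continuous_compact_integrable; first exact: segment_compact.
exact: continuous_subspaceT.
Qed.

Lemma Rint_indic (D : set (measurableTypeR R)) f :
  \int[leb R]_(x in D) f x = \int[leb R]_x (\1_D x * f x).
Proof.
rewrite Rintegral_mkcond; apply: eq_Rint => x.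
by rewrite patch_indic mulrC.
Qed.

Lemma L1_indic (D : set (measurableTypeR R)) f : measurable D ->
  (leb R).-integrable D (EFin \o f) -> L1 (leb R) (fun x => \1_D x * f x).
Proof.
move=> mD If; have := (@integrable_mkcond _ _ _ (leb R) D (EFin \o f) mD).1 If.
apply: eq_integrable => // x _.
by rewrite /= /patch indicE; case: (x \in D); rewrite ?mul1r ?mul0r.
Qed.

End FTC.

(** * The Abel and Poisson kernels *)

Section Poisson.
Variable R : realType.
Variable e : R.
Hypothesis e0 : 0 < e.

Definition abel (t : R) : R := expR (- (e * `|t|)).
(** The Fourier transform of the Abel kernel, that is, 2 pi times the Poisson
    kernel of the upper half-plane at height e. *)
Definition poisson (s : R) : R := 2 * e / (e ^+ 2 + s ^+ 2).

Lemma poisson_den s : 0 < e ^+ 2 + s ^+ 2.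
Proof. by rewrite ltr_pwDl ?exprn_gt0// sqr_ge0. Qed.

Lemma abel_gt0 t : 0 < abel t. Proof. exact: expR_gt0. Qed.

Lemma abel_le1 t : `|abel t| <= 1.
Proof.
rewrite gtr0_norm ?abel_gt0// -[leRHS]expR0 ler_expR oppr_le0.
by rewrite mulr_ge0// ltW.
Qed.

Lemma abelN t : abel (- t) = abel t.
Proof. by rewrite /abel normrN. Qed.

Lemma continuous_abel : continuous abel.
Proof.
move=> x; apply: continuous_comp; last exact: continuous_expR.
apply: continuousN; apply: (@continuousM _ _ (cst e)); first exact: cst_continuous.
exact: norm_continuous.
Qed.

(* A primitive of exp (- e t) (1 + cos (s t)) that vanishes at +oo. The added 1
   makes the integrand nonnegative, so that the improper integral is computed
   before integrability is known. *)
Let F s t : R := expR (- (e * t)) * (s * sin (s * t) - e * cos (s * t))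
   / (e ^+ 2 + s ^+ 2) - expR (- (e * t)) / e.

Let dF s t : is_derive t (1 : R) (F s) (expR (- (e * t)) * (1 + cos (s * t))).
Proof.
rewrite /F; apply: is_derive_eq.
rewrite /GRing.scale /=; field.
by rewrite (lt0r_neq0 e0) (lt0r_neq0 (poisson_den s)).
Qed.

Let expR_cvg0 : expR (- (e * t)) @[t --> +oo] --> (0 : R).
Proof.
apply: (@cvg_comp _ _ _ (fun t : R => e * t) (fun t => expR (- t)) _ +oo).
  by apply: gt0_cvgMry => //; exact: cvg_id.
exact: cvgr_expR.
Qed.

Let F_cvg0 s : F s t @[t --> +oo] --> (0 : R).
Proof.
pose C := (`|s| + e) / (e ^+ 2 + s ^+ 2) + e^-1.
have FC t : `|F s t| <= expR (- (e * t)) * C.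
  have E0 := expR_ge0 (- (e * t)).
  apply: (le_trans (ler_normB _ _)); rewrite /C [leRHS]mulrDr; apply: lerD.
    rewrite -mulrA normrM ger0_norm// ler_wpM2l//.
    rewrite normrM [X in _ * X]gtr0_norm ?invr_gt0 ?poisson_den//.
    rewrite ler_wpM2r ?invr_ge0 ?(ltW (poisson_den s))//.
    apply: (le_trans (ler_normB _ _)); apply: lerD.
      by rewrite normrM ler_piMr// ler_norml sin_geN1 sin_le1.
    by rewrite normrM [X in X * _]gtr0_norm// ler_piMr ?(ltW e0)// ler_norml
      cos_geN1 cos_le1.
  by rewrite normrM ger0_norm// [X in _ * X]gtr0_norm// invr_gt0.
have EC : expR (- (e * t)) * C @[t --> +oo] --> (0 : R).
  by rewrite -[0 as X in _ --> X](mul0r C); apply: cvgMl.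
have NEC : - (expR (- (e * t)) * C) @[t --> +oo] --> (0 : R).
  by rewrite -[0 as X in _ --> X]oppr0; apply: cvgN.
apply: squeeze_cvgr NEC EC.
by apply: nearW => t; rewrite -ler_norml.
Qed.

Let int_half s : (\int[leb R]_(t in `[0%R, +oo[)
   (expR (- (e * t)) * (1 + cos (s * t)))%:E = (e^-1 + e / (e ^+ 2 + s ^+ 2))%:E)%E.
Proof.
rewrite (FTC_0y (dF s) _ _ (F_cvg0 s)).
- congr EFin; rewrite /F !mulr0 oppr0 expR0 sin0 cos0; ring.
- apply: (@is_derive_continuous _ _ (fun t => 
    expR (- (e * t)) * - e * (1 + cos (s * t)) + expR (- (e * t)) * (- sin (s * t) * s))).
  move=> t; apply: is_derive_eq; rewrite /GRing.scale /=; ring.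
- move=> x; rewrite mulr_ge0 ?expR_ge0// -lerBlDl sub0r; exact: cos_geN1.
Qed.

Let int_full s : (\int[leb R]_t (abel t * (1 + cos (s * t)))%:E =
  (2 * e^-1 + poisson s)%:E)%E.
Proof.
rewrite ge0_symfun_integralT.
- set I := (\int[_]_(_ in _) _)%E; have -> : I = (e^-1 + e / (e ^+ 2 + s ^+ 2))%:E.
    rewrite /I -set_itvcy -int_half; apply: eq_integral => t.
    by rewrite inE/= in_itv/= andbT => t0; rewrite /abel ger0_norm.
  by rewrite -EFinM; congr EFin; rewrite /poisson; ring.
- move=> x; rewrite mulr_ge0 ?expR_ge0// -lerBlDl sub0r; exact: cos_geN1.
- move=> x; apply: continuousM; first exact: continuous_abel.
  move: x; apply: (@is_derive_continuous _ _ (fun t => - sin (s * t) * s)).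
  by move=> t; apply: is_derive_eq; rewrite /GRing.scale /=; ring.
- by move=> x; rewrite /abel /= normrN mulrN cosN.
Qed.

Let meas_abel_cos s : Rmeas (fun t => abel t * (1 + cos (s * t))).
Proof.
apply: meas_continuous => x; apply: continuousM; first exact: continuous_abel.
move: x; apply: (@is_derive_continuous _ _ (fun t => - sin (s * t) * s)).
by move=> t; apply: is_derive_eq; rewrite /GRing.scale /=; ring.
Qed.

Lemma meas_abel : Rmeas abel.
Proof. exact: meas_continuous continuous_abel. Qed.

Let int_abel_cos1 s : L1 (leb R) (fun t => abel t * (1 + cos (s * t))) /\
  \int[leb R]_t (abel t * (1 + cos (s * t))) = 2 * e^-1 + poisson s.
Proof.
split; last by rewrite /Rintegral int_full.
apply: L1_ltyP => [|x|]; [exact: meas_abel_cos| |by rewrite int_full ltry].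
by rewrite mulr_ge0 ?expR_ge0// -lerBlDl sub0r; exact: cos_geN1.
Qed.

Lemma L1_abel : L1 (leb R) abel.
Proof.
have [If _] := int_abel_cos1 0.
by apply: eq_L1 (L1Z 2^-1 If) => t; rewrite mul0r cos0; lra.
Qed.

Lemma L1_abelM (f : R -> R) : Rmeas f -> (forall t, `|f t| <= 1) ->
  L1 (leb R) (fun t => abel t * f t).
Proof.
by move=> mf f1; apply: eq_L1 (L1_bdM mf f1 L1_abel) => t; rewrite mulrC.
Qed.

Lemma int_abel_cos s : \int[leb R]_t (abel t * cos (s * t)) = poisson s.
Proof.
have [If0 E0] := int_abel_cos1 0; have [If Es] := int_abel_cos1 s.
transitivity (\int[leb R]_t (abel t * (1 + cos (s * t))
   - 2^-1 * (abel t * (1 + cos (0 * t))))).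
  by apply: eq_Rint => t; rewrite mul0r cos0; lra.
rewrite RintB//; last exact: L1Z.
rewrite RintZ// Es E0 /poisson; field.
by rewrite (lt0r_neq0 e0) (lt0r_neq0 (poisson_den s)).
Qed.

Lemma int_abel_sin s : \int[leb R]_t (abel t * sin (s * t)) = 0.
Proof.
have If : L1 (leb R) (fun t => abel t * sin (s * t)).
  apply: L1_abelM => [|t]; last by rewrite ler_norml sin_geN1 sin_le1.
  by mftac.
have : \int[leb R]_t (abel t * sin (s * t)) = - \int[leb R]_t (abel t * sin (s * t)).
  rewrite -{1}(Rint_reflect 0 If) -RintN//; apply: eq_Rint => t.
  by rewrite sub0r /abel normrN mulrN sinN mulrN.
lra.
Qed.

Lemma poisson_gt0 s : 0 < poisson s.
Proof. by rewrite /poisson divr_gt0 ?mulr_gt0 ?poisson_den. Qed.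

Lemma poisson_le s : `|poisson s| <= 2 / e.
Proof.
rewrite gtr0_norm ?poisson_gt0// /poisson ler_pdivrMr ?poisson_den//.
rewrite -subr_ge0 (_ : _ - _ = 2 / e * s ^+ 2); last by field; exact: lt0r_neq0.
by rewrite mulr_ge0 ?sqr_ge0// divr_ge0// ltW.
Qed.

Lemma continuous_poisson : continuous poisson.
Proof.
apply: (@is_derive_continuous _ _ (fun s => 2 * e * (- (e ^+ 2 + s ^+ 2) ^- 2 * (2 * s)))).
move=> t; have nz := lt0r_neq0 (poisson_den t).
by rewrite /poisson; apply: is_derive_eq; rewrite /GRing.scale /=; ring.
Qed.

Lemma int_poisson : L1 (leb R) poisson /\ \int[leb R]_s poisson s = 2 * pi.
Proof.
have mp : Rmeas (fun s : R => (oneDsqr s)^-1).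
  by apply: meas_continuous; exact: continuous_oneDsqrV.
have pos s : 0 <= (oneDsqr s)^-1 :> R by rewrite invr_ge0 (le_trans ler01)// oneDsqr_ge1.
have E : (\int[leb R]_s ((oneDsqr s)^-1)%:E = pi%:E)%E.
  rewrite ge0_symfun_integralT//.
  - by rewrite -set_itvcy integral0y_oneDsqr -EFinM; congr EFin; field.
  - by move=> x; exact: continuous_oneDsqrV.
  - by move=> x; rewrite /oneDsqr /= sqrrN.
have I1 : L1 (leb R) (fun s : R => (oneDsqr s)^-1).
  by apply: L1_ltyP => //; rewrite E ltry.
have ei0 : e^-1 != 0 by rewrite invr_eq0 lt0r_neq0.
have pE s : 2 / e * (oneDsqr (e^-1 * s + 0))^-1 = poisson s.
  rewrite /poisson /oneDsqr addr0.
  have -> : 1 + (e^-1 * s) ^+ 2 = (e ^+ 2 + s ^+ 2) / e ^+ 2.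
    by field; exact: lt0r_neq0.
  rewrite invf_div; field.
  by rewrite (lt0r_neq0 e0) (lt0r_neq0 (poisson_den s)).
split; first by apply: (eq_L1R pE); apply: L1Z; exact: (L1_affine 0 ei0 I1).
rewrite -(eq_Rint (leb R) pE) RintZ; last exact: (L1_affine 0 ei0 I1).
have := Rint_affine 0 ei0 I1; rewrite {1}/Rintegral E /= => ->.
by rewrite gtr0_norm ?invr_gt0//; field; exact: lt0r_neq0.
Qed.

End Poisson.

Lemma abel_cvg1 (R : realType) (t : R) :
  abel n.+1%:R^-1 t @[n --> \oo] --> (1 : R).
Proof.
have c0 : - (n.+1%:R^-1 * `|t|) @[n --> \oo] --> (0 : R).
  rewrite -oppr0; apply: cvgN; rewrite -[0 as X in _ --> X](mul0r `|t|).
  by apply: cvgMl; exact: cvg_harmonic.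
rewrite -[X in _ --> X]expR0.
apply: (@cvg_comp _ _ _ (fun n : nat => - (n.+1%:R^-1 * `|t|)) expR _ (nbhs (0 : R))) => //.
exact: continuous_expR.
Qed.

Lemma poissonE (R : realType) (e s : R) : poisson e s = 2 * e / (e ^+ 2 + s ^+ 2).
Proof. by []. Qed.

Global Opaque abel poisson.

Section Tonelli.
Context d1 d2 (T1 : measurableType d1) (T2 : measurableType d2) (R : realType).
Variables (m1 : {sigma_finite_measure set T1 -> \bar R})
  (m2 : {sigma_finite_measure set T2 -> \bar R}).

(** For nonnegative integrands, integrability of one iterated integral implies that
    of the other one. *)
Lemma Rtonelli (F : T1 * T2 -> R) :
  measurable_fun setT F -> (forall z, 0 <= F z) ->
  (forall x, L1 m2 (fun y => F (x, y))) -> (forall y, L1 m1 (fun x => F (x, y))) ->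
  L1 m2 (fun y => \int[m1]_x F (x, y)) ->
  L1 m1 (fun x => \int[m2]_y F (x, y)) /\
  \int[m1]_x \int[m2]_y F (x, y) = \int[m2]_y \int[m1]_x F (x, y).
Proof.
move=> mF F0 Ix Iy Iyx.
have mE : measurable_fun setT (EFin \o F) by exact/measurable_EFinP.
have E : (\int[m1]_x (\int[m2]_y F (x, y))%:E = (\int[m2]_y \int[m1]_x F (x, y))%:E)%E.
  have := fubini_tonelli (m1 := m1) (m2 := m2) (EFin \o F) mE.
  move=> /(_ (fun z => F0 z)).
  under eq_integral => x _ do rewrite /= Rint_EFin//.
  move=> ->; rewrite -Rint_EFin//.
  by apply: eq_integral => y _; rewrite /= Rint_EFin.
split; last by rewrite /Rintegral E.
apply: L1_ltyP; last by rewrite E ltry.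
- have := @measurable_fun_fubini_tonelli_F _ _ T1 T2 R m2 (EFin \o F) mE (fun z => F0 z).
  have -> : fubini_F m2 (EFin \o F) = EFin \o (fun x => \int[m2]_y F (x, y)).
    by apply/funext => x; rewrite /fubini_F /= Rint_EFin.
  by move/measurable_EFinP.
- by move=> x; exact: Rint_ge0.
Qed.

End Tonelli.

(** * Uniformly continuous functions and moduli of continuity *)

Section Ucont.
Variable R : realType.
Implicit Types f g h : R -> R.

Definition ucont f := forall e : R, 0 < e -> exists2 d : R, 0 < d &
  forall s t : R, `|s - t| < d -> `|f s - f t| < e.

Lemma ucont_continuous f : ucont f -> continuous f.
Proof.
move=> uf x; apply/cvgrPdist_lt => e e0; have [d d0 fd] := uf e e0.
by near=> t; apply: fd; near: t; exact: cvgr_dist_lt.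
Unshelve. all: by end_near. Qed.

Lemma ucont_meas f : ucont f -> Rmeas f.
Proof. by move/ucont_continuous/meas_continuous. Qed.

Lemma abs_sub_le (F df : R -> R) (B a b : R) :
  (forall x : R, is_derive x (1 : R) F (df x)) -> (forall x, `|df x| <= B) ->
  `|F a - F b| <= B * `|a - b|.
Proof.
move=> dF dB; wlog ab : a b / a <= b.
  move=> wl; have [ab|/ltW ab] := leP a b; first exact: wl.
  by rewrite distrC [`|a - b|]distrC; exact: wl.
have cF : {within `[a, b], continuous F}.
  by apply: continuous_subspaceT; apply: (is_derive_continuous dF).
have [c _] := @MVT_segment R F df a b ab (fun x _ => dF x) cF.
by move=> E; rewrite distrC E normrM [`|a - b|]distrC ler_wpM2r.
Qed.

Lemma cos_lip (a b : R) : `|cos a - cos b| <= `|a - b|.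
Proof.
rewrite -[leRHS]mul1r; apply: (@abs_sub_le _ (fun x => - sin x)) => // x.
by rewrite normrN ler_norml sin_geN1 sin_le1.
Qed.

Lemma sin_lip (a b : R) : `|sin a - sin b| <= `|a - b|.
Proof.
rewrite -[leRHS]mul1r; apply: (@abs_sub_le _ (fun x => cos x)) => // x.
by rewrite ler_norml cos_geN1 cos_le1.
Qed.

Lemma cos_abs (a : R) : `|cos a| <= 1.
Proof. by rewrite ler_norml cos_geN1 cos_le1. Qed.

Lemma sin_abs (a : R) : `|sin a| <= 1.
Proof. by rewrite ler_norml sin_geN1 sin_le1. Qed.

Lemma harmonic0 : (n.+1%:R^-1 : R) @[n --> \oo] --> (0 : R).
Proof. exact: cvg_harmonic. Qed.

(** The factor min 2 (d |s|) bounds the increment of cos (t s) and of sin (t s)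
    when t moves by d: this is the common modulus of continuity of the transforms
    of h. *)
Lemma modulus_cvg0 h : L1 (leb R) h ->
  forall e, 0 < e -> exists2 d : R, 0 < d &
   \int[leb R]_s (Num.min 2 (d * `|s|) * `|h s|) < e.
Proof.
move=> Ih e e0; have mh := L1_meas Ih.
have mm n : Rmeas (fun s : R => Num.min 2 (n.+1%:R^-1 * `|s|) * `|h s|).
  apply: measurable_funM; last by mftac.
  by apply: measurable_minr; mftac.
have [||||_ cv] := @Rint_dct _ _ _ (leb R) 
  (fun n (s : R) => Num.min 2 (n.+1%:R^-1 * `|s|) * `|h s|) (fun=> 0) (fun s => 2 * `|h s|) mm.
- by mftac.
- move=> s; rewrite -[0 as X in _ --> X](mul0r `|h s|); apply: cvgMl.
  have c0 : n.+1%:R^-1 * `|s| @[n --> \oo] --> (0 : R).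
    by rewrite -[0 as X in _ --> X](mul0r `|s|); apply: cvgMl; exact: harmonic0.
  apply: squeeze_cvgr; [|exact: cvg_cst|exact: c0].
  apply: nearW => n; by rewrite le_min ler0n mulr_ge0//= ge_min lexx orbT.
- by apply: L1Z; exact: L1_abs.
- move=> n s; rewrite normrM normr_id ler_wpM2r// ger0_norm ?ge_min ?lexx//.
rewrite (_ : \int[leb R]_x 0 = 0) in cv; last by rewrite /Rintegral integral0.
have /cvgrPdist_lt/(_ e e0) [N _ /(_ N (leqnn N))] := cv.
rewrite /= sub0r normrN => NE; exists N.+1%:R^-1 => //; apply: le_lt_trans NE; exact: ler_norm.
Qed.

Lemma ucont_modulus (K : R -> R) h f : Rmeas K ->
  (forall a b, `|K a - K b| <= `|a - b|) -> (forall a, `|K a| <= 1) ->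
  L1 (leb R) h -> (forall t, f t = \int[leb R]_s (K (t * s) * h s)) -> ucont f.
Proof.
move=> mK Kl K1 Ih fE e e0; have mh := L1_meas Ih.
have [d d0 de] := modulus_cvg0 Ih e0; exists d => // s t st.
have IK u : L1 (leb R) (fun x => K (u * x) * h x).
  by apply: L1_bdM Ih => //; mftac.
rewrite !fE -RintB//; apply: le_lt_trans de; apply: Rint_norm_le; first exact: L1B.
- apply: (L1_le _ (L1Z 2 (L1_abs Ih))).
    apply: measurable_funM; last by mftac.
    by apply: measurable_minr; mftac.
  move=> x; rewrite normrM normr_id ler_wpM2r// ger0_norm ?ge_min ?lexx//.
  by rewrite le_min ler0n mulr_ge0// ltW.
- move=> x; rewrite -mulrBl normrM ler_wpM2r// le_min; apply/andP; split.
    apply: (le_trans (ler_normB _ _)).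
    by rewrite (_ : 2 = 1 + 1)//; apply: lerD.
  apply: (le_trans (Kl _ _)); rewrite -mulrBl normrM ler_wpM2r//.
  exact: ltW.
Qed.

End Ucont.

(** * Cosine and sine transforms, and the Plancherel inequality *)

Section Transforms.
Variable R : realType.
Implicit Types f g h : R -> R.

(** For real h, the Fourier transform of h is Ct h - i St h; the two real
    transforms are integrated separately. *)
Definition Ct h (t : R) : R := \int[leb R]_s (cos (t * s) * h s).
Definition St h (t : R) : R := \int[leb R]_s (sin (t * s) * h s).

Lemma L1_cosM h t : L1 (leb R) h -> L1 (leb R) (fun s => cos (t * s) * h s).
Proof. by move=> Ih; apply: (@L1_bdM _ _ _ _ _ _ 1) => // [|x]; [mftac|exact: cos_abs]. Qed.

Lemma L1_sinM h t : L1 (leb R) h -> L1 (leb R) (fun s => sin (t * s) * h s).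
Proof. by move=> Ih; apply: (@L1_bdM _ _ _ _ _ _ 1) => // [|x]; [mftac|exact: sin_abs]. Qed.

Lemma ucont_Ct h : L1 (leb R) h -> ucont (Ct h).
Proof.
move=> Ih; apply: (@ucont_modulus _ cos h) => //; [|exact: cos_lip|exact: cos_abs].
by mftac.
Qed.

Lemma ucont_St h : L1 (leb R) h -> ucont (St h).
Proof.
move=> Ih; apply: (@ucont_modulus _ sin h) => //; [|exact: sin_lip|exact: sin_abs].
by mftac.
Qed.

Lemma Ct_le h t : L1 (leb R) h -> `|Ct h t| <= \int[leb R]_s `|h s|.
Proof.
move=> Ih; apply: Rint_norm_le; [exact: L1_cosM|exact: L1_abs|move=> x].
by rewrite normrM ler_piMl// cos_abs.
Qed.

Lemma St_le h t : L1 (leb R) h -> `|St h t| <= \int[leb R]_s `|h s|.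
Proof.
move=> Ih; apply: Rint_norm_le; [exact: L1_sinM|exact: L1_abs|move=> x].
by rewrite normrM ler_piMl// sin_abs.
Qed.

(** Fubini's theorem, since the cosine transform of the Abel kernel is the
    Poisson kernel. *)
Lemma abel_inversion h (e s : R) : 0 < e -> L1 (leb R) h ->
  \int[leb R]_t (abel e t * (cos (t * s) * Ct h t + sin (t * s) * St h t)) =
  \int[leb R]_r (h r * poisson e (s - r)).
Proof.
move=> e0 Ih; have mh := L1_meas Ih; have mab := meas_abel e.
transitivity (\int[leb R]_t \int[leb R]_r (abel e t * cos (t * (s - r)) * h r)).
  apply: eq_Rint => t; rewrite -!RintZ ?[L1 _ _]L1_cosM ?[L1 _ _]L1_sinM//.
  rewrite -RintD; [|by apply: L1Z; exact: L1_cosM|by apply: L1Z; exact: L1_sinM].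
  rewrite -RintZ; last by apply: L1D; apply: L1Z; [exact: L1_cosM|exact: L1_sinM].
  by apply: eq_Rint => r; rewrite mulrBr cosB; ring.
rewrite (@Rfubini _ _ _ _ _ (leb R) (leb R) (fun z : measurableTypeR R * measurableTypeR R =>
    abel e z.1 * cos (z.1 * (s - z.2)) * h z.2) (abel e) (fun r => `|h r|)).
- apply: eq_Rint => r; rewrite -(int_abel_cos e0) -RintZ.
    by apply: eq_Rint => t /=; rewrite [t * _]mulrC; ring.
  by apply: L1_abelM => // [|x]; [mftac|exact: cos_abs].
- by mftac.
- exact: L1_abel.
- exact: L1_abs.
- move=> x y; rewrite /= normrM ler_wpM2r// normrM gtr0_norm ?abel_gt0//.
  by rewrite ler_piMr ?cos_abs// ltW ?abel_gt0.
Qed.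

(** Expanding the squares and integrating in t first turns the left-hand side
    into the quadratic form of the Poisson kernel at h. As this kernel is
    nonnegative and has mass 2 pi in each variable, 2 x y <= x^2 + y^2 bounds the
    form. *)
Lemma plancherel_abel h (e : R) : 0 < e -> L1 (leb R) h ->
  L1 (leb R) (fun s => h s ^+ 2) ->
  L1 (leb R) (fun t => abel e t * (Ct h t ^+ 2 + St h t ^+ 2)) /\
  \int[leb R]_t (abel e t * (Ct h t ^+ 2 + St h t ^+ 2))
    <= 2 * pi * \int[leb R]_s (h s ^+ 2).
Proof.
move=> e0 Ih Ih2; have mh := L1_meas Ih; have mab := meas_abel e.
have mC := ucont_meas (ucont_Ct Ih); have mS := ucont_meas (ucont_St Ih).
have [Ip pE] := int_poisson e0; have mp := meas_continuous (continuous_poisson e0).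
set H := \int[leb R]_s `|h s|.
have H0 : 0 <= H by exact: Rint_ge0.
have Ipl : L1 (leb R) (fun t => abel e t * (Ct h t ^+ 2 + St h t ^+ 2)).
  apply: (L1_le _ (L1Z (2 * H ^+ 2) (L1_abel e0))); first by mftac.
  move=> t; rewrite normrM gtr0_norm ?abel_gt0// mulrC ler_wpM2r ?(ltW (abel_gt0 _ _))//.
  rewrite ger0_norm ?addr_ge0 ?sqr_ge0// -[Ct h t ^+ 2]real_normK ?num_real// -[St h t ^+ 2]real_normK ?num_real//.
  have c1 := Ct_le t Ih; have s1 := St_le t Ih.
  by rewrite mulrDl mul1r; apply: lerD; rewrite lerXn2r ?nnegrE.
have pr u : 0 <= poisson e u by exact: ltW (poisson_gt0 e0 _).
have Ips s : L1 (leb R) (fun r => poisson e (s - r)) by exact: L1_reflect.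
have Ipr s : L1 (leb R) (fun r => poisson e (r - s)) by exact: L1_shift.
have Ep s : \int[leb R]_r poisson e (s - r) = 2 * pi by rewrite Rint_reflect.
have Er s : \int[leb R]_r poisson e (r - s) = 2 * pi by rewrite Rint_shift.
have Ihp s (f : R -> R) : L1 (leb R) f -> L1 (leb R) (fun r => f r * poisson e (s - r)).
  move=> If; apply: (eq_L1R _ (@L1_bdM _ _ _ (leb R) (fun r => poisson e (s - r)) f (2 / e) _ _ If)).
  - by move=> r; rewrite mulrC.
  - by mftac.
  - by move=> r; exact: poisson_le.
have Ihp' s (f : R -> R) : L1 (leb R) f -> L1 (leb R) (fun r => f r * poisson e (r - s)).
  move=> If; apply: (eq_L1R _ (@L1_bdM _ _ _ (leb R) (fun r => poisson e (r - s)) f (2 / e) _ _ If)).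
  - by move=> r; rewrite mulrC.
  - by mftac.
  - by move=> r; exact: poisson_le.
split=> //.
have CS t s : `|cos (t * s) * Ct h t + sin (t * s) * St h t| <= 2 * H.
  have c1 := Ct_le t Ih; have s1 := St_le t Ih.
  apply: (le_trans (ler_normD _ _)); rewrite mulrDl mul1r; apply: lerD; rewrite normrM.
    by apply: (le_trans _ c1); rewrite ler_piMl// cos_abs.
  by apply: (le_trans _ s1); rewrite ler_piMl// sin_abs.
have Ihp2 : L1 (leb R) (fun s => h s * \int[leb R]_r (h r * poisson e (s - r))).
  have mF : measurable_fun setT (fun z : measurableTypeR R * measurableTypeR R =>
    h z.1 * (h z.2 * poisson e (z.1 - z.2))) by mftac.
  apply: (eq_L1R _ (L1_partial (m1 := leb R) (m2 := leb R) mF (L1_abs Ih) (L1Z (2 / e) (L1_abs Ih)) _)).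
    by move=> s /=; rewrite (RintZ _ (Ihp s h Ih)).
  move=> s r /=; rewrite normrM ler_wpM2l// normrM mulrC ler_wpM2r//.
  exact: poisson_le.
(* The quadratic form of the Poisson kernel, by abel_inversion. *)
have -> : \int[leb R]_t (abel e t * (Ct h t ^+ 2 + St h t ^+ 2)) =
    \int[leb R]_s (h s * \int[leb R]_r (h r * poisson e (s - r))).
  transitivity (\int[leb R]_t \int[leb R]_s (abel e t * (cos (t * s) * Ct h t + sin (t * s) * St h t) * h s)).
    apply: eq_Rint => t.
    have E s : abel e t * (cos (t * s) * Ct h t + sin (t * s) * St h t) * h s =
      (abel e t * Ct h t) * (cos (t * s) * h s) + (abel e t * St h t) * (sin (t * s) * h s) by ring.
    under [RHS]eq_Rint do rewrite E.
    rewrite RintD; [|by apply: L1Z; exact: L1_cosM|by apply: L1Z; exact: L1_sinM].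
    rewrite !RintZ; [|exact: L1_sinM|exact: L1_cosM].
    rewrite -/(Ct h t) -/(St h t); ring.
  rewrite (@Rfubini _ _ _ _ _ (leb R) (leb R) (fun z : measurableTypeR R * measurableTypeR R =>
    abel e z.1 * (cos (z.1 * z.2) * Ct h z.1 + sin (z.1 * z.2) * St h z.1) * h z.2)
      (fun t => 2 * H * abel e t) (fun r => `|h r|)).
  - apply: eq_Rint => s /=; rewrite -(abel_inversion s e0 Ih) -RintZ.
      by apply: eq_Rint => t; ring.
    apply: (L1_le _ (L1Z (2 * H) (L1_abel e0))) => [|t]; first by mftac.
    by rewrite normrM gtr0_norm ?abel_gt0// mulrC ler_wpM2r ?(ltW (abel_gt0 _ _))// CS.
  - by mftac.
  - by apply: L1Z; exact: L1_abel.
  - exact: L1_abs.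
  - move=> t s /=; rewrite normrM ler_wpM2r// normrM gtr0_norm ?abel_gt0// mulrC.
    by rewrite ler_wpM2r ?(ltW (abel_gt0 _ _))// CS.
(* Bound of the form by half of the two diagonal terms, each of mass 2 pi. *)
have [|||||I1 E1] := @Rtonelli _ _ _ _ R (leb R) (leb R) (fun z : measurableTypeR R * measurableTypeR R =>
   h z.2 ^+ 2 * poisson e (z.1 - z.2)).
- by mftac.
- by move=> z; rewrite mulr_ge0 ?sqr_ge0.
- by move=> s /=; exact: Ihp.
- by move=> r /=; apply: L1Z; exact: Ipr.
- apply: (eq_L1R _ (L1Z (2 * pi) Ih2)) => r /=.
  by rewrite (RintZ _ (Ipr r)) Er mulrC.
rewrite /= in I1 E1.
have I2 : L1 (leb R) (fun s => \int[leb R]_r (h s ^+ 2 * poisson e (s - r))).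
  apply: (eq_L1R _ (L1Z (2 * pi) Ih2)) => s /=.
  by rewrite (RintZ _ (Ips s)) Ep mulrC.
have E2 : \int[leb R]_s \int[leb R]_r (h s ^+ 2 * poisson e (s - r)) = 
   2 * pi * \int[leb R]_s (h s ^+ 2).
  by rewrite -(RintZ _ Ih2); apply: eq_Rint => s; rewrite (RintZ _ (Ips s)) Ep mulrC.
have E3 : \int[leb R]_s \int[leb R]_r (h r ^+ 2 * poisson e (s - r)) = 
   2 * pi * \int[leb R]_s (h s ^+ 2).
  by rewrite E1 -(RintZ _ Ih2); apply: eq_Rint => s; rewrite (RintZ _ (Ipr s)) Er mulrC.
apply: (@le_trans _ _ (\int[leb R]_s (2^-1 * (\int[leb R]_r (h s ^+ 2 * poisson e (s - r)) +
   \int[leb R]_r (h r ^+ 2 * poisson e (s - r)))))).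
  apply: Rint_le.
  - exact: Ihp2.
  - by apply: L1Z; exact: (L1D I2 I1).
  - move=> s; have A1 := Ihp s h Ih; have A2 := L1Z (h s ^+ 2) (Ips s).
    have A3 := Ihp s _ Ih2.
    rewrite -(RintZ (h s) A1) -(RintD A2 A3) -(RintZ 2^-1 (L1D A2 A3)).
    apply: (Rint_le (L1Z (h s) A1) (L1Z 2^-1 (L1D A2 A3))).
    move=> r; rewrite mulrA -mulrDl [leRHS]mulrA ler_wpM2r//.
    rewrite -subr_ge0 (_ : _ - _ = 2^-1 * (h s - h r) ^+ 2); last by field.
    by rewrite mulr_ge0 ?sqr_ge0 ?invr_ge0.
have half_twice (x : R) : 2^-1 * (x + x) = x by field.
by rewrite (RintZ _ (L1D I2 I1)) (RintD I2 I1) E2 E3 half_twice.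
Qed.

(** The inequality half of Plancherel's theorem: the weight abel e increases to 1
    as e tends to 0, and Fatou's lemma applies. *)
Lemma plancherel h : L1 (leb R) h -> L1 (leb R) (fun s => h s ^+ 2) ->
  L1 (leb R) (fun t => Ct h t ^+ 2 + St h t ^+ 2) /\
  \int[leb R]_t (Ct h t ^+ 2 + St h t ^+ 2) <= 2 * pi * \int[leb R]_s (h s ^+ 2).
Proof.
move=> Ih Ih2.
have mC := ucont_meas (ucont_Ct Ih); have mS := ucont_meas (ucont_St Ih).
pose en (n : nat) : R := n.+1%:R^-1.
have en0 n : 0 < en n by rewrite invr_gt0.
apply: (@L1_fatou _ _ _ (leb R) (fun n t => abel (en n) t * (Ct h t ^+ 2 + St h t ^+ 2))).
- by move=> n; have [] := plancherel_abel (en0 n) Ih Ih2.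
- by mftac.
- move=> n t; rewrite mulr_ge0 ?(ltW (abel_gt0 _ _))// addr_ge0 ?sqr_ge0//.
- move=> t; rewrite -[X in _ --> X]mul1r; apply: cvgMl; exact: abel_cvg1.
- by move=> n; have [] := plancherel_abel (en0 n) Ih Ih2.
Qed.

End Transforms.

(** * Poisson averages, completeness of L2 and decay at infinity *)

Section ApproximateIdentity.
Variable R : realType.

Lemma poisson_scale (e s : R) : 0 < e -> e * poisson e (e * s) = poisson 1 s.
Proof.
move=> e0; rewrite poissonE poissonE; field.
have := poisson_den ltr01 s; have := poisson_den e0 (e * s).
rewrite !expr1n => h1 h2; rewrite (lt0r_neq0 h2) (lt0r_neq0 h1) //.
Qed.

(** The averaged function depends on n to allow for truncations that follow the
    width of the kernel. Rescaling the variable by this width leaves a dominated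
    convergence against poisson 1. *)
Lemma poisson_approx (h_ : nat -> R -> R) (B l c : R) :
  (forall n, L1 (leb R) (h_ n)) -> (forall n s, `|h_ n s| <= B) ->
  (forall s : R, h_ n (l - n.+1%:R^-1 * s) @[n --> \oo] --> c) ->
  \int[leb R]_r (h_ n r * poisson n.+1%:R^-1 (l - r)) @[n --> \oo] --> 2 * pi * c.
Proof.
move=> Ih hB hc; pose en (n : nat) : R := n.+1%:R^-1.
have en0 n : 0 < en n by rewrite invr_gt0.
have [I1 E1] := int_poisson (@ltr01 R).
have mp := meas_continuous (continuous_poisson (@ltr01 R)).
have mh n := L1_meas (Ih n).
have E n : \int[leb R]_r (h_ n r * poisson (en n) (l - r)) =
    \int[leb R]_s (h_ n (l - en n * s) * poisson 1 s).
  have a0 : - en n != 0 by rewrite oppr_eq0 lt0r_neq0.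
  have Ihp : L1 (leb R) (fun r => h_ n r * poisson (en n) (l - r)).
    have mpe := meas_continuous (continuous_poisson (en0 n)).
    apply: (eq_L1R _ (@L1_bdM _ _ _ (leb R) (fun r => poisson (en n) (l - r)) (h_ n) (2 / en n) _ _ (Ih n))).
    - by move=> r; rewrite mulrC.
    - by mftac.
    - by move=> r; exact: poisson_le.
  have J := L1_affine l a0 Ihp.
  rewrite (Rint_affine l a0 Ihp) normrN gtr0_norm// -(RintZ _ J).
  apply: eq_Rint => s /=; rewrite mulNr addrC opprB addrCA subrr addr0.
  by rewrite mulrCA poisson_scale.
under eq_cvg do rewrite E.
have -> : 2 * pi * c = \int[leb R]_s (c * poisson 1 s) by rewrite (RintZ _ I1) E1 mulrC.
have [|||||//] := @Rint_dct _ _ _ (leb R) (fun n s => h_ n (l - en n * s) * poisson 1 s)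
  (fun s => c * poisson 1 s) (fun s => B * poisson 1 s).
- by move=> n; have mhn := mh n; mftac.
- by mftac.
- by move=> s; apply: cvgMl; exact: hc.
- exact: L1Z.
- move=> n s; rewrite normrM [X in _ * X]gtr0_norm ?poisson_gt0// ler_wpM2r//.
  exact: ltW (poisson_gt0 _ _).
Qed.

End ApproximateIdentity.

Section L2limit.
Context d (T : measurableType d) (R : realType).
Variable mu : {measure set T -> \bar R}.

(** Completeness of L2 for sequences with a given geometric rate, which avoids
    extracting subsequences. Even weighted by 2^k, the squared increments have a
    finite total integral; so for almost every x they are summable, and then the
    increments too, as 2 |d| <= 2^-k + 2^k d^2. Fatou's lemma passes the rate to
    the limit. *)
Lemma L2_limit (f_ : nat -> T -> R) (C : R) :
  (forall n, measurable_fun setT (f_ n)) -> L1 mu (fun x => f_ 0%N x ^+ 2) ->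
  (forall n m, (n <= m)%N -> L1 mu (fun x => (f_ m x - f_ n x) ^+ 2) /\
     \int[mu]_x ((f_ m x - f_ n x) ^+ 2) <= C * 4^-1 ^+ n) ->
  exists f : T -> R, [/\ measurable_fun setT f, L1 mu (fun x => f x ^+ 2) &
    forall n, L1 mu (fun x => (f x - f_ n x) ^+ 2) /\
     \int[mu]_x ((f x - f_ n x) ^+ 2) <= C * 4^-1 ^+ n].
Proof.
move=> mf I0 Inm.
pose dd n x := f_ n.+1 x - f_ n x.
have md n : measurable_fun setT (dd n) by apply: measurable_funB.
pose D x := (\sum_(0 <= k <oo) ((2 : R) ^+ k * dd k x ^+ 2)%:E)%E.
have mk k : measurable_fun setT (fun x => ((2 : R) ^+ k * dd k x ^+ 2)%:E).
  apply/measurable_EFinP; apply: measurable_funM => //.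
  by apply: measurable_funX.
have D0 k x : (0 <= ((2 : R) ^+ k * dd k x ^+ 2)%:E)%E.
  by rewrite lee_fin mulr_ge0 ?sqr_ge0// exprn_ge0.
have mD : measurable_fun setT D.
  by apply: ge0_emeasurable_sum => // k x _ _; exact: D0.
have ID : (\int[mu]_x D x < +oo)%E.
  rewrite integral_nneseries//.
  have C0 : 0 <= C.
    have [_] := Inm 0%N 0%N (leqnn 0); rewrite expr0 mulr1; apply: le_trans.
    by apply: Rint_ge0 => x; exact: sqr_ge0.
  have Ck k : (\int[mu]_x ((2 : R) ^+ k * dd k x ^+ 2)%:E <= (C * 2^-1 ^+ k)%:E)%E.
    have [Ik Bk] := Inm k k.+1 (leqnSn k).
    rewrite Rint_EFin; last exact: L1Z.
    rewrite lee_fin (RintZ _ Ik); apply: (@le_trans _ _ (2 ^+ k * (C * 4^-1 ^+ k))).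
      by rewrite ler_wpM2l// exprn_ge0.
    rewrite mulrCA -exprMn (_ : 2 * 4^-1 = 2^-1 :> R)//; by field.
  have sumC n : \sum_(0 <= k < n) (C * 2^-1 ^+ k) = 2 * C * (1 - 2^-1 ^+ n).
    elim: n => [|n IH]; first by rewrite big_nil expr0 subrr mulr0.
    by rewrite big_nat_recr//= IH exprS; field.
  apply: (@le_lt_trans _ _ (2 * C)%:E); last exact: ltry.
  apply: lime_le; first by apply: is_cvg_nneseries => k _ _; apply: integral_ge0 => x _; exact: D0.
  apply: nearW => n; apply: (@le_trans _ _ (\sum_(0 <= k < n) (C * 2^-1 ^+ k)%:E)%E).
    by apply: lee_sum => k _; exact: Ck.
  rewrite sumEFin lee_fin sumC ler_piMr ?mulr_ge0//.
pose Om := [set x | D x \is a fin_num].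
have mOm : measurable Om.
  by rewrite -[Om]setTI; apply: emeasurable_fin_num.
have aeOm : {ae mu, forall x, Om x}.
  have : mu.-integrable setT D.
    apply/integrableP; split=> //; apply: le_lt_trans ID.
    apply: ge0_le_integral => //; first by apply: measurableT_comp.
    by move=> x _; rewrite gee0_abs// nneseries_ge0// => k _ _; exact: D0.
  by move/integrable_ae => /(_ measurableT); apply: filterS => x /(_ I).
have cvOm x : Om x -> cvgn (fun n => f_ n x).
  rewrite /Om /= => Ox.
  have DB n : \sum_(0 <= k < n) (2 ^+ k * dd k x ^+ 2) <= fine (D x).
    rewrite -lee_fin fineK// -sumEFin.
    by apply: nneseries_lim_ge => k _ _; exact: D0.
  have dB n : \sum_(0 <= k < n) `|dd k x| <= 1 + 2^-1 * fine (D x).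
    apply: (@le_trans _ _ (\sum_(0 <= k < n) (2^-1 * (2^-1 ^+ k) + 2^-1 * (2 ^+ k * dd k x ^+ 2)))).
      apply: ler_sum => k _; have k0 : 0 < (2 : R) ^+ k by exact: exprn_gt0.
      rewrite exprVn -subr_ge0 -[dd k x ^+ 2]real_normK ?num_real//.
      rewrite (_ : _ - _ = 2^-1 * (2 ^+ k)^-1 * (2 ^+ k * `|dd k x| - 1) ^+ 2).
        by apply: mulr_ge0; [rewrite mulr_ge0 ?invr_ge0// ltW|exact: sqr_ge0].
      by field; exact: lt0r_neq0.
    rewrite big_split /= -!mulr_sumr; apply: lerD; last by rewrite ler_wpM2l ?invr_ge0.
    have -> : \sum_(0 <= k < n) 2^-1 ^+ k = 2 * (1 - 2^-1 ^+ n) :> R.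
      elim: n => [|n IH]; first by rewrite big_nil expr0 subrr mulr0.
      by rewrite big_nat_recr//= IH exprS; field.
    by rewrite mulrA mulVf// mul1r lerBlDl lerDr exprn_ge0// invr_ge0.
  have cs : cvgn (series (fun k => dd k x)).
    apply: normed_cvg; apply: nondecreasing_is_cvgn.
      by apply: nondecreasing_series => k _ _; exact: normr_ge0.
    by exists (1 + 2^-1 * fine (D x)) => _ [n _ <-]; exact: dB.
  have -> : (fun n => f_ n x) = (fun n => f_ 0%N x + series (fun k => dd k x) n).
    apply/funext => n; rewrite /series /= /dd telescope_sumr// addrC subrK //.
  by apply: is_cvgD => //; exact: is_cvg_cst.
(* Convergence everywhere, so that the limit is a measurable function. *)
pose g_ n x := \1_Om x * f_ n x.
pose f x := limn (fun n => g_ n x).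
have gf x : g_ n x @[n --> \oo] --> f x.
  apply/cvg_ex; rewrite /g_; have [xO|xO] := boolP (x \in Om).
    exists (limn (fun n => f_ n x)).
    under eq_cvg do rewrite indicE xO mul1r.
    by apply: cvOm; rewrite inE in xO.
  exists 0; under eq_cvg do rewrite indicE (negbTE xO) mul0r.
  exact: cvg_cst.
have mg n : measurable_fun setT (g_ n).
  by apply: measurable_funM => //; exact: measurable_indic.
have mff : measurable_fun setT f.
  by apply: (measurable_fun_cvg mg) => x _; exact: gf.
have gfE n : {ae mu, forall x, g_ n x = f_ n x}.
  by apply: filterS aeOm => x Ox; rewrite /g_ indicE mem_set// mul1r.
have key n : L1 mu (fun x => (f x - f_ n x) ^+ 2) /\
     \int[mu]_x ((f x - f_ n x) ^+ 2) <= C * 4^-1 ^+ n.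
  have [J1 J2] : L1 mu (fun x => (f x - g_ n x) ^+ 2) /\
     \int[mu]_x ((f x - g_ n x) ^+ 2) <= C * 4^-1 ^+ n.
    apply: (@L1_fatou _ _ _ mu (fun m x => (g_ (m + n)%N x - g_ n x) ^+ 2)).
    - move=> m; have [Imn _] := Inm n (m + n)%N (leq_addl _ _).
      apply: (L1_le _ Imn); first by apply: measurable_funX; exact: measurable_funB.
      move=> x; rewrite ger0_norm ?sqr_ge0// /g_ indicE; case: (x \in Om).
        by rewrite !mul1r.
      by rewrite !mul0r subrr expr0n sqr_ge0.
    - by apply: measurable_funX; exact: measurable_funB.
    - by move=> m x; exact: sqr_ge0.
    - move=> x; have cB : g_ (m + n)%N x - g_ n x @[m --> \oo] --> f x - g_ n x.
        apply: cvgB; last exact: cvg_cst.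
        by rewrite (cvg_shiftn n (fun m => g_ m x)); exact: gf.
      by rewrite expr2; under eq_cvg do rewrite expr2; exact: cvgM.
    - move=> m; have [Imn Bmn] := Inm n (m + n)%N (leq_addl _ _).
      apply: le_trans Bmn; apply: Rint_le => //.
        apply: (L1_le _ Imn); first by apply: measurable_funX; exact: measurable_funB.
        move=> x; rewrite ger0_norm ?sqr_ge0// /g_ indicE; case: (x \in Om).
          by rewrite !mul1r.
        by rewrite !mul0r subrr expr0n sqr_ge0.
      move=> x; rewrite /g_ indicE; case: (x \in Om).
        by rewrite !mul1r.
      by rewrite !mul0r subrr expr0n sqr_ge0.
  have mfg : measurable_fun setT (fun x => (f x - g_ n x) ^+ 2).
    by apply: measurable_funX; exact: measurable_funB.
  have mff' : measurable_fun setT (fun x => (f x - f_ n x) ^+ 2).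
    by apply: measurable_funX; exact: measurable_funB.
  have E : {ae mu, forall x, (f x - g_ n x) ^+ 2 = (f x - f_ n x) ^+ 2}.
    by apply: filterS (gfE n) => x ->.
  by split; [exact: ae_eq_L1 E J1|rewrite -(ae_eq_Rint mfg mff' E)].
have [K1 _] := key 0%N.
exists f; split => //.
apply: (eq_L1 _ (L1_sqD (measurable_funB mff (mf 0%N)) (mf 0%N) K1 I0)).
by move=> x /=; rewrite subrK.
Qed.

End L2limit.

Section Vanishing.
Variable R : realType.

(** A value of size e at t persists, up to a factor 2, on [t, t + d/2] with d
    independent of t: at large t this contradicts the smallness of the tails of
    the integral of f^2. *)
Lemma ucont_L2_vanish (f : R -> R) : ucont f -> L1 (leb R) (fun t => f t ^+ 2) ->
  forall e : R, 0 < e -> exists A : R, forall t, A < `|t| -> `|f t| < e.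
Proof.
move=> uf I2 e e0; have mf := ucont_meas uf.
have [d d0 fd] := uf (e / 2) (divr_gt0 e0 (@ltr0n R 2)).
pose Tn (n : nat) := [set t : measurableTypeR R | n%:R <= `|t|].
have mT n : measurable (Tn n).
  rewrite -[Tn n]setTI; apply: (@measurable_fun_ler _ _ _ setT (fun=> n%:R) (fun t : measurableTypeR R => `|t|)) => //.
  by mftac.
have [|||||_ cv] := @Rint_dct _ _ _ (leb R) (fun n t => \1_(Tn n) t * f t ^+ 2)
   (fun=> 0) (fun t => f t ^+ 2).
- by move=> n; mftac; exact: mT.
- by mftac.
- move=> t; apply: cvg_near_cst.
  near=> n; rewrite indicE memNset ?mul0r//; rewrite /Tn /=; apply/negP.
  rewrite -ltNge; near: n; exact: nbhs_infty_gtr.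
- exact: I2.
- move=> n t; rewrite normrM [X in _ * X]ger0_norm ?sqr_ge0// indicE; case: (t \in _) => /=.
    by rewrite normr1 mul1r.
  by rewrite normr0 mul0r sqr_ge0.
rewrite (_ : \int[leb R]_x 0 = 0) in cv; last by rewrite /Rintegral integral0.
have c0 : 0 < d / 2 * (e / 2) ^+ 2 by rewrite mulr_gt0 ?exprn_gt0 ?divr_gt0.
have /cvgrPdist_lt/(_ _ c0) [N _ /(_ N (leqnn N))] := cv.
rewrite /= sub0r normrN => NE; exists (N%:R + d) => t tA.
rewrite ltNge; apply/negP => et; move: NE; apply/negP; rewrite -leNgt.
apply: (le_trans _ (ler_norm _)).
pose J := (`[t, t + d / 2]%classic : set (measurableTypeR R)).
have -> : d / 2 * (e / 2) ^+ 2 = \int[leb R]_s (\1_J s * (e / 2) ^+ 2).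
  have E := Rint_indic J (fun=> (e / 2) ^+ 2).
  rewrite -E Rintegral_cst; last exact: measurable_itv.
  have := lebesgue_measure_itv (`[t, t + d / 2] : interval R).
  rewrite /= lte_fin ltrDl divr_gt0// -EFinB => EJ.
  by rewrite /J EJ /=; ring.
apply: Rint_le.
- apply: L1_indic; first exact: measurable_itv.
  by apply: continuous_L1_itv; exact: cst_continuous.
- apply: (L1_le _ I2).
    by mftac; exact: mT.
  move=> s; rewrite normrM [X in _ * X]ger0_norm ?sqr_ge0// indicE; case: (s \in _) => /=.
    by rewrite normr1 mul1r.
  by rewrite normr0 mul0r sqr_ge0.
- move=> s; rewrite indicE; case: (boolP (s \in J)) => [|_]; last first.
    by rewrite mul0r mulr_ge0 ?sqr_ge0.
  rewrite inE /J /= in_itv/= mul1r => /andP[ts st].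
  have dst : `|t - s| < d by rewrite ltr_norml; apply/andP; split; lra.
  rewrite indicE mem_set; last first.
    rewrite /Tn /=; have := ler_normD (t - s) s; rewrite subrK => ?.
    lra.
  rewrite mul1r -[f s ^+ 2]real_normK ?num_real// lerXn2r ?nnegrE ?divr_ge0 ?(ltW e0)//.
  have := fd _ _ dst; have := ler_normD (f t - f s) (f s); rewrite subrK => ? ?.
  lra.
Unshelve. all: by end_near. Qed.

End Vanishing.

(** * Fourier inversion for decaying functions *)

Section Decay.
Variable R : realType.
Implicit Types (f g h k : R -> R).

Lemma cvgR_unique (u : nat -> R) (a b : R) :
  u n @[n --> \oo] --> a -> u n @[n --> \oo] --> b -> a = b.
Proof. by move=> ua ub; rewrite -(cvg_lim _ ua)// -(cvg_lim _ ub). Qed.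

Lemma continuous_cosM (t : R) : continuous (fun s : R => cos (t * s)).
Proof.
apply: (@is_derive_continuous _ _ (fun s => - sin (t * s) * t)) => s.
by apply: is_derive_eq; rewrite /GRing.scale /=; ring.
Qed.

Lemma continuous_sinM (t : R) : continuous (fun s : R => sin (t * s)).
Proof.
apply: (@is_derive_continuous _ _ (fun s => cos (t * s) * t)) => s.
by apply: is_derive_eq; rewrite /GRing.scale /=; ring.
Qed.

Lemma poisson1_cvg0 : poisson 1 n%:R @[n --> \oo] --> (0 : R).
Proof.
have c0 : 4 * n.+1%:R^-1 @[n --> \oo] --> (0 : R).
  by rewrite -[0 as X in _ --> X](mulr0 4); apply: cvgMr; exact: cvg_harmonic.
apply: squeeze_cvgr; [|exact: cvg_cst|exact: c0].
apply: nearW => n; rewrite ltW ?poisson_gt0//= poissonE mulr1 expr1n.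
have n0 : 0 < n.+1%:R :> R by [].
rewrite ler_pdivrMr; last by rewrite ltr_pwDl ?sqr_ge0.
rewrite -mulrA [_^-1 * _]mulrC mulrA ler_pdivlMr//.
rewrite -natr1; have := sqr_ge0 (n%:R - 1 : R); have := ler0n R n.
by rewrite -subr_ge0 => ? ?; nra.
Qed.

Lemma integral_derivative_eq0 (F df : R -> R) (B : R) :
  (forall x : R, is_derive x (1 : R) F (df x)) -> continuous df ->
  L1 (leb R) df -> (forall x, `|F x| <= B * poisson 1 x) ->
  \int[leb R]_x df x = 0.
Proof.
move=> dF cdf Idf FB; have mdf := L1_meas Idf.
pose J (n : nat) := (`[- n%:R, n%:R]%classic : set (measurableTypeR R)).
have mJ n : measurable (J n) by exact: measurable_itv.
have [|||||_ cv] := @Rint_dct _ _ _ (leb R) (fun n x => \1_(J n) x * df x) df (fun x => `|df x|).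
- by move=> n; mftac; exact: mJ.
- exact: mdf.
- move=> x; apply: cvg_near_cst; near=> n.
  rewrite indicE mem_set ?mul1r// /J /= in_itv /= -ler_norml.
  by near: n; exact: nbhs_infty_ger.
- exact: L1_abs.
- move=> n x; rewrite normrM indicE; case: (x \in _) => /=.
    by rewrite normr1 mul1r.
  by rewrite normr0 mul0r.
have E n : \int[leb R]_x (\1_(J n) x * df x) = F n%:R - F (- n%:R).
  rewrite -(Rint_indic (J n) df) (FTC_itv dF)//.
  by rewrite (@le_trans _ _ 0)// oppr_le0.
have Fp0 (s : R) : s ^+ 2 = 1 -> F (s * n%:R) @[n --> \oo] --> (0 : R).
  move=> s1; apply: norm_cvg0.
  have b0 : B * poisson 1 n%:R @[n --> \oo] --> (0 : R).
    by rewrite -[0 as X in _ --> X](mulr0 B); apply: cvgMr; exact: poisson1_cvg0.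
  apply: squeeze_cvgr; [|exact: cvg_cst|exact: b0].
  apply: nearW => n; rewrite normr_ge0 /= (le_trans (FB _))//.
  by rewrite !poissonE exprMn s1 mul1r.
apply: (cvgR_unique cv).
have cF : F (1 * n%:R) - F (-1 * n%:R) @[n --> \oo] --> (0 - 0 : R).
  by apply: cvgB; apply: Fp0; rewrite ?sqrrN expr1n.
rewrite subr0 in cF; under eq_cvg do rewrite E -mulN1r -{1}[_%:R]mul1r.
exact: cF.
Unshelve. all: by end_near. Qed.

(** The decay O(1/(1 + x^2)) is expressed with poisson 1, a majorant that comes with
    its integral. *)
Lemma L1_decay k (B : R) : Rmeas k -> (forall x, `|k x| <= B * poisson 1 x) ->
  L1 (leb R) k.
Proof. by move=> mk kB; apply: (L1_le mk _ kB); apply: L1Z; case: (int_poisson (@ltr01 R)). Qed.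

Lemma sq_L1_decay k (B : R) : Rmeas k -> (forall x, `|k x| <= B * poisson 1 x) ->
  L1 (leb R) (fun x => k x ^+ 2).
Proof.
move=> mk kB; have [Ip _] := int_poisson (@ltr01 R).
have B0 : 0 <= B.
  have := le_trans (normr_ge0 _) (kB 0).
  by rewrite pmulr_lge0// poisson_gt0.
apply: (L1_le _ (L1Z (2 * B ^+ 2) Ip)); first by mftac.
move=> x; rewrite ger0_norm ?sqr_ge0// -real_normK ?num_real//.
have p0 : 0 < poisson 1 x by exact: poisson_gt0.
apply: (@le_trans _ _ ((B * poisson 1 x) ^+ 2)).
  by rewrite lerXn2r ?nnegrE// mulr_ge0// ltW.
have p2 : poisson 1 x <= 2.
  by have := poisson_le (@ltr01 R) x; rewrite divr1; exact: le_trans (ler_norm _).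
rewrite -subr_ge0 (_ : _ - _ = B ^+ 2 * (poisson 1 x * (2 - poisson 1 x))); last by ring.
by rewrite mulr_ge0 ?sqr_ge0// mulr_ge0 ?(ltW p0)// subr_ge0.
Qed.

End Decay.

Section Bernstein.
Variable R : realType.
Variables (k dk : R -> R) (B : R).
Hypothesis kd : forall x : R, is_derive x (1 : R) k (dk x).
Hypothesis cdk : continuous dk.
Hypothesis kB : forall x, `|k x| <= B * poisson 1 x.
Hypothesis dkB : forall x, `|dk x| <= B * poisson 1 x.

Let mk : Rmeas k.
Proof. by apply: meas_continuous; exact: is_derive_continuous kd. Qed.
Let mdk : Rmeas dk. Proof. exact: meas_continuous. Qed.
Let Ik := L1_decay mk kB.
Let Idk := L1_decay mdk dkB.

(** Integration by parts: the derivative of sin (t s) k(s) has integral 0. *)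
Lemma Ct_derive t : t * Ct k t = - St dk t.
Proof.
have ck := is_derive_continuous kd.
have cc : continuous (fun s : R => t * (cos (t * s) * k s) + sin (t * s) * dk s).
  move=> s; apply: cvgD.
    by apply: cvgMr; apply: cvgM; [exact: continuous_cosM|exact: ck].
  by apply: cvgM; [exact: continuous_sinM|exact: cdk].
have E : \int[leb R]_s (t * (cos (t * s) * k s) + sin (t * s) * dk s) = 0.
  apply: (@integral_derivative_eq0 _ (fun s => sin (t * s) * k s) _ B).
  - move=> s; apply: is_derive_eq; rewrite /GRing.scale /=; ring.
  - exact: cc.
  - by apply: L1D; [apply: L1Z; exact: L1_cosM|exact: L1_sinM].
  - by move=> x; rewrite normrM (le_trans _ (kB x))// ler_piMl// sin_abs.
move: E; rewrite (RintD (L1Z t (L1_cosM t Ik)) (L1_sinM t Idk)) (RintZ t (L1_cosM t Ik)).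
by move/eqP; rewrite addr_eq0 => /eqP.
Qed.

Lemma St_derive t : t * St k t = Ct dk t.
Proof.
have ck := is_derive_continuous kd.
have cc : continuous (fun s : R => cos (t * s) * dk s - t * (sin (t * s) * k s)).
  move=> s; apply: cvgB; last first.
    by apply: cvgMr; apply: cvgM; [exact: continuous_sinM|exact: ck].
  by apply: cvgM; [exact: continuous_cosM|exact: cdk].
have E : \int[leb R]_s (cos (t * s) * dk s - t * (sin (t * s) * k s)) = 0.
  apply: (@integral_derivative_eq0 _ (fun s => cos (t * s) * k s) _ B).
  - move=> s; apply: is_derive_eq; rewrite /GRing.scale /=; ring.
  - exact: cc.
  - by apply: L1B; [exact: L1_cosM|apply: L1Z; exact: L1_sinM].
  - by move=> x; rewrite normrM (le_trans _ (kB x))// ler_piMl// cos_abs.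
move: E; rewrite (RintB (L1_cosM t Idk) (L1Z t (L1_sinM t Ik))) (RintZ t (L1_sinM t Ik)).
by move/eqP; rewrite subr_eq0 => /eqP.
Qed.

(* Cauchy-Schwarz with the weight 1 + t^2, in the form
   |c| <= 1/(1 + t^2) + (1 + t^2) c^2. *)
Let L1_weight (c d : R -> R) : Rmeas c -> Rmeas d -> (forall t, t * c t = d t) ->
  L1 (leb R) (fun t => c t ^+ 2) -> L1 (leb R) (fun t => d t ^+ 2) -> L1 (leb R) c.
Proof.
move=> mc md cd Ic Id; have [Ip _] := int_poisson (@ltr01 R).
apply: (L1_le mc (L1D Ip (L1D Ic Id))) => t.
rewrite -cd poissonE mulr1 expr1n -[c t ^+ 2]real_normK ?num_real//.
rewrite exprMn -[c t ^+ 2]real_normK ?num_real//.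
have q0 : 0 < 1 + t ^+ 2 by rewrite ltr_pwDl ?sqr_ge0.
rewrite -subr_ge0 (_ : _ - _ = (1 + t ^+ 2)^-1 * (((1 + t ^+ 2) * `|c t| - 2^-1) ^+ 2 + 7 / 4)).
  by rewrite mulr_ge0 ?invr_ge0 ?(ltW q0)// addr_ge0 ?sqr_ge0.
by field; exact: lt0r_neq0.
Qed.

(** Bernstein's argument: by Plancherel the transforms of k and of its derivative
    are square integrable, and the latter are t times the former, which are
    therefore square integrable for the weight 1 + t^2. *)
Lemma L1_CtSt : L1 (leb R) (Ct k) /\ L1 (leb R) (St k).
Proof.
have [P1 _] := plancherel Ik (sq_L1_decay mk kB).
have [P2 _] := plancherel Idk (sq_L1_decay mdk dkB).
have mC := ucont_meas (ucont_Ct Ik); have mS := ucont_meas (ucont_St Ik).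
have mC' := ucont_meas (ucont_Ct Idk); have mS' := ucont_meas (ucont_St Idk).
have sub1 (a b : R -> R) : Rmeas a -> L1 (leb R) (fun t => a t ^+ 2 + b t ^+ 2) ->
    L1 (leb R) (fun t => a t ^+ 2).
  move=> ma Iab; apply: (L1_le _ Iab); first by mftac.
  by move=> x; rewrite ger0_norm ?sqr_ge0// lerDl sqr_ge0.
have sub2 (a b : R -> R) : Rmeas b -> L1 (leb R) (fun t => a t ^+ 2 + b t ^+ 2) ->
    L1 (leb R) (fun t => b t ^+ 2).
  move=> mb Iab; apply: (L1_le _ Iab); first by mftac.
  by move=> x; rewrite ger0_norm ?sqr_ge0// lerDr sqr_ge0.
split.
- apply: (L1_weight mC (d := fun t => - St dk t)); first by mftac.
  + exact: Ct_derive.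
  + exact: sub1 mC P1.
  + apply: (eq_L1R _ (sub2 _ _ mS' P2)) => t; by rewrite sqrrN.
- apply: (L1_weight mS mC' St_derive); [exact: sub2 mS P1|exact: sub1 mC' P2].
Qed.

(** The Abel means of the left-hand side are Poisson averages of k, which tend
    to 2 pi k(l). *)
Lemma fourier_inversion (l : R) :
  \int[leb R]_t (cos (l * t) * Ct k t + sin (l * t) * St k t) = 2 * pi * k l.
Proof.
have [IC IS] := L1_CtSt.
pose en (n : nat) : R := n.+1%:R^-1.
have en0 n : 0 < en n by rewrite invr_gt0.
have mC := L1_meas IC; have mS := L1_meas IS.
have Iinv := L1D (L1_cosM l IC) (L1_sinM l IS).
have minv := L1_meas Iinv.
have [|||||_ cv] := @Rint_dct _ _ _ (leb R)
   (fun n t => abel (en n) t * (cos (l * t) * Ct k t + sin (l * t) * St k t))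
   (fun t => cos (l * t) * Ct k t + sin (l * t) * St k t)
   (fun t => `|cos (l * t) * Ct k t + sin (l * t) * St k t|).
- by move=> n; have ma := meas_abel (en n); mftac.
- exact: minv.
- by move=> t; rewrite -[X in _ --> X]mul1r; apply: cvgMl; exact: abel_cvg1.
- exact: L1_abs.
- move=> n t; rewrite normrM ler_piMl//; exact: abel_le1.
apply: (cvgR_unique cv).
under eq_cvg => n.
  rewrite (_ : \int[leb R]_t _ = \int[leb R]_r (k r * poisson (en n) (l - r))); last first.
    by rewrite -(abel_inversion l (en0 n) Ik); apply: eq_Rint => t; rewrite ![l * _]mulrC.
  over.
apply: (@poisson_approx _ (fun=> k) (B * (2 / 1))) => //.
- move=> _ s; apply: (le_trans (kB s)).
  have B0 : 0 <= B.
    have := le_trans (normr_ge0 _) (kB 0).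
    by rewrite pmulr_lge0// poisson_gt0.
  rewrite ler_wpM2l//; apply: (le_trans (ler_norm _)); exact: poisson_le.
- move=> s; have cl : l - n.+1%:R^-1 * s @[n --> \oo] --> (l - 0 : R).
    apply: cvgB; first exact: cvg_cst.
    by rewrite -[0 as X in _ --> X](mul0r s); apply: cvgMl; exact: cvg_harmonic.
  rewrite subr0 in cl.
  apply: (@cvg_comp _ _ _ (fun n : nat => l - n.+1%:R^-1 * s) k _ (nbhs l)) => //.
  exact: is_derive_continuous kd l.
Qed.

End Bernstein.

(** * The Riemann-Lebesgue lemma *)

Section RiemannLebesgue.
Variable R : realType.
Implicit Types (f g h k : R -> R).

(** Cutting h off where |h| > N changes it little in L1, hence changes its
    transforms little. What remains is square integrable, so that its transforms
    are uniformly continuous and, by Plancherel, square integrable: they vanish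
    at infinity. *)
Lemma riemann_lebesgue h : L1 (leb R) h -> forall e : R, 0 < e ->
  exists A : R, forall t, A < `|t| -> `|Ct h t| < e /\ `|St h t| < e.
Proof.
move=> Ih e e0; have mh := L1_meas Ih.
pose Tn (n : nat) := [set t : measurableTypeR R | `|h t| <= n%:R].
have mT n : measurable (Tn n).
  rewrite -[Tn n]setTI; apply: (@measurable_fun_ler _ _ _ setT (fun t : measurableTypeR R => `|h t|) (fun=> n%:R)) => //.
  by mftac.
have mg n : Rmeas (fun t => \1_(Tn n) t * h t) by mftac; exact: mT.
have gh n t : `|\1_(Tn n) t * h t| <= `|h t|.
  rewrite normrM indicE; case: (t \in _) => /=; first by rewrite normr1 mul1r.
  by rewrite normr0 mul0r.
have Ig n : L1 (leb R) (fun t => \1_(Tn n) t * h t).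
  exact: (L1_le (mg n) (L1_abs Ih) (gh n)).
have [|||||_ cv] := @Rint_dct _ _ _ (leb R) (fun n t => `|h t - \1_(Tn n) t * h t|) (fun=> 0)
   (fun t => `|h t|).
- by move=> n; mftac; exact: mT.
- by mftac.
- move=> t; apply: cvg_near_cst; near=> n.
  rewrite indicE mem_set ?mul1r ?subrr ?normr0// /Tn /=.
  by near: n; exact: nbhs_infty_ger.
- exact: L1_abs.
- move=> n t; rewrite normr_id indicE; case: (t \in _) => /=.
    by rewrite mul1r subrr normr0.
  by rewrite mul0r subr0.
rewrite (_ : \int[leb R]_x 0 = 0) in cv; last by rewrite /Rintegral integral0.
have e2 : 0 < e / 2 by rewrite divr_gt0.
have /cvgrPdist_lt/(_ _ e2) [N _ /(_ N (leqnn N))] := cv.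
rewrite /= sub0r normrN => NE; have := le_lt_trans (ler_norm _) NE => {NE}.
set g := fun t => \1_(Tn N) t * h t => NE.
have Igg : L1 (leb R) g by exact: Ig.
have Ig2 : L1 (leb R) (fun t => g t ^+ 2).
  apply: (L1_le _ (L1Z N%:R (L1_abs Ih))).
    by have := L1_meas Igg => mgg; mftac.
  move=> t; rewrite ger0_norm ?sqr_ge0// /g indicE; case: (boolP (t \in Tn N)) => [|_]; last first.
    by rewrite mul0r expr0n /= mulr_ge0.
  rewrite inE /Tn /= => hN; rewrite mul1r -real_normK ?num_real// expr2.
  by rewrite ler_wpM2r.
have [Pg _] := plancherel Igg Ig2.
have mC := ucont_meas (ucont_Ct Igg); have mS := ucont_meas (ucont_St Igg).
have [A1 HA1] : exists A : R, forall t, A < `|t| -> `|Ct g t| < e / 2.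
  apply: ucont_L2_vanish => //; first exact: ucont_Ct.
  apply: (L1_le _ Pg); first by mftac.
  by move=> x; rewrite ger0_norm ?sqr_ge0// lerDl sqr_ge0.
have [A2 HA2] : exists A : R, forall t, A < `|t| -> `|St g t| < e / 2.
  apply: ucont_L2_vanish => //; first exact: ucont_St.
  apply: (L1_le _ Pg); first by mftac.
  by move=> x; rewrite ger0_norm ?sqr_ge0// lerDr sqr_ge0.
exists (Num.max A1 A2) => t; rewrite gt_max => /andP[t1 t2].
have Ihg := L1B Ih Igg.
have CE : Ct h t = Ct g t + Ct (fun s => h s - g s) t.
  rewrite -(RintD (L1_cosM t Igg) (L1_cosM t Ihg)); apply: eq_Rint => s; ring.
have SE : St h t = St g t + St (fun s => h s - g s) t.
  rewrite -(RintD (L1_sinM t Igg) (L1_sinM t Ihg)); apply: eq_Rint => s; ring.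
have Cr := le_lt_trans (Ct_le t Ihg) NE; have Sr := le_lt_trans (St_le t Ihg) NE.
rewrite CE SE; split; apply: (le_lt_trans (ler_normD _ _)).
  have := HA1 _ t1; lra.
have := HA2 _ t2; lra.
Unshelve. all: by end_near. Qed.

End RiemannLebesgue.

(** * Complex measures as combinations of finite positive measures *)

Notation fmeas R := {finite_measure set (measurableTypeR R) -> \bar R}.
Notation charge_R R := (charge (measurableTypeR R) R).

Section BoundedMeasurable.
Variable R : realType.
Implicit Types (g h : R -> R) (p : fmeas R).

Definition bmeas g := Rmeas g /\ exists B : R, forall x, `|g x| <= B.

Lemma bmeas_L1 p g : bmeas g -> L1 p g.
Proof.
move=> [mg [B gB]]; apply: (L1_le (g := fun=> B) mg) => //.
exact: finite_measure_integrable_cst.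
Qed.

End BoundedMeasurable.

Section PushProduct.
Variable R : realType.
Variables (p q : fmeas R) (m : measurableTypeR R * measurableTypeR R -> measurableTypeR R).
Hypothesis mm : measurable_fun setT m.

(** The law of m under the product measure. Measurability of m is an argument of
    the definition so that the measure structure can be attached to it. *)
Definition push_product (_ : measurable_fun setT m) : set (measurableTypeR R) -> \bar R :=
  pushforward (p \x q)%E m.

Let M : {measure set (measurableTypeR R) -> \bar R} :=
  measure_function_pushforward__canonical__measure_function_Measure (p \x q)%E mm.

HB.instance Definition _ := isMeasure.Build _ _ _ (push_product mm)
  (measure0 M) (measure_ge0 M) (@measure_semi_sigma_additive _ _ _ M).

Let fin : fin_num_fun (push_product mm).
Proof.
move=> A mA; rewrite /push_product /pushforward.
have mA' : measurable (m @^-1` A) by rewrite -[X in measurable X]setTI; exact: mm.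
rewrite ge0_fin_numE//; apply: (@le_lt_trans _ _ ((p \x q)%E setT)).
  by apply: le_measure => //; rewrite inE.
rewrite -setXTT product_measure1E// ltey_eq fin_numM//; exact: fin_num_measure.
Qed.

HB.instance Definition _ := @Measure_isFinite.Build _ _ _ (push_product mm) fin.

Lemma int_push_product g : bmeas g ->
  \int[push_product mm]_x g x = \int[p]_s \int[q]_t g (m (s, t)).
Proof.
move=> [mg [B gB]].
have mgm : measurable_fun setT (fun z => g (m z)) by exact: Rmeas_comp.
have B0 : 0 <= B by apply: le_trans (gB 0).
have Ip (r : fmeas R) (c : R) : L1 r (fun=> c) by exact: finite_measure_integrable_cst.
have dom x y : `|g (m (x, y))| <= (fun=> B) x * (fun=> 1) y by rewrite mulr1.
have I2 := L1_prod (m1 := p) (m2 := q) mgm (Ip p B) (Ip q 1) dom.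
rewrite {1}/Rintegral (@integral_pushforward _ _ _ _ _ _ mm (p \x q)%E)//=; last first.
  exact/measurable_EFinP.
have := integral12_prod_meas1 I2.
rewrite preimage_setT => <-.
rewrite /fubini_F /=.
under eq_integral => s _ do rewrite /= (Rint_EFin (L1_section (m2 := q) mgm (Ip q 1) dom s)).
by [].
Qed.

End PushProduct.

Section Density.
Variable R : realType.
Variable q : R -> R.
Hypothesis Iq : L1 (leb R) q.
Hypothesis q0 : forall x, 0 <= q x.

Let ind_ge0 (E : set (measurableTypeR R)) : (0 <= induced_charge Iq E)%E.
Proof. by apply: integral_ge0 => x _; rewrite lee_fin. Qed.

Definition density_measure : set (measurableTypeR R) -> \bar R :=
  measure_of_charge (induced_charge Iq) ind_ge0.

HB.instance Definition _ := Measure.on density_measure.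

Let fin : fin_num_fun (density_measure).
Proof. by move=> A mA; exact: (fin_num_measure (induced_charge Iq)). Qed.

HB.instance Definition _ := @Measure_isFinite.Build _ _ _ (density_measure) fin.

Lemma density_measureE A : density_measure A = (\int[leb R]_(x in A) (q x)%:E)%E.
Proof. by []. Qed.

Let nudom : density_measure `<< leb R.
Proof. 
apply/null_content_dominatesP => A mA A0.
rewrite density_measureE; apply: null_set_integral => //.
by apply: measurable_funTS; exact: measurable_int Iq.
Qed.

(** The Radon-Nikodym derivative of the measure of density q is q almost
    everywhere, which turns the change of variables formula for derivatives into
    the formula for q. *)
Lemma ge0_int_density (g : R -> R) : bmeas g -> (forall x, 0 <= g x) ->
  \int[density_measure]_x g x = \int[leb R]_x (q x * g x).
Proof.
move=> [mg [B gB]] g0; have mq := L1_meas Iq.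
pose nu : fmeas R := density_measure.
have cv := @Radon_Nikodym_SigmaFinite.change_of_variables _ _ R nu (leb R) nudom
  (fun x => (g x)%:E) setT (fun x => g0 x) measurableT.
rewrite /Rintegral -cv; last exact/measurable_EFinP.
congr fine.
have If := Radon_Nikodym_SigmaFinite.f_integrable nudom.
have E : ae_eq (leb R) setT (Radon_Nikodym_SigmaFinite.f nu (leb R)) (fun x => (q x)%:E).
  apply: integral_ae_eq => //; first exact: measurable_int Iq.
  move=> A _ mA; rewrite -Radon_Nikodym_SigmaFinite.f_integral//; exact: nudom.
apply: ae_eq_integral => //.
- apply: emeasurable_funM; first exact/measurable_EFinP.
  exact: measurable_int If.
- by apply/measurable_EFinP; mftac.
- by apply: filterS E => x /= /(_ I) -> _; rewrite mulrC EFinM.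
Qed.

Lemma int_density (g : R -> R) : bmeas g ->
  \int[density_measure]_x g x = \int[leb R]_x (q x * g x).
Proof.
move=> bg; have [mg [B gB]] := bg; have mq := L1_meas Iq.
have B0 : 0 <= B by apply: le_trans (gB 0).
have bB : bmeas (fun=> B : R) by split=> //; exists B => x; rewrite ger0_norm.
have bgB : bmeas (fun x => g x + B).
  split; first by mftac.
  exists (B + B) => x; apply: (le_trans (ler_normD _ _)).
  by apply: lerD => //; rewrite ger0_norm.
have gB0 x : 0 <= g x + B by have := gB x; rewrite ler_norml => /andP[? _]; lra.
have Iqg : L1 (leb R) (fun x => q x * g x).
  by apply: (eq_L1R _ (L1_bdM mg gB Iq)) => x; rewrite mulrC.
have IqB : L1 (leb R) (fun x => q x * B).
  by apply: (eq_L1R _ (L1Z B Iq)) => x; rewrite mulrC.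
have := ge0_int_density bgB gB0.
rewrite (RintD (bmeas_L1 _ bg) (bmeas_L1 _ bB)) (ge0_int_density bB)//.
under [RHS]eq_Rint do rewrite mulrDr.
by rewrite (RintD Iqg IqB) => /addIr.
Qed.

End Density.

Notation Re := complex.Re.
Notation Im := complex.Im.

Section ComplexBasics.
Variable R : realType.
Implicit Types x y z : R[i].

Lemma complex_eqP x y : Re x = Re y -> Im x = Im y -> x = y.
Proof. by case: x y => [a b] [c d] /= -> ->. Qed.

Lemma ReD x y : Re (x + y) = Re x + Re y. Proof. by case: x y => ? ? []. Qed.
Lemma ImD x y : Im (x + y) = Im x + Im y. Proof. by case: x y => ? ? []. Qed.
Lemma ReN x : Re (- x) = - Re x. Proof. by case: x. Qed.
Lemma ImN x : Im (- x) = - Im x. Proof. by case: x. Qed.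
Lemma ReM x y : Re (x * y) = Re x * Re y - Im x * Im y.
Proof. by case: x y => ? ? []. Qed.
Lemma ImM x y : Im (x * y) = Re x * Im y + Im x * Re y.
Proof. by case: x y => ? ? []. Qed.

Definition ReIm := (ReD, ImD, ReN, ImN, ReM, ImM).

Lemma cabs_sq z : cabs z ^+ 2 = Re z ^+ 2 + Im z ^+ 2.
Proof. by case: z => a b; rewrite /cabs /= sqr_sqrtr ?addr_ge0 ?sqr_ge0. Qed.

Lemma cabs_ge0 z : 0 <= cabs z.
Proof. by case: z => a b; rewrite /cabs /= sqrtr_ge0. Qed.

Lemma cabs_Re z : `|Re z| <= cabs z.
Proof.
rewrite -(@ler_pXn2r _ 2)// ?nnegrE ?cabs_ge0// real_normK ?num_real// cabs_sq.
by rewrite lerDl sqr_ge0.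
Qed.

Lemma cabs_Im z : `|Im z| <= cabs z.
Proof.
rewrite -(@ler_pXn2r _ 2)// ?nnegrE ?cabs_ge0// real_normK ?num_real// cabs_sq.
by rewrite lerDr sqr_ge0.
Qed.

Lemma cabs_le z : cabs z <= `|Re z| + `|Im z|.
Proof.
rewrite -(@ler_pXn2r _ 2)// ?nnegrE ?cabs_ge0 ?addr_ge0// cabs_sq sqrrD.
rewrite !real_normK ?num_real// lerD2r lerDl mulrn_wge0// mulr_ge0//.
Qed.

Lemma cis_add (a b : R) : cis (a + b) = cis a * cis b :> R[i].
Proof. by apply: complex_eqP; rewrite !ReIm /= ?cosD ?sinD// addrC. Qed.

Lemma cis0 : cis 0 = 1 :> R[i].
Proof. by apply: complex_eqP; rewrite /= ?cos0 ?sin0. Qed.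

End ComplexBasics.

Section ComplexIntegral.
Context d (T : measurableType d) (R : realType).
Variable mu : {measure set T -> \bar R}.
Implicit Types f g : T -> R[i].

Definition Cint f : R[i] :=
  (\int[mu]_x Re (f x)) +i* (\int[mu]_x Im (f x)).

Definition CL1 f := L1 mu (fun x => Re (f x)) /\ L1 mu (fun x => Im (f x)).

Lemma eq_Cint f g : f =1 g -> Cint f = Cint g.
Proof. by move=> fg; have -> : f = g by apply/funext. Qed.

Lemma CL1D f g : CL1 f -> CL1 g -> CL1 (fun x => f x + g x).
Proof.
move=> [f1 f2] [g1 g2]; split.
  by apply: (eq_L1 _ (L1D f1 g1)) => x; rewrite ReD.
by apply: (eq_L1 _ (L1D f2 g2)) => x; rewrite ImD.
Qed.

Lemma CL1Z c f : CL1 f -> CL1 (fun x => c * f x).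
Proof.
move=> [f1 f2]; split.
  by apply: (eq_L1 _ (L1B (L1Z (Re c) f1) (L1Z (Im c) f2))) => x; rewrite ReM.
by apply: (eq_L1 _ (L1D (L1Z (Re c) f2) (L1Z (Im c) f1))) => x; rewrite ImM.
Qed.

Lemma CintD f g : CL1 f -> CL1 g -> Cint (fun x => f x + g x) = Cint f + Cint g.
Proof.
move=> [f1 f2] [g1 g2]; apply: complex_eqP; rewrite ReIm /=.
  by rewrite -(RintD f1 g1); apply: eq_Rint => x; rewrite ReD.
by rewrite -(RintD f2 g2); apply: eq_Rint => x; rewrite ImD.
Qed.

Lemma CintZ c f : CL1 f -> Cint (fun x => c * f x) = c * Cint f.
Proof.
move=> [f1 f2]; apply: complex_eqP; rewrite ReIm /=.
  rewrite -(RintZ _ f1) -(RintZ _ f2) -(RintB (L1Z _ f1) (L1Z _ f2)).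
  by apply: eq_Rint => x; rewrite ReM.
rewrite -(RintZ _ f1) -(RintZ _ f2) -(RintD (L1Z _ f2) (L1Z _ f1)).
by apply: eq_Rint => x; rewrite ImM.
Qed.

Lemma CL1B f g : CL1 f -> CL1 g -> CL1 (fun x => f x - g x).
Proof.
move=> f1 g1; have := CL1D f1 (CL1Z (-1) g1).
by have -> : (fun x => f x + -1 * g x) = (fun x => f x - g x) by apply/funext => x; rewrite mulN1r.
Qed.

Lemma CintB f g : CL1 f -> CL1 g -> Cint (fun x => f x - g x) = Cint f - Cint g.
Proof.
move=> f1 g1; rewrite -mulN1r -(CintZ (-1) g1) -(CintD f1 (CL1Z (-1) g1)).
by apply: eq_Cint => x; rewrite mulN1r.
Qed.

End ComplexIntegral.

Section Cbm.
Variable R : realType.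
Implicit Types (g h : R -> R[i]) (p : fmeas R).

Definition cbm g := bmeas (fun x => Re (g x)) /\ bmeas (fun x => Im (g x)).

Lemma cbm_CL1 p g : cbm g -> CL1 p g.
Proof. by move=> [g1 g2]; split; exact: bmeas_L1. Qed.

Lemma bmeasD (f g : R -> R) : bmeas f -> bmeas g -> bmeas (fun x => f x + g x).
Proof.
move=> [mf [A fA]] [mg [B gB]]; split; first by mftac.
by exists (A + B) => x; rewrite (le_trans (ler_normD _ _))// lerD.
Qed.

Lemma bmeasM (f g : R -> R) : bmeas f -> bmeas g -> bmeas (fun x => f x * g x).
Proof.
move=> [mf [A fA]] [mg [B gB]]; split; first by mftac.
by exists (A * B) => x; rewrite normrM ler_pM.
Qed.

Lemma bmeasN (f : R -> R) : bmeas f -> bmeas (fun x => - f x).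
Proof. by move=> [mf [A fA]]; split; [mftac|exists A => x; rewrite normrN]. Qed.

Lemma bmeas_cst (c : R) : bmeas (fun=> c).
Proof. by split; [mftac|exists `|c|]. Qed.

Lemma eq_bmeas (f g : R -> R) : f =1 g -> bmeas f -> bmeas g.
Proof. by move=> fg; have -> : f = g by apply/funext. Qed.

Lemma cbmM g h : cbm g -> cbm h -> cbm (fun x => g x * h x).
Proof.
move=> [g1 g2] [h1 h2]; split.
  apply: (eq_bmeas _ (bmeasD (bmeasM g1 h1) (bmeasN (bmeasM g2 h2)))) => x.
  by rewrite ReM.
apply: (eq_bmeas _ (bmeasD (bmeasM g1 h2) (bmeasM g2 h1))) => x.
by rewrite ImM.
Qed.

Lemma cbm_cst (c : R[i]) : cbm (fun=> c).
Proof. by split; exact: bmeas_cst. Qed.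

Lemma cbm_comp g (m : R -> R) : Rmeas m -> cbm g -> cbm (fun x => g (m x)).
Proof.
move=> mm [[m1 [A A1]] [m2 [B B2]]]; split; split.
- exact: (Rmeas_comp m1 mm).
- by exists A.
- exact: (Rmeas_comp m2 mm).
- by exists B.
Qed.

End Cbm.

Section Combination.
Variable R : realType.
Notation cR := (measurableTypeR R).

Fixpoint nncomb (l : seq ({nonneg R} * fmeas R)) : {measure set cR -> \bar R} :=
  if l is cp :: l' then measure_add (mscale cp.1 cp.2) (nncomb l') else mzero.

Lemma nncombE l A : nncomb l A = (\sum_(cp <- l) cp.1%:num%:E * cp.2 A)%E.
Proof.
elim: l => [|[c p] l IH]; first by rewrite big_nil.
transitivity (measure_add (mscale c p) (nncomb l) A); first by [].
by rewrite measure_addE IH big_cons.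
Qed.

Lemma int_nncomb l (h : R -> R) : bmeas h -> (forall x, 0 <= h x) ->
  (\int[nncomb l]_x (h x)%:E = (\sum_(cp <- l) cp.1%:num * \int[cp.2]_x h x)%:E)%E.
Proof.
move=> bh h0; have mh := bh.1; have mE : measurable_fun setT (EFin \o h) by exact/measurable_EFinP.
elim: l => [|[c p] l IH] /=; first by rewrite big_nil integral_measure_zero.
rewrite (ge0_integral_measure_add (mscale c p) (nncomb l) measurableT _ mE); last first.
  by move=> x _; rewrite lee_fin.
rewrite big_cons EFinD -IH; congr (_ + _)%E.
rewrite ge0_integral_mscale//=; last by move=> x _; rewrite lee_fin.
by rewrite EFinM -(Rint_EFin (bmeas_L1 p bh)).
Qed.

Definition rpos (c : R) : {nonneg R} := NngNum (normr_ge0 (Num.max c 0)).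
Definition rneg (c : R) : {nonneg R} := NngNum (normr_ge0 (Num.max (- c) 0)).

Lemma rpos_rneg c : (rpos c)%:num - (rneg c)%:num = c.
Proof.
rewrite /rpos /rneg /= !ger0_norm ?le_max ?lexx ?orbT//.
case: (leP 0 c) => c0.
  by rewrite max_r ?subr0// oppr_le0.
by rewrite max_l ?sub0r ?opprK// oppr_ge0 ltW.
Qed.

(** Separating the positive from the negative coefficients gives two measures that
    agree on Borel sets, hence have the same integrals. *)
Lemma null_combination (l : seq (R * fmeas R)) :
  (forall A : set cR, measurable A -> \sum_(cp <- l) cp.1 * fine (cp.2 A) = 0) ->
  forall g, bmeas g -> \sum_(cp <- l) cp.1 * \int[cp.2]_x g x = 0.
Proof.
move=> l0 g bg.
pose lp := [seq (rpos cp.1, cp.2) | cp <- l].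
pose ln := [seq (rneg cp.1, cp.2) | cp <- l].
have E (A : set cR) : measurable A -> nncomb lp A = nncomb ln A.
  move=> mA; rewrite !nncombE !big_map.
  have fE (r : R -> {nonneg R}) : (\sum_(cp <- l) ((r cp.1)%:num%:E * cp.2 A) =
      (\sum_(cp <- l) (r cp.1)%:num * fine (cp.2 A))%:E)%E.
    rewrite -sumEFin; apply: eq_bigr => cp _.
    by rewrite EFinM fineK//; exact: fin_num_measure.
  rewrite (fE rpos) (fE rneg); congr EFin; apply/eqP; rewrite -subr_eq0 -sumrB; apply/eqP.
  rewrite -[RHS](l0 A mA); apply: eq_bigr => cp _.
  by rewrite -mulrBl rpos_rneg.
have Eint h : bmeas h -> (forall x, 0 <= h x) -> \sum_(cp <- l) cp.1 * \int[cp.2]_x h x = 0.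
  move=> bh h0.
  have : (\int[nncomb lp]_x (h x)%:E = \int[nncomb ln]_x (h x)%:E)%E.
    by apply: eq_measure_integral => A mA _; exact: E.
  rewrite !int_nncomb// !big_map => -[/eqP]; rewrite -subr_eq0 -sumrB => /eqP S0.
  by rewrite -[RHS]S0; apply: eq_bigr => cp _; rewrite -mulrBl rpos_rneg.
have [mg [B gB]] := bg.
have B0 : 0 <= B by apply: le_trans (gB 0).
have bB := bmeas_cst B.
have gB0 x : 0 <= g x + B by have := gB x; rewrite ler_norml => /andP[? _]; lra.
have := Eint _ (bmeasD bg bB) gB0.
under eq_bigr => cp _ do rewrite (RintD (bmeas_L1 _ bg) (bmeas_L1 _ bB)) mulrDr.
by rewrite big_split /= (Eint _ bB)// addr0.
Qed.

(** All that is kept of the chosen Hahn decomposition is that a charge is a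
    difference of two finite measures. *)
Lemma charge_int_rep (nu : charge_R R) : exists p n : fmeas R,
  (forall g, charge_int nu g = \int[p]_x g x - \int[n]_x g x) /\
  (forall A, measurable A -> fine (nu A) = fine (p A) - fine (n A)).
Proof.
rewrite /charge_int; case: cid => P HP; case: cid => N PN.
exists (jordan_pos PN), (jordan_neg PN); split=> // A mA.
rewrite (jordan_decomp PN mA) /cadd /= cscaleN1 fineD//.
- by rewrite /= fineN.
- exact: fin_num_measure.
- by rewrite /= fin_numN; exact: fin_num_measure.
Qed.

(** The values of a charge determine its integrals: the two representations of nu
    are compared by null_combination. *)
Lemma charge_of_comb (l : seq (R * fmeas R)) : exists nu : charge_R R,
  forall g, bmeas g -> charge_int nu g = \sum_(cp <- l) cp.1 * \int[cp.2]_x g x.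
Proof.
have [nu nuE] : exists nu : charge_R R, forall A, measurable A ->
    fine (nu A) = \sum_(cp <- l) cp.1 * fine (cp.2 A).
  elim: l => [|[c p] l [nu IH]].
    by exists czero => A mA; rewrite big_nil.
  exists (cadd (cscale c (charge_of_finite_measure p)) nu) => A mA.
  rewrite big_cons -IH// /cadd /= fineD//.
  - by rewrite /cscale /= fineM//; exact: fin_num_measure.
  - by rewrite /cscale /= fin_numM//; exact: fin_num_measure.
  - exact: fin_num_measure.
exists nu => g bg; have [p [n [gE AE]]] := charge_int_rep nu.
have := @null_combination ((1, p) :: (-1, n) :: [seq (- cp.1, cp.2) | cp <- l]).
move=> /(_ _ g bg); rewrite gE !big_cons /= big_map /=.
under eq_bigr do rewrite mulNr.
rewrite sumrN mul1r mulN1r addrA => h; apply/eqP; rewrite -subr_eq0; apply/eqP.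
apply: h => A mA; rewrite !big_cons /= big_map /=.
under eq_bigr do rewrite mulNr.
by rewrite sumrN mul1r mulN1r addrA -AE// nuE// subrr.
Qed.

End Combination.

Section ComplexMeasures.
Variable R : realType.
Implicit Types (l : seq (R[i] * fmeas R)) (mu nu : @cmeasure R) (g h : R -> R[i]).

(** Integral against a complex measure given as a finite combination of finite
    positive measures. Dominated convergence and Fubini's theorem extend to such
    combinations by linearity. *)
Definition csum l g : R[i] := \sum_(cp <- l) cp.1 * Cint cp.2 g.

Lemma cmint_rep mu : exists l, forall g, cmint mu g = csum l g.
Proof.
have [p1 [n1 [E1 _]]] := charge_int_rep (mu_re mu).
have [p2 [n2 [E2 _]]] := charge_int_rep (mu_im mu).
exists [:: (1, p1); (-1, n1); ('i, p2); (- 'i, n2)] => g.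
rewrite /csum !big_cons big_nil /= addr0 /cmint !E1 !E2.
by apply: complex_eqP; rewrite !ReIm /=; ring.
Qed.

Lemma cmint_of l : exists mu, forall g, cbm g -> cmint mu g = csum l g.
Proof.
have [nr nrE] := charge_of_comb [seq (Re cp.1, cp.2) | cp <- l].
have [ni niE] := charge_of_comb [seq (Im cp.1, cp.2) | cp <- l].
exists (CMeasure nr ni) => g [bg1 bg2].
rewrite /cmint /= !nrE// !niE// !big_map /= /csum.
elim: l {nr nrE ni niE} => [|[c p] l IH]; first by rewrite !big_nil subr0 addr0.
rewrite !big_cons -IH /=; apply: complex_eqP; rewrite !ReIm /=; ring.
Qed.

End ComplexMeasures.

Section CsumTheory.
Variable R : realType.
Notation cR := (measurableTypeR R).
Implicit Types (l : seq (R[i] * fmeas R)) (g h : R -> R[i]).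

Lemma eq_csum l g h : g =1 h -> csum l g = csum l h.
Proof. by move=> gh; have -> : g = h by apply/funext. Qed.

Lemma csumD l g h : cbm g -> cbm h -> csum l (fun s => g s + h s) = csum l g + csum l h.
Proof.
move=> bg bh; rewrite /csum -big_split /=; apply: eq_bigr => -[c p] _ /=.
by rewrite (CintD (cbm_CL1 p bg) (cbm_CL1 p bh)) mulrDr.
Qed.

Lemma csumZ l c g : cbm g -> csum l (fun s => c * g s) = c * csum l g.
Proof.
move=> bg; rewrite /csum mulr_sumr; apply: eq_bigr => -[b p] _ /=.
by rewrite (CintZ c (cbm_CL1 p bg)) mulrCA.
Qed.

Lemma cbmD g h : cbm g -> cbm h -> cbm (fun x => g x + h x).
Proof.
move=> [g1 g2] [h1 h2]; split.
  by apply: (eq_bmeas _ (bmeasD g1 h1)) => x; rewrite ReD.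
by apply: (eq_bmeas _ (bmeasD g2 h2)) => x; rewrite ImD.
Qed.

Lemma cbmB g h : cbm g -> cbm h -> cbm (fun x => g x - h x).
Proof.
move=> bg [h1 h2]; apply: cbmD => //; split.
  by apply: (eq_bmeas _ (bmeasN h1)) => x; rewrite ReN.
by apply: (eq_bmeas _ (bmeasN h2)) => x; rewrite ImN.
Qed.

Lemma csumB l g h : cbm g -> cbm h -> csum l (fun s => g s - h s) = csum l g - csum l h.
Proof.
move=> bg bh; rewrite -mulN1r -(csumZ l (-1) bh) -csumD//; last first.
  by apply: cbmM => //; exact: cbm_cst.
by apply: eq_csum => s; rewrite mulN1r.
Qed.

(** The l1 norm of the plane is subadditive and submultiplicative as the modulus
    is, and bounding it amounts to bounding the integrals of real and imaginary
    parts. *)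
Definition n1 (z : R[i]) : R := `|Re z| + `|Im z|.

Lemma n1_ge0 z : 0 <= n1 z. Proof. by rewrite addr_ge0. Qed.

Lemma n1_cabs z : n1 z <= 2 * cabs z.
Proof. by rewrite mulrDl mul1r lerD// ?cabs_Re ?cabs_Im. Qed.

Lemma n1D x y : n1 (x + y) <= n1 x + n1 y.
Proof.
rewrite /n1 !ReIm; have := ler_normD (Re x) (Re y); have := ler_normD (Im x) (Im y).
lra.
Qed.

Lemma n1M x y : n1 (x * y) <= n1 x * n1 y.
Proof.
rewrite /n1 !ReIm; have := ler_normB (Re x * Re y) (Im x * Im y).
have := ler_normD (Re x * Im y) (Im x * Re y); rewrite !normrM; lra.
Qed.

(** For f >= 0, an upper bound of the integral of f against the total variation of
    the measure, which depends on the representation l. *)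
Definition vsum l (f : R -> R) : R := \sum_(cp <- l) n1 cp.1 * \int[cp.2]_x f x.

Lemma csum_le l g (f : R -> R) : cbm g -> bmeas f -> (forall s, n1 (g s) <= f s) ->
  n1 (csum l g) <= 2 * vsum l f.
Proof.
move=> bg bf gf; rewrite /csum /vsum; elim: l => [|[c p] l IH].
  by rewrite !big_nil /n1 /= normr0 addr0 mulr0.
rewrite !big_cons mulrDr; apply: (le_trans (n1D _ _)); apply: lerD => //.
apply: (le_trans (n1M _ _)); rewrite mulrCA ler_wpM2l ?n1_ge0//=.
rewrite mulrDl mul1r /n1 /=; have [b1 b2] := bg; apply: lerD.
  apply: Rint_norm_le; [exact: bmeas_L1|exact: bmeas_L1|move=> x].
  by apply: (le_trans _ (gf x)); rewrite lerDl.
apply: Rint_norm_le; [exact: bmeas_L1|exact: bmeas_L1|move=> x].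
by apply: (le_trans _ (gf x)); rewrite lerDr.
Qed.

Lemma vsum_cst l B : vsum l (fun=> B) = B * vsum l (fun=> 1).
Proof.
rewrite /vsum mulr_sumr; apply: eq_bigr => cp _; rewrite mulrCA; congr (_ * _).
rewrite -RintZ; first by apply: eq_Rint => x; rewrite mulr1.
exact: finite_measure_integrable_cst.
Qed.

Lemma vsum_ge0 l f : (forall x, 0 <= f x) -> 0 <= vsum l f.
Proof. by move=> f0; apply: sumr_ge0 => cp _; rewrite mulr_ge0 ?n1_ge0 ?Rint_ge0. Qed.

Lemma csum_le_cst l g B : cbm g -> (forall s, n1 (g s) <= B) ->
  n1 (csum l g) <= 2 * (B * vsum l (fun=> 1)).
Proof. by move=> bg gB; rewrite -vsum_cst; apply: csum_le => //; exact: bmeas_cst. Qed.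

Lemma vsum_cvg0 l (f_ : nat -> R -> R) B : (forall n, Rmeas (f_ n)) ->
  (forall n s, 0 <= f_ n s <= B) -> (forall s, f_ n s @[n --> \oo] --> (0 : R)) ->
  vsum l (f_ n) @[n --> \oo] --> (0 : R).
Proof.
move=> mf fB f0; rewrite /vsum; elim: l => [|[c p] l IH].
  by under eq_cvg do rewrite big_nil; exact: cvg_cst.
have -> : (fun n => \sum_(cp <- (c, p) :: l) n1 cp.1 * \int[cp.2]_x f_ n x) =
  (fun n => n1 c * \int[p]_x f_ n x + \sum_(cp <- l) n1 cp.1 * \int[cp.2]_x f_ n x).
  by apply/funext => n; rewrite big_cons.
suff pf : \int[p]_x f_ n x @[n --> \oo] --> (0 : R).
  have cp : n1 c * \int[p]_x f_ n x @[n --> \oo] --> n1 c * 0 by exact: cvgMr.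
  have h := cvgD cp IH; rewrite mulr0 addr0 in h; exact: h.
have [|||||_] := @Rint_dct _ _ _ p f_ (fun=> 0) (fun=> B) => //.
- exact: finite_measure_integrable_cst.
- by move=> n x; have /andP[a b] := fB n x; rewrite ger0_norm.
- by rewrite (_ : \int[p]_x 0 = 0)//; rewrite /Rintegral integral0.
Qed.

Lemma csum_dct l (g_ : nat -> R -> R[i]) g B :
  (forall n, cbm (g_ n)) -> cbm g -> (forall n s, n1 (g_ n s - g s) <= B) ->
  (forall s, n1 (g_ n s - g s) @[n --> \oo] --> (0 : R)) ->
  n1 (csum l (g_ n) - csum l g) @[n --> \oo] --> (0 : R).
Proof.
move=> bg_ bg gB g0.
have bB n := cbmB (bg_ n) bg.
have mn n : Rmeas (fun s => n1 (g_ n s - g s)).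
  by have [[m1 _] [m2 _]] := bB n; rewrite /n1; mftac.
have V0 := vsum_cvg0 l mn (B := B) _ g0.
have V1 : 2 * vsum l (fun s => n1 (g_ n s - g s)) @[n --> \oo] --> (0 : R).
  rewrite -[0 as X in _ --> X](mulr0 2); apply: cvgMr; apply: V0 => n s.
  by rewrite n1_ge0 gB.
apply: squeeze_cvgr; [|exact: cvg_cst|exact: V1].
apply: nearW => n; rewrite n1_ge0 /= -csumB//; apply: csum_le => //.
by split; [exact: mn|exists B => s; rewrite ger0_norm ?n1_ge0].
Qed.

Section FubiniCsum.
Context d (T : measurableType d) (m : {sigma_finite_measure set T -> \bar R}).
Variables (G : R -> T -> R[i]) (H : T -> R).
Hypothesis mG1 : measurable_fun setT (fun z : cR * T => Re (G z.1 z.2)).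
Hypothesis mG2 : measurable_fun setT (fun z : cR * T => Im (G z.1 z.2)).
Hypothesis GH : forall s t, n1 (G s t) <= H t.
Hypothesis IH : L1 m H.

Let H1 s t : `|Re (G s t)| <= H t.
Proof. by apply: (le_trans _ (GH s t)); rewrite lerDl. Qed.
Let H2 s t : `|Im (G s t)| <= H t.
Proof. by apply: (le_trans _ (GH s t)); rewrite lerDr. Qed.

Let I1 (p : fmeas R) : L1 p (fun=> 1 : R).
Proof. exact: finite_measure_integrable_cst. Qed.

Let swap1 : measurable_fun setT (fun z : T * cR => Re (G z.2 z.1)).
Proof.
exact: (@measurableT_comp _ _ _ _ _ _ (fun z : cR * T => Re (G z.1 z.2)) _ _ mG1 (@measurable_swap _ _ T cR)).
Qed.
Let swap2 : measurable_fun setT (fun z : T * cR => Im (G z.2 z.1)).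
Proof.
exact: (@measurableT_comp _ _ _ _ _ _ (fun z : cR * T => Im (G z.1 z.2)) _ _ mG2 (@measurable_swap _ _ T cR)).
Qed.

Let dom1 (t : T) (s : cR) : `|(fun z : T * cR => Re (G z.2 z.1)) (t, s)| <= H t * (fun=> 1) s.
Proof. by rewrite mulr1. Qed.
Let dom2 (t : T) (s : cR) : `|(fun z : T * cR => Im (G z.2 z.1)) (t, s)| <= H t * (fun=> 1) s.
Proof. by rewrite mulr1. Qed.

Lemma CL1_Cint (p : fmeas R) : CL1 m (fun t => Cint p (fun s => G s t)).
Proof.
split.
  exact: (@L1_partial _ _ _ _ R m p _ H (fun=> 1) swap1 IH (I1 p) dom1).
exact: (@L1_partial _ _ _ _ R m p _ H (fun=> 1) swap2 IH (I1 p) dom2).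
Qed.

Lemma CL1_csum l : CL1 m (fun t => csum l (fun s => G s t)).
Proof.
elim: l => [|[c p] l IHl].
  have -> : (fun t => csum [::] (fun s => G s t)) = (fun=> 0).
    by apply/funext => t; rewrite /csum big_nil.
  by split; exact: (@integrable0 _ _ _ m setT).
have -> : (fun t => csum ((c, p) :: l) (fun s => G s t)) =
   (fun t => c * Cint p (fun s => G s t) + csum l (fun s => G s t)).
  by apply/funext => t; rewrite /csum big_cons.
by apply: CL1D => //; apply: CL1Z; exact: CL1_Cint.
Qed.

Lemma csum_fubini l : Cint m (fun t => csum l (fun s => G s t)) =
  csum l (fun s => Cint m (G s)).
Proof.
elim: l => [|[c p] l IHl].
  rewrite /csum big_nil; apply: complex_eqP; rewrite /= /Rintegral.
    by under eq_integral do rewrite big_nil /=; rewrite integral0.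
  by under eq_integral do rewrite big_nil /=; rewrite integral0.
transitivity (Cint m (fun t => c * Cint p (fun s => G s t) + csum l (fun s => G s t))).
  by apply: eq_Cint => t; rewrite /csum big_cons.
rewrite (CintD (CL1Z c (CL1_Cint p)) (CL1_csum l)) IHl (CintZ c (CL1_Cint p)).
rewrite [in RHS]/csum big_cons; congr (_ * _ + _).
apply: complex_eqP => /=.
  exact: (@Rfubini _ _ _ _ R m p _ H (fun=> 1) swap1 IH (I1 p) dom1).
exact: (@Rfubini _ _ _ _ R m p _ H (fun=> 1) swap2 IH (I1 p) dom2).
Qed.

End FubiniCsum.

Section ProductCsum.
Variable m : cR * cR -> cR.
Hypothesis mm : measurable_fun setT m.

Lemma cbm_csum l (G : R -> R -> R[i]) B :
  measurable_fun setT (fun z : cR * cR => Re (G z.1 z.2)) ->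
  measurable_fun setT (fun z : cR * cR => Im (G z.1 z.2)) ->
  (forall s t, n1 (G s t) <= B) -> cbm (fun t => csum l (fun s => G s t)).
Proof.
move=> m1 m2 GB.
have bG t : cbm (fun s => G s t).
  split; split.
  - exact: (@measurableT_comp _ _ _ _ _ _ (fun z : cR * cR => Re (G z.1 z.2)) _ (pair^~ t) m1 (pair2_measurable _)).
  - by exists B => s; apply: (le_trans _ (GB s t)); rewrite lerDl.
  - exact: (@measurableT_comp _ _ _ _ _ _ (fun z : cR * cR => Im (G z.1 z.2)) _ (pair^~ t) m2 (pair2_measurable _)).
  - by exists B => s; apply: (le_trans _ (GB s t)); rewrite lerDr.
have bd t := csum_le_cst l (bG t) (fun s => GB s t).
pose p1 : fmeas R := @dirac _ cR 0 R.
have IB : L1 p1 (fun=> B : R) by exact: finite_measure_integrable_cst.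
have [J1 J2] := CL1_csum (m := p1) m1 m2 GB IB l.
split; split; [exact: L1_meas J1| |exact: L1_meas J2|].
- by eexists => t; apply: (le_trans _ (bd t)); rewrite lerDl.
- by eexists => t; apply: (le_trans _ (bd t)); rewrite lerDr.
Qed.

Lemma csum_product l1 l2 : exists l, forall g, cbm g ->
  csum l g = csum l1 (fun s => csum l2 (fun t => g (m (s, t)))).
Proof.
have push c (p : fmeas R) l2' : exists l, forall g, cbm g ->
    csum l g = c * Cint p (fun s => csum l2' (fun t => g (m (s, t)))).
  elim: l2' => [|[b q] l2' [l IHl]].
    exists [::] => g bg; rewrite /csum big_nil (_ : Cint p _ = 0) ?mulr0//.
    apply: complex_eqP; rewrite /= /Rintegral.
      by under eq_integral do rewrite big_nil /=; rewrite integral0.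
    by under eq_integral do rewrite big_nil /=; rewrite integral0.
  pose pq : fmeas R := push_product p q mm.
  exists ((c * b, pq) :: l) => g bg.
  have [[mg1 [B1 b1]] [mg2 [B2 b2]]] := bg.
  rewrite [LHS]/csum big_cons -/(csum l g) IHl//=.
  have mG1 : measurable_fun setT (fun z : cR * cR => Re (g (m (z.2, z.1)))).
    apply: (Rmeas_comp mg1); apply: measurableT_comp => //; exact: measurable_swap.
  have mG2 : measurable_fun setT (fun z : cR * cR => Im (g (m (z.2, z.1)))).
    apply: (Rmeas_comp mg2); apply: measurableT_comp => //; exact: measurable_swap.
  have gB t s : n1 ((fun t s => g (m (s, t))) t s) <= B1 + B2 by rewrite lerD.
  have IB : L1 p (fun=> B1 + B2 : R) by exact: finite_measure_integrable_cst.
  have C1 := CL1_Cint (m := p) mG1 mG2 gB IB q.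
  have C2 := CL1_csum (m := p) mG1 mG2 gB IB l2'.
  have -> : Cint pq g = Cint p (fun s => Cint q (fun t => g (m (s, t)))).
    by have [bg1 bg2] := bg; apply: complex_eqP => /=; rewrite int_push_product.
  rewrite -mulrA -mulrDr -(CintZ b C1) -(CintD (CL1Z b C1) C2); congr (_ * _).
  by apply: eq_Cint => s; rewrite /csum big_cons.
elim: l1 => [|[c p] l1 [l IHl]].
  by exists [::] => g bg; rewrite /csum !big_nil.
have [l' E'] := push c p l2.
exists (l' ++ l) => g bg.
by rewrite {1}/csum big_cat /= -/(csum l' g) -/(csum l g) E'// IHl// [in RHS]/csum big_cons.
Qed.

End ProductCsum.
End CsumTheory.

(** * Convolution of complex measures *)

(** The unqualified name also denotes convex combinations. *)
Notation mconv := Defs.conv.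

Section ComplexMeasureOps.
Variable R : realType.
Notation cR := (measurableTypeR R).
Implicit Types (mu nu : @cmeasure R) (g h phi : R -> R[i]).

Lemma cintE g : cint g = Cint (leb R) g. Proof. by []. Qed.

Lemma cbm_cisN (l : R) : cbm (fun t => cis (- (l * t))).
Proof.
split; split => /=; try mftac; exists 1 => x; [exact: cos_abs|exact: sin_abs].
Qed.

Lemma n1_cis (a : R) : n1 (cis a) <= 2.
Proof. by rewrite /n1 /= (_ : 2 = 1 + 1)// lerD ?cos_abs ?sin_abs. Qed.

Lemma eq_cmint mu g h : g =1 h -> cmint mu g = cmint mu h.
Proof. by move=> gh; have -> : g = h by apply/funext. Qed.

(** Addition for m gives the convolution of measures, and multiplication an
    average of dilations. *)
Lemma cmeasure_product (m : cR * cR -> cR) mu nu : measurable_fun setT m ->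
  exists pi : @cmeasure R, forall g, cbm g ->
    cmint pi g = cmint mu (fun s => cmint nu (fun t => g (m (s, t)))).
Proof.
move=> mm; have [l1 E1] := cmint_rep mu; have [l2 E2] := cmint_rep nu.
have [l El] := csum_product mm l1 l2; have [pi Epi] := cmint_of l.
exists pi => g bg; rewrite Epi// El// E1; apply: eq_csum => s.
by rewrite E2.
Qed.

Lemma cmeasure_scale (c : R[i]) mu : exists pi : @cmeasure R, forall g, cbm g ->
  cmint pi g = c * cmint mu g.
Proof.
have [l El] := cmint_rep mu; have [pi Epi] := cmint_of [seq (c * cp.1, cp.2) | cp <- l].
exists pi => g bg; rewrite Epi// El /csum big_map mulr_sumr.
by apply: eq_bigr => cp _; rewrite mulrA.
Qed.

Lemma cmeasure_dirac0 : exists pi : @cmeasure R, forall g, cbm g -> cmint pi g = g 0.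
Proof.
pose p : fmeas R := @dirac _ cR 0 R.
have [pi Epi] := cmint_of [:: (1, p)].
exists pi => g bg; rewrite Epi// /csum big_seq1 mul1r.
have [[m1 _] [m2 _]] := bg.
apply: complex_eqP; rewrite /= /Rintegral integral_dirac ?diracT ?mul1e//.
  exact/measurable_EFinP.
exact/measurable_EFinP.
Qed.

Lemma L1M_bmeas (f k : R -> R) : bmeas f -> L1 (leb R) k ->
  L1 (leb R) (fun x => k x * f x).
Proof.
by move=> [mf [B fB]] Ik; apply: (eq_L1R _ (L1_bdM mf fB Ik)) => x; rewrite mulrC.
Qed.

Lemma signed_density (k : R -> R) : L1 (leb R) k -> exists p n : fmeas R,
  forall f, bmeas f -> \int[p]_x f x - \int[n]_x f x = \int[leb R]_x (k x * f x).
Proof.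
move=> Ik.
have Ip : L1 (leb R) (fun x => 2^-1 * (`|k x| + k x)).
  by apply: L1Z; apply: L1D => //; exact: L1_abs.
have In : L1 (leb R) (fun x => 2^-1 * (`|k x| - k x)).
  by apply: L1Z; apply: L1B => //; exact: L1_abs.
have p0 x : 0 <= 2^-1 * (`|k x| + k x).
  by rewrite mulr_ge0 ?invr_ge0// -lerBlDr sub0r -normrN ler_norm.
have n0 x : 0 <= 2^-1 * (`|k x| - k x).
  by rewrite mulr_ge0 ?invr_ge0// subr_ge0 ler_norm.
exists (density_measure Ip p0), (density_measure In n0) => f bf.
rewrite !int_density// -(RintB (L1M_bmeas bf Ip) (L1M_bmeas bf In)).
by apply: eq_Rint => x; field.
Qed.

Lemma cmeasure_density (q : R -> R[i]) : CL1 (leb R) q ->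
  exists pi : @cmeasure R, forall g, cbm g -> cmint pi g = cint (fun t => q t * g t).
Proof.
move=> [q1 q2].
have [rp [rn Er]] := signed_density q1; have [ip [inn Ei]] := signed_density q2.
have [pi Epi] := cmint_of [:: (1, rp); (-1, rn); ('i, ip); (- 'i, inn)].
exists pi => g bg; have [bg1 bg2] := bg.
have IM := L1M_bmeas.
rewrite Epi// /csum !big_cons big_nil addr0 cintE.
apply: complex_eqP; rewrite !ReIm /=.
  rewrite -(eq_Rint (leb R) (fun x => esym (ReM (q x) (g x)))).
  rewrite (RintB (IM _ _ bg1 q1) (IM _ _ bg2 q2)) -(Er _ bg1) -(Ei _ bg2); ring.
rewrite -(eq_Rint (leb R) (fun x => esym (ImM (q x) (g x)))).
rewrite (RintD (IM _ _ bg2 q1) (IM _ _ bg1 q2)) -(Er _ bg2) -(Ei _ bg1); ring.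
Qed.

End ComplexMeasureOps.

Section CbConv.
Variable R : realType.
Notation cR := (measurableTypeR R).
Implicit Types (mu nu : @cmeasure R) (g h phi : R -> R[i]).

(** A bound for the total variation of mu. *)
Definition mass_of mu (K : R) := 0 <= K /\ forall g B, cbm g ->
  (forall s, n1 (g s) <= B) -> n1 (cmint mu g) <= K * B.

Lemma mass_ex mu : exists K, mass_of mu K.
Proof.
have [l El] := cmint_rep mu.
exists (2 * vsum l (fun=> 1)); split; first by rewrite mulr_ge0// vsum_ge0.
by move=> g B bg gB; rewrite El mulrAC -mulrA; apply: csum_le_cst.
Qed.

Lemma Cb_Re phi : Cb phi -> ucont (fun t => Re (phi t)).
Proof.
move=> [_ u] e e0; have [d d0 ud] := u e e0; exists d => // s t st.
by apply: le_lt_trans (ud _ _ st); rewrite -ReN -ReD; exact: cabs_Re.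
Qed.

Lemma Cb_Im phi : Cb phi -> ucont (fun t => Im (phi t)).
Proof.
move=> [_ u] e e0; have [d d0 ud] := u e e0; exists d => // s t st.
by apply: le_lt_trans (ud _ _ st); rewrite -ImN -ImD; exact: cabs_Im.
Qed.

Lemma Cb_cbm phi : Cb phi -> cbm phi.
Proof.
move=> bp; have [[B pB] _] := bp; split; split.
- exact: ucont_meas (Cb_Re bp).
- by exists B => x; exact: le_trans (cabs_Re _) (pB x).
- exact: ucont_meas (Cb_Im bp).
- by exists B => x; exact: le_trans (cabs_Im _) (pB x).
Qed.

Lemma cbm_reflect phi (t : R) : cbm phi -> cbm (fun s => phi (t - s)).
Proof. by move=> bp; apply: (cbm_comp (m := fun s : R => t - s)) => //; mftac. Qed.

Lemma cmintB mu g h : cbm g -> cbm h -> cmint mu (fun s => g s - h s) = cmint mu g - cmint mu h.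
Proof. by move=> bg bh; have [l El] := cmint_rep mu; rewrite !El csumB. Qed.

Lemma cmintZ mu c g : cbm g -> cmint mu (fun s => c * g s) = c * cmint mu g.
Proof. by move=> bg; have [l El] := cmint_rep mu; rewrite !El csumZ. Qed.

Lemma Cb_conv mu phi : Cb phi -> Cb (mconv mu phi).
Proof.
move=> bp; have cp := Cb_cbm bp; have [[B pB] u] := bp; have [K [K0 KB]] := mass_ex mu.
split.
  exists (K * (2 * B)) => t; apply: (le_trans (cabs_le _)).
  apply: KB; first exact: cbm_reflect.
  by move=> s; apply: (le_trans (n1_cabs _)); rewrite ler_wpM2l.
move=> e e0; have [d d0 ud] := u (e / (2 * (K + 1))) (divr_gt0 e0 (mulr_gt0 (ltr0n _ 2) (ltr_wpDl K0 ltr01))).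
exists d => // s t st; rewrite -(cmintB mu (cbm_reflect s cp) (cbm_reflect t cp)).
apply: (le_lt_trans (cabs_le _)).
apply: (@le_lt_trans _ _ (K * (2 * (e / (2 * (K + 1)))))).
  apply: KB; first by apply: cbmB; exact: cbm_reflect.
  move=> r; apply: (le_trans (n1_cabs _)); rewrite ler_wpM2l// ltW// ud//.
  by rewrite opprB addrA subrK.
have K1 : 0 < K + 1 by rewrite ltr_wpDl.
rewrite (_ : _ * _ = e * (K / (K + 1))); last by field; exact: lt0r_neq0.
by rewrite gtr_pMr// ltr_pdivrMr// mul1r ltrDl.
Qed.

(** The sign sg selects the direction of decay, +oo for 1 and -oo for -1, so that
    the past and the future are treated together. *)
Definition vanish (sg : R) phi := forall e : R, 0 < e ->
  exists A : R, forall t, A < sg * t -> cabs (phi t) < e.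

(** Dominated convergence along a sequence t_n with sg t_n > n: for each s,
    phi (t_n - s) tends to 0. *)
Lemma vanish_conv (sg : R) mu phi : sg ^+ 2 = 1 -> Cb phi -> vanish sg phi ->
  vanish sg (mconv mu phi).
Proof.
move=> sg1 bp vp; have cp := Cb_cbm bp; have [[B pB] _] := bp.
apply: contrapT => /existsNP[e /not_implyP[e0 /forallNP ne]].
have tn (n : nat) : exists t, n%:R < sg * t /\ e <= cabs (mconv mu phi t).
  have /existsNP[t /not_implyP[nt /negP]] := ne n%:R.
  by rewrite -leNgt => et; exists t.
have [t_ tP] := choice tn.
have [l El] := cmint_rep mu.
have sgsg (r : R) : sg * (sg * r) = r by rewrite mulrA -expr2 sg1 mul1r.
have z0 : cbm (fun=> 0 : R[i]) by exact: cbm_cst.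
have cv := @csum_dct _ l (fun n s => phi (t_ n - s)) (fun=> 0) (2 * B) _ z0 _ _.
have {cv} : n1 (csum l (fun s => phi (t_ n - s)) - csum l (fun=> 0)) @[n --> \oo] --> (0 : R).
  apply: cv => [n|n s|s]; first exact: cbm_reflect.
    by rewrite subr0; apply: (le_trans (n1_cabs _)); rewrite ler_wpM2l.
  apply/cvgrPdist_lt => d d0; have [A AP] := vp (d / 2) (divr_gt0 d0 (ltr0n _ 2)).
  near=> n; rewrite sub0r normrN subr0 ger0_norm ?n1_ge0//.
  apply: (le_lt_trans (n1_cabs _)).
  have := AP (t_ n - s); rewrite mulrBr.
  have [nt _] := tP n.
  have An : A < sg * t_ n - sg * s.
    rewrite ltrBrDr; apply: le_lt_trans nt.
    by near: n; exact: nbhs_infty_ger.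
  by move=> /(_ An); lra.
have -> : csum l (fun=> 0) = 0.
  rewrite /csum big1// => cp0 _; rewrite (_ : Cint _ _ = 0) ?mulr0//.
  by apply: complex_eqP; rewrite /= /Rintegral integral0.
move=> /cvgrPdist_lt/(_ _ e0) [N _ /(_ N (leqnn N))] /=.
rewrite sub0r normrN subr0 ger0_norm ?n1_ge0// -El => nN.
have [_] := tP N; rewrite leNgt => /negP; apply.
exact: le_lt_trans (cabs_le _) nN.
Unshelve. all: by end_near. Qed.

Lemma fourier_product mu nu : exists pi : @cmeasure R,
  (forall l, fourier_measure pi l = fourier_measure mu l * fourier_measure nu l) /\
  (forall phi, cbm phi -> mconv pi phi = mconv mu (mconv nu phi)).
Proof.
have mm : measurable_fun setT (fun z : cR * cR => (z.1 + z.2 : R)) by mftac.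
have [pi Epi] := cmeasure_product mu nu mm.
exists pi; split.
  move=> l; rewrite /fourier_measure Epi; last exact: cbm_cisN.
  have -> : (fun s => cmint nu (fun t => cis (- (l * (s + t))))) =
     (fun s => cmint nu (fun t => cis (- (l * t))) * cis (- (l * s))).
    apply/funext => s; rewrite mulrC -cmintZ; last exact: cbm_cisN.
    by apply: eq_cmint => t; rewrite -cis_add mulrDr opprD.
  by rewrite cmintZ 1?mulrC//; exact: cbm_cisN.
move=> phi bp; apply/funext => t; rewrite /mconv Epi; last exact: cbm_reflect.
by apply: eq_cmint => s; apply: eq_cmint => r; rewrite opprD addrA.
Qed.

Lemma fourier_scale (c : R[i]) mu : exists pi : @cmeasure R,
  (forall l, fourier_measure pi l = c * fourier_measure mu l) /\
  (forall phi, cbm phi -> mconv pi phi = (fun t => c * mconv mu phi t)).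
Proof.
have [pi Epi] := cmeasure_scale c mu; exists pi; split.
  by move=> l; rewrite /fourier_measure Epi//; exact: cbm_cisN.
by move=> phi bp; apply/funext => t; rewrite /mconv Epi//; exact: cbm_reflect.
Qed.

Lemma cbm_fourier_measure mu : cbm (fourier_measure mu).
Proof.
have [l El] := cmint_rep mu.
have -> : fourier_measure mu = (fun r => csum l (fun s => cis (- (r * s)))).
  by apply/funext => r; rewrite /fourier_measure El.
apply: (@cbm_csum _ l (fun s r => cis (- (r * s))) 2).
- by rewrite /=; mftac.
- by rewrite /=; mftac.
- by move=> s t; exact: n1_cis.
Qed.

Lemma continuous_fourier_measure mu : continuous (fun l => Re (fourier_measure mu l)).
Proof.
have [l El] := cmint_rep mu.
suff u : forall e : R, 0 < e -> exists2 d : R, 0 < d &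
    forall s t, `|s - t| < d -> n1 (fourier_measure mu s - fourier_measure mu t) < e.
  apply: ucont_continuous => e e0; have [d d0 ud] := u e e0; exists d => // s t st.
  by apply: le_lt_trans (ud _ _ st); rewrite /n1 !ReIm lerDl.
move=> e e0; pose f_ (n : nat) (s : R) := 2 * Num.min 2 (n.+1%:R^-1 * `|s|).
have mf n : Rmeas (f_ n).
  apply: measurable_funM; first by mftac.
  by apply: measurable_minr; mftac.
have fB n s : 0 <= f_ n s <= 4.
  rewrite mulr_ge0 ?le_min ?ler0n ?mulr_ge0//= /f_ (_ : 4 = 2 * 2) ?ler_wpM2l ?ge_min ?lexx//.
  by rewrite -natrM.
have f0 s : f_ n s @[n --> \oo] --> (0 : R).
  have c0 : 2 * (n.+1%:R^-1 * `|s|) @[n --> \oo] --> (0 : R).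
    rewrite -[0 as X in _ --> X](mulr0 2); apply: cvgMr.
    by rewrite -[0 as X in _ --> X](mul0r `|s|); apply: cvgMl; exact: harmonic0.
  apply: squeeze_cvgr; [|exact: cvg_cst|exact: c0].
  apply: nearW => n; have /andP[-> _] /= := fB n s.
  by rewrite ler_wpM2l// ge_min lexx orbT.
have := vsum_cvg0 l mf fB f0; move=> /cvgrPdist_lt/(_ _ (divr_gt0 e0 (ltr0n _ 2))).
move=> [N _ /(_ N (leqnn N))] /=; rewrite sub0r normrN ger0_norm; last first.
  by apply: vsum_ge0 => x; have /andP[] := fB N x.
move=> VN; exists N.+1%:R^-1 => // s t st.
rewrite /fourier_measure -(cmintB mu (cbm_cisN s) (cbm_cisN t)) El.
apply: (@le_lt_trans _ _ (2 * vsum l (f_ N))); last by move: VN; lra.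
apply: csum_le; first by apply: cbmB; exact: cbm_cisN.
  by split=> //; exists 4 => x; have /andP[a b] := fB N x; rewrite ger0_norm.
move=> x; rewrite /f_ mulrDl mul1r /n1 !ReIm /=.
have sx : `|- (s * x) - - (t * x)| <= N.+1%:R^-1 * `|x|.
  by rewrite -opprD normrN -mulrBl normrM ler_wpM2r// ltW.
have two : 2 = 1 + 1 :> R by [].
apply: lerD; rewrite le_min; apply/andP; split.
- by apply: (le_trans (ler_normB _ _)); rewrite two lerD ?cos_abs.
- exact: le_trans (cos_lip _ _) sx.
- by apply: (le_trans (ler_normB _ _)); rewrite two lerD ?sin_abs.
- exact: le_trans (sin_lip _ _) sx.
Qed.

End CbConv.

(** * Distributional Fourier transforms of convolutions *)

Section ComplexMeasurability.
Variable R : realType.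

Lemma cbm_Re_comp d (T : measurableType d) (f : R -> R[i]) (g : T -> R) :
  cbm f -> measurable_fun setT g -> measurable_fun setT (fun z => Re (f (g z))).
Proof. by move=> [[mf _] _]; exact: (@Rmeas_comp R d T (fun x => Re (f x))). Qed.

Lemma cbm_Im_comp d (T : measurableType d) (f : R -> R[i]) (g : T -> R) :
  cbm f -> measurable_fun setT g -> measurable_fun setT (fun z => Im (f (g z))).
Proof. by move=> [_ [mf _]]; exact: (@Rmeas_comp R d T (fun x => Im (f x))). Qed.

End ComplexMeasurability.

Ltac cmftac := repeat match goal with
  | H : cbm ?f |- measurable_fun _ (fun z => complex.Re (?f (@?g z))) =>
      apply: (@cbm_Re_comp _ _ _ f g H)
  | H : cbm ?f |- measurable_fun _ (fun z => complex.Im (?f (@?g z))) =>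
      apply: (@cbm_Im_comp _ _ _ f g H)
  | |- measurable_fun _ (fun z => z.1) => exact: meas_fst
  | |- measurable_fun _ (fun z => z.2) => exact: meas_snd
  | |- measurable_fun _ (fun z => z) => exact: meas_id
  | |- measurable_fun _ (fun z => ?c) => exact: measurable_cst
  | |- measurable_fun _ (fun z => @GRing.opp _ _) => apply: measurable_funN
  | |- measurable_fun _ (fun z => @GRing.add _ _ (GRing.opp _)) => apply: measurable_funB
  | |- measurable_fun _ (fun z => @GRing.add _ _ _) => apply: measurable_funD
  | |- measurable_fun _ (fun z => @GRing.mul _ _ _) => apply: measurable_funM
  | |- measurable_fun _ (fun z => @cos _ _) => apply: meas_cos
  | |- measurable_fun _ (fun z => @sin _ _) => apply: meas_sin
  end.

Section SchwartzFacts.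
Variable R : realType.
Notation cR := (measurableTypeR R).

(** This decay makes a test function, and by L1_CtSt its transform, integrable. *)
Lemma rapidly_decreasing_decay (g : R -> R) : rapidly_decreasing g ->
  exists B : R, [/\ forall x : R, is_derive x (1 : R) g (derive1 g x),
    continuous (derive1 g), forall x, `|g x| <= B * poisson 1 x &
    forall x, `|derive1 g x| <= B * poisson 1 x].
Proof.
move=> [dg bg].
have d0 (x : R) : is_derive x (1 : R) g (derive1 g x).
  by rewrite derive1E; apply: derivableP; exact: (dg 0%N).
have c1 : continuous (derive1 g).
  by move=> x; apply: differentiable_continuous; apply/derivable1_diffP; exact: (dg 1%N).
have [B00 b00] := bg 0%N 0%N; have [B20 b20] := bg 2%N 0%N.
have [B01 b01] := bg 0%N 1%N; have [B21 b21] := bg 2%N 1%N.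
have key (f : R -> R) (A C : R) : (forall t, `|t ^+ 0 * f t| <= A) ->
    (forall t, `|t ^+ 2 * f t| <= C) -> forall x, `|f x| <= (A + C) * poisson 1 x.
  move=> fA fC x; have := fA x; have := fC x.
  rewrite expr0 mul1r normrM (ger0_norm (sqr_ge0 x)) => h1 h2.
  have q0 : 0 < 1 + x ^+ 2 by rewrite ltr_pwDl ?sqr_ge0.
  have AC0 : 0 <= A + C by rewrite addr_ge0 ?(le_trans (normr_ge0 _) (fA 0)) ?(le_trans (normr_ge0 _) (fC 0)).
  rewrite poissonE mulr1 expr1n mulrA ler_pdivlMr//.
  apply: (@le_trans _ _ (A + C)); last by rewrite ler_peMr// ler1n.
  rewrite mulrDr mulr1; lra.
exists (B00 + B20 + (B01 + B21)).
have p0 x : 0 <= poisson (1 : R) x by rewrite ltW ?poisson_gt0.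
have S0 : 0 <= B00 + B20.
  by rewrite addr_ge0 ?(le_trans (normr_ge0 _) (b00 0)) ?(le_trans (normr_ge0 _) (b20 0)).
have S1 : 0 <= B01 + B21.
  by rewrite addr_ge0 ?(le_trans (normr_ge0 _) (b01 0)) ?(le_trans (normr_ge0 _) (b21 0)).
split => // x.
- by apply: (le_trans (key _ _ _ b00 b20 x)); rewrite ler_wpM2r// lerDl.
- by apply: (le_trans (key _ _ _ b01 b21 x)); rewrite ler_wpM2r// lerDr.
Qed.

Lemma fourierE (q : R -> R[i]) (l : R) : CL1 (leb R) q -> fourier q l =
  (Ct (fun t => Re (q t)) l + St (fun t => Im (q t)) l) +i*
  (Ct (fun t => Im (q t)) l - St (fun t => Re (q t)) l).
Proof.
move=> [q1 q2]; rewrite /fourier /cint; congr (_ +i* _).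
  rewrite -(RintD (L1_cosM l q1) (L1_sinM l q2)); apply: eq_Rint => t.
  by rewrite ReM /= cosN sinN; ring.
rewrite -(RintB (L1_cosM l q2) (L1_sinM l q1)); apply: eq_Rint => t.
by rewrite ImM /= cosN sinN; ring.
Qed.

Lemma CL1M (g f : R -> R[i]) : cbm g -> CL1 (leb R) f -> CL1 (leb R) (fun t => g t * f t).
Proof.
move=> [g1 g2] [f1 f2].
have IM (a b : R -> R) : bmeas a -> L1 (leb R) b -> L1 (leb R) (fun t => a t * b t).
  by move=> [ma [B aB]]; exact: L1_bdM.
split.
  by apply: (eq_L1R _ (L1B (IM _ _ g1 f1) (IM _ _ g2 f2))) => t; rewrite ReM.
by apply: (eq_L1R _ (L1D (IM _ _ g1 f2) (IM _ _ g2 f1))) => t; rewrite ImM.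
Qed.

Lemma L1_n1 (f : R -> R[i]) : CL1 (leb R) f -> L1 (leb R) (fun t => n1 (f t)).
Proof. by move=> [f1 f2]; exact: L1D (L1_abs f1) (L1_abs f2). Qed.

Lemma n1_Cint (f : R -> R[i]) : CL1 (leb R) f -> n1 (cint f) <= 2 * \int[leb R]_t n1 (f t).
Proof.
move=> cf; have [f1 f2] := cf; rewrite mulrDl mul1r /n1 /=; apply: lerD.
  apply: Rint_norm_le => //; first exact: L1_n1.
  by move=> x; rewrite lerDl.
apply: Rint_norm_le => //; first exact: L1_n1.
by move=> x; rewrite lerDr.
Qed.

Lemma fourier_cbm (q : R -> R[i]) : CL1 (leb R) q -> cbm (fourier q).
Proof.
move=> cq; have [q1 q2] := cq.
have -> : fourier q = (fun l => (Ct (fun t => Re (q t)) l + St (fun t => Im (q t)) l) +i*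
  (Ct (fun t => Im (q t)) l - St (fun t => Re (q t)) l)).
  by apply/funext => l; exact: fourierE.
have bC (f : R -> R) : L1 (leb R) f -> bmeas (Ct f).
  move=> If; split; first exact: ucont_meas (ucont_Ct If).
  by eexists => t; exact: Ct_le.
have bS (f : R -> R) : L1 (leb R) f -> bmeas (St f).
  move=> If; split; first exact: ucont_meas (ucont_St If).
  by eexists => t; exact: St_le.
split => /=; apply: bmeasD => //; [exact: bC|exact: bS|exact: bC|].
by apply: bmeasN; exact: bS.
Qed.

Variable eta : @schwartz R.


Let base (g : R -> R) : rapidly_decreasing g ->
  [/\ bmeas g, L1 (leb R) g, L1 (leb R) (fun t => g t ^+ 2), L1 (leb R) (Ct g) & L1 (leb R) (St g)].
Proof.
move=> /rapidly_decreasing_decay[B [dg cg gB dgB]].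
have mg : Rmeas g by apply: meas_continuous; exact: is_derive_continuous dg.
have [IC IS] := L1_CtSt dg cg gB dgB.
split=> //; [split=> //|exact: L1_decay gB|exact: sq_L1_decay gB].
have B0 : 0 <= B.
  by have := le_trans (normr_ge0 _) (gB 0); rewrite pmulr_lge0// poisson_gt0.
exists (B * (2 / 1)) => x; apply: (le_trans (gB x)); rewrite ler_wpM2l//.
by apply: (le_trans (ler_norm _)); exact: poisson_le.
Qed.

Lemma schwartz_cbm : cbm eta.
Proof. by split; [have [] := base (schwartz_re eta)|have [] := base (schwartz_im eta)]. Qed.

Lemma schwartz_CL1 : CL1 (leb R) eta.
Proof. by split; [have [] := base (schwartz_re eta)|have [] := base (schwartz_im eta)]. Qed.

Lemma schwartz_L2 : L1 (leb R) (fun t => Re (eta t) ^+ 2) /\ L1 (leb R) (fun t => Im (eta t) ^+ 2).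
Proof. by split; [have [] := base (schwartz_re eta)|have [] := base (schwartz_im eta)]. Qed.

Lemma schwartz_fourier_CL1 : CL1 (leb R) (fourier eta).
Proof.
have [_ _ _ r1 r2] := base (schwartz_re eta); have [_ _ _ i1 i2] := base (schwartz_im eta).
split.
  apply: (eq_L1R _ (L1D r1 i2)) => l; by rewrite (fourierE l schwartz_CL1).
by apply: (eq_L1R _ (L1B i1 r2)) => l; rewrite (fourierE l schwartz_CL1).
Qed.

Lemma Cfubini (F : R -> R -> R[i]) (a b : R -> R) :
  measurable_fun setT (fun z : cR * cR => Re (F z.1 z.2)) ->
  measurable_fun setT (fun z : cR * cR => Im (F z.1 z.2)) ->
  L1 (leb R) a -> L1 (leb R) b -> (forall x y, n1 (F x y) <= a x * b y) ->
  Cint (leb R) (fun x => Cint (leb R) (F x)) =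
  Cint (leb R) (fun y => Cint (leb R) (F^~ y)).
Proof.
move=> m1 m2 Ia Ib Fab; apply: complex_eqP => /=.
  apply: (@Rfubini _ _ _ _ R (leb R) (leb R) _ a b m1 Ia Ib) => x y /=.
  by apply: (le_trans _ (Fab x y)); rewrite lerDl.
apply: (@Rfubini _ _ _ _ R (leb R) (leb R) _ a b m2 Ia Ib) => x y /=.
by apply: (le_trans _ (Fab x y)); rewrite lerDr.
Qed.

Lemma Cint_shift (c : R) (f : R -> R[i]) : CL1 (leb R) f ->
  Cint (leb R) (fun t => f (t - c)) = Cint (leb R) f.
Proof.
by move=> [f1 f2]; apply: complex_eqP => /=; [exact: Rint_shift f1|exact: Rint_shift f2].
Qed.

(** Fubini's theorem: translating phi by s multiplies its transform by
    exp (- i l s), and integrating over s makes the transform of mu appear. *)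
Lemma FT_conv_L1 (mu : @cmeasure R) (phi : R -> R[i]) : cbm phi -> CL1 (leb R) phi ->
  FT (mconv mu phi) eta =
  cint (fun l => fourier_measure mu l * (fourier phi l * eta l)).
Proof.
move=> bp cp; have [L EL] := cmint_rep mu.
have [be ce] := (schwartz_cbm, schwartz_CL1); have cf := schwartz_fourier_CL1.
have bf := fourier_cbm ce; have bfp := fourier_cbm cp.
have [[_ [A1 a1]] [_ [A2 a2]]] := bp.
have pA t : n1 (phi t) <= A1 + A2 by rewrite lerD.
have nn t : 0 <= n1 (fourier eta t) by exact: n1_ge0.
transitivity (Cint (leb R) (fun t => csum L (fun s => phi (t - s) * fourier eta t))).
  rewrite /FT cintE; apply: eq_Cint => t; rewrite /mconv EL mulrC -csumZ; last exact: cbm_reflect.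
  by apply: eq_csum => s; rewrite mulrC.
rewrite (@csum_fubini _ _ _ (leb R) (fun s t => phi (t - s) * fourier eta t)
   (fun t => (A1 + A2) * n1 (fourier eta t))); last 4 first.
- apply: (@eq_measurable_fun _ _ _ _ setT (fun z : cR * cR => Re (phi (z.2 - z.1)) * Re (fourier eta z.2) - Im (phi (z.2 - z.1)) * Im (fourier eta z.2))).
    by move=> z _; rewrite ReM.
  by cmftac.
- apply: (@eq_measurable_fun _ _ _ _ setT (fun z : cR * cR => Re (phi (z.2 - z.1)) * Im (fourier eta z.2) + Im (phi (z.2 - z.1)) * Re (fourier eta z.2))).
    by move=> z _; rewrite ImM.
  by cmftac.
- by move=> s t; apply: (le_trans (n1M _ _)); rewrite ler_wpM2r.
- by apply: L1Z; exact: L1_n1.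
transitivity (csum L (fun s => Cint (leb R) (fun l => cis (- (l * s)) * (fourier phi l * eta l)))).
  apply: eq_csum => s.
  transitivity (Cint (leb R) (fun t => Cint (leb R) (fun l => phi (t - s) * (cis (- (t * l)) * eta l)))).
    apply: eq_Cint => t; rewrite CintZ//; apply: CL1M ce; exact: cbm_cisN.
  rewrite (@Cfubini _ (fun t => n1 (phi (t - s))) (fun l => 2 * n1 (eta l))); last 5 first.
  - apply: (@eq_measurable_fun _ _ _ _ setT (fun z : cR * cR =>
       Re (phi (z.1 - s)) * (cos (- (z.1 * z.2)) * Re (eta z.2) - sin (- (z.1 * z.2)) * Im (eta z.2))
     - Im (phi (z.1 - s)) * (cos (- (z.1 * z.2)) * Im (eta z.2) + sin (- (z.1 * z.2)) * Re (eta z.2)))).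
      by move=> z _; rewrite !ReIm /=.
    by cmftac.
  - apply: (@eq_measurable_fun _ _ _ _ setT (fun z : cR * cR =>
       Re (phi (z.1 - s)) * (cos (- (z.1 * z.2)) * Im (eta z.2) + sin (- (z.1 * z.2)) * Re (eta z.2))
     + Im (phi (z.1 - s)) * (cos (- (z.1 * z.2)) * Re (eta z.2) - sin (- (z.1 * z.2)) * Im (eta z.2)))).
      by move=> z _; rewrite !ReIm /=.
    by cmftac.
  - by apply: (@L1_shift _ s (fun t => n1 (phi t))); exact: L1_n1.
  - by apply: L1Z; exact: L1_n1.
  - move=> t l; apply: (le_trans (n1M _ _)); rewrite ler_wpM2l ?n1_ge0//.
    by apply: (le_trans (n1M _ _)); rewrite ler_wpM2r ?n1_ge0// n1_cis.
  apply: eq_Cint => l.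
  have c1 : CL1 (leb R) (fun t => cis (- (l * t)) * phi t) by apply: CL1M cp; exact: cbm_cisN.
  have c2 : CL1 (leb R) (fun t => cis (- (l * (t - s))) * phi (t - s)).
    have [c11 c12] := c1; split; [exact: (L1_shift s c11)|exact: (L1_shift s c12)].
  rewrite -[fourier phi l]/(Cint (leb R) _) -(Cint_shift s c1) mulrCA mulrC -mulrA -CintZ//.
  rewrite -CintZ; last exact: CL1Z.
  apply: eq_Cint => t.
  have -> : cis (- (t * l)) = cis (- (l * s)) * cis (- (l * (t - s))) :> R[i].
    by rewrite -cis_add; congr cis; ring.
  ring.
rewrite cintE -(@csum_fubini _ _ _ (leb R) (fun s l => cis (- (l * s)) * (fourier phi l * eta l))
   (fun l => 2 * n1 (fourier phi l * eta l))); last 4 first.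
- apply: (@eq_measurable_fun _ _ _ _ setT (fun z : cR * cR =>
    cos (- (z.2 * z.1)) * (Re (fourier phi z.2) * Re (eta z.2) - Im (fourier phi z.2) * Im (eta z.2))
  - sin (- (z.2 * z.1)) * (Re (fourier phi z.2) * Im (eta z.2) + Im (fourier phi z.2) * Re (eta z.2)))).
    by move=> z _; rewrite !ReIm /=.
  by cmftac.
- apply: (@eq_measurable_fun _ _ _ _ setT (fun z : cR * cR =>
    cos (- (z.2 * z.1)) * (Re (fourier phi z.2) * Im (eta z.2) + Im (fourier phi z.2) * Re (eta z.2))
  + sin (- (z.2 * z.1)) * (Re (fourier phi z.2) * Re (eta z.2) - Im (fourier phi z.2) * Im (eta z.2)))).
    by move=> z _; rewrite !ReIm /=.
  by cmftac.
- by move=> s t; apply: (le_trans (n1M _ _)); rewrite ler_wpM2r ?n1_ge0// n1_cis.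
- by apply: L1Z; apply: L1_n1; exact: CL1M.
apply: eq_Cint => l; rewrite /fourier_measure EL [RHS]mulrC -csumZ; last exact: cbm_cisN.
by apply: eq_csum => s; rewrite mulrC.
Qed.

End SchwartzFacts.

Section SquareIntegrableTransform.
Variable R : realType.
Notation cR := (measurableTypeR R).

(** Half-open intervals make cut n a difference of two kernels sgi (cut_sgi). *)
Definition cut (n : nat) : R -> R := \1_(`[- n%:R, n%:R[%classic).

Lemma meas_cut n : Rmeas (cut n).
Proof. by apply: meas_indic; exact: measurable_itv. Qed.

Lemma cutE n t : cut n t = if (- n%:R <= t) && (t < n%:R) then 1 else 0.
Proof.
rewrite /cut indicE; case: (boolP (_ && _)) => h.
  by rewrite mem_set//= in_itv/=.
by rewrite memNset//= in_itv/=; exact/negP.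
Qed.

Lemma cut01 n t : 0 <= cut n t <= 1.
Proof. by rewrite cutE; case: ifP => _; rewrite ?lexx ?ler01. Qed.

Lemma cut_norm n t : `|cut n t| <= 1.
Proof. by have /andP[h1 h2] := cut01 n t; rewrite ger0_norm. Qed.

Lemma cut_near (N : nat -> nat) t : (forall k, (k <= N k)%N) ->
  \forall k \near \oo, cut (N k) t = 1.
Proof.
move=> Nk; exists (Num.truncn `|t|).+1 => // k /= hk; rewrite cutE ifT//.
have h : `|t| < (N k)%:R.
  rewrite (lt_le_trans (truncnS_gt `|t|))// ler_nat; exact: leq_trans hk (Nk k).
have := ler_norm t; have := ler_norm (- t); rewrite normrN => h1 h2.
apply/andP; split; [lra|exact: le_lt_trans h2 h].
Qed.

Lemma cut_cvg (N : nat -> nat) t : (forall k, (k <= N k)%N) ->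
  cut (N k) t @[k --> \oo] --> (1 : R).
Proof. by move=> Nk; apply: cvg_near_cst; exact: cut_near. Qed.

Lemma cutM_bmeas n f : bmeas f -> bmeas (fun t => cut n t * f t).
Proof.
move=> bf; apply: bmeasM => //; split; first exact: meas_cut.
by exists 1 => x; exact: cut_norm.
Qed.

Lemma L1_indic_itv (i : interval R) (a b : R) : [set` i] `<=` `[a, b] ->
  L1 (leb R) (\1_[set` i] : R -> R).
Proof.
move=> iab.
have Iab : L1 (leb R) (\1_(`[a, b]%classic) : R -> R).
  have := @L1_indic R `[a, b]%classic (fun=> 1) (measurable_itv _) (continuous_L1_itv _ _ (@cst_continuous _ _ _)).
  by apply: eq_L1R => t; rewrite mulr1.
apply: (L1_le _ Iab); first by apply: meas_indic; exact: measurable_itv.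
move=> x; rewrite !indicE; case: (boolP (x \in _)) => [xi|_]; last by rewrite normr0.
by rewrite mem_set ?normr1//; apply: iab; rewrite inE in xi.
Qed.

Lemma L1_cut n : L1 (leb R) (cut n).
Proof.
apply: (@L1_indic_itv _ (- n%:R) n%:R) => x /=; rewrite !in_itv/= => /andP[-> /ltW ->]//.
Qed.

Lemma L1_cutM n f : bmeas f -> L1 (leb R) (fun t => cut n t * f t).
Proof.
move=> [mf [B fB]]; have := L1_bdM mf fB (L1_cut n).
by apply: eq_L1R => t; rewrite mulrC.
Qed.

Lemma L1_cutM_sq n f : bmeas f -> L1 (leb R) (fun t => (cut n t * f t) ^+ 2).
Proof.
move=> bf; have := L1_cutM n (bmeasM bf bf).
apply: eq_L1R => t; rewrite exprMn expr2 cutE; case: ifP => _; rewrite ?mul1r ?mul0r//.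
Qed.

Lemma tail_cutoff (h : R -> R) (e : R) : L1 (leb R) h -> (forall x, 0 <= h x) -> 0 < e ->
  \forall n \near \oo, \int[leb R]_t ((1 - cut n t) * h t) <= e.
Proof.
move=> Ih h0 e0; have mh := L1_meas Ih.
have mc n : Rmeas (fun t => (1 - cut n t) * h t).
  by apply: measurable_funM => //; apply: measurable_funB; [exact: measurable_cst|exact: meas_cut].
have [|t|n t|_ cv] := @Rint_dct _ _ _ (leb R) (fun n t => (1 - cut n t) * h t) (fun=> 0) h mc _ _ Ih.
- exact: measurable_cst.
- have c1 : (1 - cut n t) * h t @[n --> \oo] --> ((1 - 1) * h t : R).
    apply: cvgM; last exact: cvg_cst.
    by apply: cvgB; [exact: cvg_cst|exact: (@cut_cvg id)].
  by move: c1; rewrite subrr mul0r.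
- have /andP[c0 c1] := cut01 n t.
  rewrite normrM (ger0_norm (h0 t)) ger0_norm ?subr_ge0//.
  by rewrite ler_piMl// gerBl.
have z : \int[leb R]_(t in [set: R]) 0 = 0 :> R.
  by rewrite /Rintegral integral0.
move: cv; rewrite z => /cvgrPdist_le /(_ e e0) [n0 _ H].
exists n0 => // n /= hn; have := H n hn.
by rewrite sub0r normrN; apply: le_trans; exact: ler_norm.
Qed.

(** By 2 |d e| <= 2^k d^2 + 2^-k e^2, where the weights balance the rate 4^-k. *)
Lemma L2_pair_cvg0 (d_ : nat -> R -> R) (e : R -> R) (C : R) :
  (forall k, Rmeas (d_ k)) -> Rmeas e -> (forall k, L1 (leb R) (fun x => d_ k x ^+ 2)) ->
  (forall k, \int[leb R]_x (d_ k x ^+ 2) <= C * 4^-1 ^+ k) ->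
  L1 (leb R) (fun x => e x ^+ 2) ->
  (forall k, L1 (leb R) (fun x => `|d_ k x| * `|e x|)) /\
  \int[leb R]_x (`|d_ k x| * `|e x|) @[k --> \oo] --> (0 : R).
Proof.
move=> md me Id dC Ie.
have I k : L1 (leb R) (fun x => `|d_ k x| * `|e x|).
  by apply: (eq_L1R _ (L1_abs (L1_sqM (md k) me (Id k) Ie))) => x; rewrite normrM.
split => //.
have p2 k : 0 < 2 ^+ k :> R by rewrite exprn_gt0.
have bd k : `|\int[leb R]_x (`|d_ k x| * `|e x|)| <= (C + \int[leb R]_x (e x ^+ 2)) * 2^-1 ^+ k.
  have I1 := L1Z (2 ^+ k) (Id k); have I2 := L1Z (2^-1 ^+ k) Ie.
  rewrite ger0_norm; last by apply: Rint_ge0 => x; rewrite mulr_ge0.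
  apply: (@le_trans _ _ (\int[leb R]_x (2 ^+ k * d_ k x ^+ 2 + 2^-1 ^+ k * e x ^+ 2))).
    apply: (Rint_le (I k) (L1D I1 I2)) => x.
    rewrite -[d_ k x ^+ 2]real_normK ?num_real// -[e x ^+ 2]real_normK ?num_real//.
    have a0 := normr_ge0 (d_ k x); have b0 := normr_ge0 (e x).
    rewrite -subr_ge0.
    have -> : 2 ^+ k * `|d_ k x| ^+ 2 + 2^-1 ^+ k * `|e x| ^+ 2 - `|d_ k x| * `|e x| =
      2^-1 ^+ k * (((2 ^+ k * `|d_ k x|) - `|e x|) ^+ 2 + 2 ^+ k * `|d_ k x| * `|e x|).
      rewrite exprVn; field; exact: lt0r_neq0.
    by rewrite mulr_ge0 ?exprn_ge0 ?invr_ge0// addr_ge0 ?sqr_ge0// !mulr_ge0// ltW.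
  rewrite (RintD I1 I2) (RintZ _ (Id k)) (RintZ _ Ie) mulrDl; apply: lerD; last by rewrite mulrC.
  apply: (le_trans (ler_wpM2l (ltW (p2 k)) (dC k))).
  rewrite mulrCA ler_wpM2l//.
    have := le_trans (Rint_ge0 (leb R) (fun x => sqr_ge0 (d_ 0%N x))) (dC 0%N).
    by rewrite expr0 mulr1.
  by rewrite -exprMn (_ : 2 * 4^-1 = 2^-1 :> R)//; field.
have c0 : (C + \int[leb R]_x (e x ^+ 2)) * 2^-1 ^+ k @[k --> \oo] --> (0 : R).
  rewrite -(mulr0 (C + \int[leb R]_x (e x ^+ 2))); apply: cvgMr.
  by apply: cvg_expr; rewrite ger0_norm ?invr_ge0// invf_lt1// ltr1n.
apply/cvgr0Pnorm_le => eps e0; move/cvgr0Pnorm_le : c0 => /(_ _ e0).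
apply: filterS => k; apply: le_trans; apply: (le_trans (bd k)); exact: ler_norm.
Qed.

(** By Plancherel, the transforms of the truncations of f form a Cauchy sequence.
    The truncation times N k make the tails of f^2 geometrically small, as
    L2_limit demands; they are given, so that the real and the imaginary part of
    a complex function can share them. *)
Lemma L2_transform f (N : nat -> nat) : bmeas f -> L1 (leb R) (fun t => f t ^+ 2) ->
  (forall k, \int[leb R]_t ((1 - cut (N k) t) * f t ^+ 2) <= 4^-1 ^+ k) ->
  forall T : (R -> R) -> R -> R, (T = @Ct R \/ T = @St R) ->
  exists c : R -> R, [/\ Rmeas c, L1 (leb R) (fun x => c x ^+ 2),
    forall k, L1 (leb R) (fun x => (c x - T (fun t => cut (N k) t * f t) x) ^+ 2) &
    forall k, \int[leb R]_x ((c x - T (fun t => cut (N k) t * f t) x) ^+ 2) <= 4 * pi * 4^-1 ^+ k].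
Proof.
move=> bf I2 tl T TE; have [mf _] := bf.
have I1 k := L1_cutM (N k) bf; have I12 k := L1_cutM_sq (N k) bf.
have mT h : L1 (leb R) h -> Rmeas (T h).
  by move=> Ih; case: TE => ->; [exact: ucont_meas (ucont_Ct Ih)|exact: ucont_meas (ucont_St Ih)].
have PT h : L1 (leb R) h -> L1 (leb R) (fun s => h s ^+ 2) ->
    L1 (leb R) (fun t => T h t ^+ 2) /\ \int[leb R]_t (T h t ^+ 2) <= 2 * pi * \int[leb R]_s (h s ^+ 2).
  move=> Ih Ih2; have [P1 P2] := plancherel Ih Ih2.
  have le1 x : T h x ^+ 2 <= Ct h x ^+ 2 + St h x ^+ 2.
    by case: TE => ->; [rewrite lerDl sqr_ge0|rewrite lerDr sqr_ge0].
  have J : L1 (leb R) (fun t => T h t ^+ 2).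
    apply: (L1_le _ P1); first by apply: measurable_funX; exact: mT.
    by move=> x; rewrite ger0_norm ?sqr_ge0.
  by split=> //; apply: le_trans P2; exact: Rint_le.
have TB h g : L1 (leb R) h -> L1 (leb R) g -> forall x, T h x - T g x = T (fun t => h t - g t) x.
  move=> Ih Ig x; case: TE => ->.
    rewrite /Ct -(RintB (L1_cosM x Ih) (L1_cosM x Ig)); apply: eq_Rint => t; ring.
  rewrite /St -(RintB (L1_sinM x Ih) (L1_sinM x Ig)); apply: eq_Rint => t; ring.
have tlI k : L1 (leb R) (fun t => (1 - cut (N k) t) * f t ^+ 2).
  apply: (L1_bdM (B := 1)) I2; first by apply: measurable_funB; [exact: measurable_cst|exact: meas_cut].
  move=> x; have /andP[c0 c1] := cut01 (N k) x.
  by rewrite ger0_norm ?subr_ge0// gerBl.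
pose F k := T (fun t => cut (N k) t * f t).
have [||n m nm|c [mc c2 cc]] := @L2_limit _ _ _ (leb R) F (4 * pi).
- by move=> n; exact: mT.
- by have [] := PT _ (I1 0%N) (I12 0%N).
- have Id := L1B (I1 m) (I1 n).
  have Idsq : L1 (leb R) (fun s => (cut (N m) s * f s - cut (N n) s * f s) ^+ 2).
    have := @L1_sqD _ _ _ (leb R) _ _ (L1_meas (I1 m)) (L1_meas (L1N (I1 n))) (I12 m).
    by apply; apply: (eq_L1R _ (I12 n)) => x; rewrite sqrrN.
  have [Q1 Q2] := PT _ Id Idsq.
  have FE x : F m x - F n x = T (fun t => cut (N m) t * f t - cut (N n) t * f t) x by exact: TB.
  split; first by apply: (eq_L1R _ Q1) => x; rewrite FE.
  rewrite (eq_Rint (leb R) (g := fun x => T (fun t => cut (N m) t * f t - cut (N n) t * f t) x ^+ 2)); last by move=> x; rewrite FE.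
  apply: (le_trans Q2).
  have e4 : 4 * pi * 4^-1 ^+ n = 2 * pi * (2 * 4^-1 ^+ n) :> R by ring.
  rewrite e4 ler_wpM2l ?mulr_ge0 ?pi_ge0//.
  apply: (@le_trans _ _ (\int[leb R]_x ((1 - cut (N m) x) * f x ^+ 2 + (1 - cut (N n) x) * f x ^+ 2))).
    apply: (Rint_le Idsq (L1D (tlI m) (tlI n))) => x.
    rewrite -mulrBl exprMn -mulrDl ler_wpM2r ?sqr_ge0//.
    rewrite !cutE; case: ifP => _; case: ifP => _; rewrite !(subrr, subr0, sub0r, sqrrN, expr0n, expr1n) /=; lra.
  rewrite (RintD (tlI m) (tlI n)) mulr_natl mulr2n lerD//.
  apply: (le_trans (tl m)); rewrite ler_wiXn2l// ?invr_ge0// ?invf_le1 ?ler1n// ltr0n.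
exists c; split => // k; have [] := cc k => //.
Qed.

Lemma cbm_conv (mu : @cmeasure R) (phi : R -> R[i]) : cbm phi -> cbm (mconv mu phi).
Proof.
move=> bp; have [L EL] := cmint_rep mu.
have -> : mconv mu phi = (fun t => csum L (fun s => phi (t - s))).
  by apply/funext => t; rewrite /mconv EL.
have [[_ [A1 a1]] [_ [A2 a2]]] := bp.
apply: (@cbm_csum _ _ (fun s t => phi (t - s)) (A1 + A2)).
- by cmftac.
- by cmftac.
- by move=> s t; rewrite lerD.
Qed.

Lemma bmeas_n1 (f : R -> R[i]) : cbm f -> bmeas (fun t => n1 (f t)).
Proof.
move=> [[m1 [A1 a1]] [m2 [A2 a2]]]; split.
  by apply: measurable_funD; exact: meas_norm.
by exists (A1 + A2) => t; rewrite ger0_norm ?n1_ge0// lerD.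
Qed.

Lemma n1_eq0 (z : R[i]) : n1 z = 0 -> z = 0.
Proof.
move=> h; have := normr_ge0 (Re z); have := normr_ge0 (Im z); move: h; rewrite /n1 => h h1 h2.
by apply: complex_eqP => /=; apply/eqP; rewrite -normr_le0; lra.
Qed.

Lemma n1_limit_unique (x_ : nat -> R[i]) (a b : R[i]) :
  n1 (x_ k - a) @[k --> \oo] --> (0 : R) -> n1 (x_ k - b) @[k --> \oo] --> (0 : R) -> a = b.
Proof.
move=> ha hb; apply/eqP; rewrite -subr_eq0; apply/eqP; apply: n1_eq0.
have c : n1 (x_ k - a) + n1 (x_ k - b) @[k --> \oo] --> (0 + 0 : R) by exact: cvgD.
rewrite addr0 in c; apply/eqP; rewrite eq_le n1_ge0 andbT leNgt; apply/negP => h.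
move/cvgr0Pnorm_lt : c => /(_ _ h) [k _ /(_ k (leqnn k))].
rewrite ger0_norm ?addr_ge0 ?n1_ge0// ltNge => /negP; apply.
have -> : a - b = (x_ k - b) - (x_ k - a) by ring.
apply: (le_trans (n1D _ _)); rewrite addrC lerD// /n1 !ReIm !normrN//.
Qed.


(** The transforms of the truncations of u converge to g in L2. In the formula of
    FT_conv_L1 for the truncations, the left-hand side converges by dominated
    convergence and the right-hand side by pairing in L2 with the test function.
    One g serves for all mu: this is what computes the product of the transform
    of u by that of a measure. *)
Lemma FT_conv_L2 (u : R -> R[i]) : cbm u ->
  L1 (leb R) (fun t => Re (u t) ^+ 2) -> L1 (leb R) (fun t => Im (u t) ^+ 2) ->
  exists g : R -> R[i], [/\ Rmeas (fun l => Re (g l)), Rmeas (fun l => Im (g l)),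
    L1 (leb R) (fun l => Re (g l) ^+ 2), L1 (leb R) (fun l => Im (g l) ^+ 2) &
    forall (mu : @cmeasure R) (eta : @schwartz R),
      FT (mconv mu u) eta = cint (fun l => fourier_measure mu l * (g l * eta l))].
Proof.
move=> bu a2 b2; have [ba bb] := bu.
pose a t := Re (u t); pose b t := Im (u t).
have [N [NkP Nka Nkb]] : exists N : nat -> nat, [/\ forall k, (k <= N k)%N,
    forall k, \int[leb R]_t ((1 - cut (N k) t) * a t ^+ 2) <= 4^-1 ^+ k &
    forall k, \int[leb R]_t ((1 - cut (N k) t) * b t ^+ 2) <= 4^-1 ^+ k].
  have ex k : exists n : nat, [/\ (k <= n)%N,
     \int[leb R]_t ((1 - cut n t) * a t ^+ 2) <= 4^-1 ^+ k &
     \int[leb R]_t ((1 - cut n t) * b t ^+ 2) <= 4^-1 ^+ k].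
    have e0 : 0 < 4^-1 ^+ k :> R by rewrite exprn_gt0.
    have [n1 _ H1] := tail_cutoff a2 (fun x => sqr_ge0 _) e0.
    have [n2 _ H2] := tail_cutoff b2 (fun x => sqr_ge0 _) e0.
    exists (maxn k (maxn n1 n2)); split; first exact: leq_maxl.
      by apply: H1; rewrite /= leq_max leq_maxl orbT.
    by apply: H2; rewrite /= leq_max leq_maxr orbT.
  have [N HN] := choice ex; exists N.
  by split=> k; have [] := HN k.
have [ca [mca ca2 dca ica]] := L2_transform ba a2 Nka (or_introl erefl).
have [sa [msa sa2 dsa isa]] := L2_transform ba a2 Nka (or_intror erefl).
have [cb [mcb cb2 dcb icb]] := L2_transform bb b2 Nkb (or_introl erefl).
have [sb [msb sb2 dsb isb]] := L2_transform bb b2 Nkb (or_intror erefl).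
pose g l : R[i] := (ca l + sb l) +i* (cb l - sa l).
have mReg : Rmeas (fun l => Re (g l)) by exact: measurable_funD.
have mImg : Rmeas (fun l => Im (g l)) by exact: measurable_funB.
have gR2 : L1 (leb R) (fun l => Re (g l) ^+ 2) by exact: L1_sqD.
have gI2 : L1 (leb R) (fun l => Im (g l) ^+ 2).
  have sa2N : L1 (leb R) (fun x => (- sa x) ^+ 2) by apply: (eq_L1R _ sa2) => x; rewrite sqrrN.
  exact: (L1_sqD mcb (measurable_funN msa) cb2 sa2N).
exists g; split => //.
move=> mu eta.
pose uk k t := (cut (N k) t)%:C * u t.
have buk k : cbm (uk k).
  apply: cbmM => //; split; last exact: bmeas_cst.
  by split; [exact: meas_cut|exists 1 => x; exact: cut_norm].
have ReUk k t : Re (uk k t) = cut (N k) t * a t by rewrite /uk ReM /= mul0r subr0.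
have ImUk k t : Im (uk k t) = cut (N k) t * b t by rewrite /uk ImM /= mul0r addr0.
have cuk k : CL1 (leb R) (uk k).
  split; first by apply: (eq_L1R _ (L1_cutM (N k) ba)) => t; rewrite ReUk.
  by apply: (eq_L1R _ (L1_cutM (N k) bb)) => t; rewrite ImUk.
have [be ce] := (schwartz_cbm eta, schwartz_CL1 eta).
have cf := schwartz_fourier_CL1 eta; have bf := fourier_cbm ce.
have [K [K0 HK]] := mass_ex mu.
have [[mRu [A1 a1]] [mIu [A2 a2']]] := bu.
have uA t : n1 (u t) <= A1 + A2 by rewrite lerD.
have A0 : 0 <= A1 + A2 by apply: le_trans (uA 0); exact: n1_ge0.
have ukA k t : n1 (uk k t - u t) <= A1 + A2.
  apply: le_trans (uA t); rewrite /uk cutE; case: ifP => _.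
    by rewrite mul1r subrr /n1 /= normr0 addr0 addr_ge0.
  by rewrite mul0r sub0r /n1 !ReIm !normrN.
have cvgU t : n1 (uk k t - u t) @[k --> \oo] --> (0 : R).
  apply: cvg_near_cst; have := @cut_near N t NkP; apply: filterS => k c1.
  by rewrite /uk c1 mul1r subrr /n1 /= normr0 addr0.
(* Both sides are the limit of the values at the truncations of u. *)
apply: (@n1_limit_unique (fun k => FT (mconv mu (uk k)) eta)).
  have bcD k : cbm (fun t => mconv mu (uk k) t - mconv mu u t).
    by apply: cbmB; exact: cbm_conv.
  have ckD k : CL1 (leb R) (fun t => (mconv mu (uk k) t - mconv mu u t) * fourier eta t).
    by apply: CL1M.
  have bD k := bmeas_n1 (bcD k).
  have If := L1_n1 cf.
  have ID k : L1 (leb R) (fun t => n1 (mconv mu (uk k) t - mconv mu u t) * n1 (fourier eta t)).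
    by apply: (eq_L1R _ (L1M_bmeas (bD k) If)) => t; rewrite mulrC.
  have [|t|k t|_ cvI] := @Rint_dct _ _ _ (leb R) (fun k t => n1 (mconv mu (uk k) t - mconv mu u t) * n1 (fourier eta t)) (fun=> 0) _ (fun k => L1_meas (ID k)) _ _ (L1Z (K * (A1 + A2)) If).
  - exact: measurable_cst.
  - rewrite -[0 in X in _ --> X](mul0r (n1 (fourier eta t))).
    have c : n1 (mconv mu (uk k) t - mconv mu u t) @[k --> \oo] --> (0 : R).
      have [L EL] := cmint_rep mu; rewrite /mconv.
      under eq_cvg do rewrite !EL.
      apply: (@csum_dct _ _ (fun k s => uk k (t - s)) (fun s => u (t - s)) (A1 + A2)).
      + by move=> k; exact: cbm_reflect.
      + exact: cbm_reflect.
      + by move=> k s; exact: ukA.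
      + by move=> s; exact: cvgU.
    by apply: cvgMl; exact: c.
  - rewrite ger0_norm ?mulr_ge0 ?n1_ge0// ler_wpM2r ?n1_ge0//.
    rewrite /mconv -cmintB; [|exact: cbm_reflect|exact: cbm_reflect].
    by apply: HK => //; apply: cbmB; exact: cbm_reflect.
  have z0 : \int[leb R]_(t in [set: R]) 0 = 0 :> R by rewrite /Rintegral integral0.
  rewrite z0 in cvI.
  have nD k : n1 (FT (mconv mu (uk k)) eta - FT (mconv mu u) eta) <=
     2 * \int[leb R]_t (n1 (mconv mu (uk k) t - mconv mu u t) * n1 (fourier eta t)).
    rewrite /FT !cintE -CintB; [|exact: (CL1M (cbm_conv mu (buk k)))|exact: (CL1M (cbm_conv mu bu))].
    rewrite -(@eq_Cint _ (measurableTypeR R) _ (leb R) (fun t => (mconv mu (uk k) t - mconv mu u t) * fourier eta t)); last first.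
      by move=> t; rewrite mulrBl.
    apply: (le_trans (n1_Cint (ckD k))); rewrite ler_wpM2l//.
    apply: Rint_le; [exact: L1_n1|exact: ID|].
    by move=> x; exact: n1M.
  apply: (squeeze_cvgr (f := fun=> 0)); last 2 first.
  - exact: cvg_cst.
  - have c : 2 * (\int[leb R]_t (n1 (mconv mu (uk k) t - mconv mu u t) * n1 (fourier eta t))) @[k --> \oo] --> (2 * 0 : R).
      by apply: cvgMr; exact: cvI.
    by rewrite mulr0 in c; exact: c.
  by apply: nearW => k; rewrite n1_ge0 nD.
have cg : CL1 (leb R) (fun l => g l * eta l).
  have [e1 e2] := schwartz_L2 eta; have [[me1 _] [me2 _]] := be.
  split.
    by apply: (eq_L1R _ (L1B (L1_sqM mReg me1 gR2 e1) (L1_sqM mImg me2 gI2 e2))) => l; rewrite ReM.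
  by apply: (eq_L1R _ (L1D (L1_sqM mReg me2 gR2 e2) (L1_sqM mImg me1 gI2 e1))) => l; rewrite ImM.
pose e l := n1 (eta l).
have e2 : L1 (leb R) (fun l => e l ^+ 2).
  have [h1 h2] := schwartz_L2 eta; have [[me1 _] [me2 _]] := be.
  apply: L1_sqD; [exact: meas_norm|exact: meas_norm| |].
    by apply: (eq_L1R _ h1) => x; rewrite real_normK ?num_real.
  by apply: (eq_L1R _ h2) => x; rewrite real_normK ?num_real.
have me : Rmeas e by have [] := bmeas_n1 be.
have Rd (c : R -> R) (T : (R -> R) -> R -> R) k h : T = @Ct R \/ T = @St R -> bmeas h -> Rmeas c ->
    Rmeas (fun x => c x - T (fun t => cut (N k) t * h t) x).
  move=> TE bh mc; apply: measurable_funB => //; have Ih := L1_cutM (N k) bh.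
  by case: TE => ->; [exact: ucont_meas (ucont_Ct Ih)|exact: ucont_meas (ucont_St Ih)].
have [J1 C1] := L2_pair_cvg0 (fun k => Rd _ _ k _ (or_introl erefl) ba mca) me dca ica e2.
have [J2 C2] := L2_pair_cvg0 (fun k => Rd _ _ k _ (or_intror erefl) ba msa) me dsa isa e2.
have [J3 C3] := L2_pair_cvg0 (fun k => Rd _ _ k _ (or_introl erefl) bb mcb) me dcb icb e2.
have [J4 C4] := L2_pair_cvg0 (fun k => Rd _ _ k _ (or_intror erefl) bb msb) me dsb isb e2.
have bF := cbm_fourier_measure mu.
have [[_ [F1 f1]] [_ [F2 f2]]] := bF.
have F12 l : n1 (fourier_measure mu l) <= F1 + F2 by rewrite lerD.
have F0 : 0 <= F1 + F2 by apply: le_trans (F12 0); exact: n1_ge0.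
pose S k := \int[leb R]_x (`|ca x - Ct (fun t => cut (N k) t * a t) x| * `|e x|)
  + \int[leb R]_x (`|sa x - St (fun t => cut (N k) t * a t) x| * `|e x|)
  + \int[leb R]_x (`|cb x - Ct (fun t => cut (N k) t * b t) x| * `|e x|)
  + \int[leb R]_x (`|sb x - St (fun t => cut (N k) t * b t) x| * `|e x|).
have CS : S k @[k --> \oo] --> (0 : R).
  have c := cvgD (cvgD (cvgD C1 C2) C3) C4; rewrite !addr0 in c; exact: c.
have key k : n1 (FT (mconv mu (uk k)) eta - cint (fun l => fourier_measure mu l * (g l * eta l)))
    <= 2 * (F1 + F2) * S k.
  rewrite (FT_conv_L1 eta mu (buk k) (cuk k)) !cintE -CintB; last 2 first.
  - by apply: (CL1M bF); apply: CL1M ce; exact: fourier_cbm.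
  - exact: CL1M.
  rewrite -(@eq_Cint _ (measurableTypeR R) _ (leb R) (fun l => fourier_measure mu l * ((fourier (uk k) l - g l) * eta l))); last first.
    by move=> t; rewrite -mulrBr mulrBl.
  have cD : CL1 (leb R) (fun l => fourier_measure mu l * ((fourier (uk k) l - g l) * eta l)).
    apply: (CL1M bF).
    have [h1 h2] := CL1B (CL1M (fourier_cbm (cuk k)) ce) cg.
    by split; [apply: (eq_L1R _ h1)|apply: (eq_L1R _ h2)] => x; rewrite mulrBl.
  apply: (le_trans (n1_Cint cD)); rewrite -mulrA ler_wpM2l//.
  rewrite /S -(RintD (J1 k) (J2 k)) -(RintD (L1D (J1 k) (J2 k)) (J3 k)).
  rewrite -(RintD (L1D (L1D (J1 k) (J2 k)) (J3 k)) (J4 k)).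
  have JJ := L1D (L1D (L1D (J1 k) (J2 k)) (J3 k)) (J4 k).
  rewrite -(RintZ _ JJ); apply: Rint_le; [exact: L1_n1|exact: L1Z|].
  move=> l; apply: (le_trans (n1M _ _)).
  apply: (@le_trans _ _ ((F1 + F2) * (n1 (fourier (uk k) l - g l) * n1 (eta l)))).
    apply: ler_pM; rewrite ?n1_ge0//; exact: n1M.
  rewrite ler_wpM2l// -!mulrDl -/(e l) (ger0_norm (n1_ge0 (eta l))) ler_wpM2r ?n1_ge0//.
  rewrite (fourierE l (cuk k)) /n1 !ReIm /=.
  rewrite (_ : (fun t => Re (uk k t)) = (fun t => cut (N k) t * a t)); last by apply/funext.
  rewrite (_ : (fun t => Im (uk k t)) = (fun t => cut (N k) t * b t)); last by apply/funext.
  set x1 := Ct _ l; set x2 := St _ l; set x3 := Ct _ l; set x4 := St _ l.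
  have -> : x1 + x2 - (ca l + sb l) = - (ca l - x1) - (sb l - x2) by ring.
  have -> : x3 - x4 - (cb l - sa l) = - (cb l - x3) + (sa l - x4) by ring.
  have h1 := ler_normB (- (ca l - x1)) (sb l - x2).
  have h2 := ler_normD (- (cb l - x3)) (sa l - x4).
  rewrite !normrN in h1 h2.
  lra.
apply: (squeeze_cvgr (f := fun=> 0)); last 2 first.
- exact: cvg_cst.
- have c : 2 * (F1 + F2) * S k @[k --> \oo] --> (2 * (F1 + F2) * 0 : R).
    by apply: cvgMr; exact: CS.
  by rewrite mulr0 in c; exact: c.
by apply: nearW => k; rewrite n1_ge0 key.
Qed.

End SquareIntegrableTransform.

(** * Measures with a prescribed Fourier transform *)

Section SpecialMeasures.
Variable R : realType.
Notation cR := (measurableTypeR R).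

Lemma Rint_odd (f : R -> R) : L1 (leb R) f -> (forall t, f (- t) = - f t) ->
  \int[leb R]_t f t = 0.
Proof.
move=> If fo; have h := Rint_reflect 0 If.
have e : \int[leb R]_t f (0 - t) = - \int[leb R]_t f t.
  by rewrite -(RintN If); apply: eq_Rint => t; rewrite sub0r.
by move: h; rewrite e; move: (\int[leb R]_t f t) => z; lra.
Qed.

Lemma CtN (h : R -> R) t : Ct h (- t) = Ct h t.
Proof. by apply: eq_Rint => s; rewrite mulNr cosN. Qed.

Lemma StN (h : R -> R) t : L1 (leb R) h -> St h (- t) = - St h t.
Proof.
move=> Ih; rewrite /St -(RintN (L1_sinM t Ih)).
by apply: eq_Rint => s; rewrite mulNr sinN mulNr.
Qed.

(** The inversion formula gives the density of q, integrable by Bernstein's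
    argument. *)
Lemma bernstein_measure (k dk : R -> R) (B : R) :
  (forall x : R, is_derive x (1 : R) k (dk x)) -> continuous dk ->
  (forall x, `|k x| <= B * poisson 1 x) -> (forall x, `|dk x| <= B * poisson 1 x) ->
  exists q : @cmeasure R, forall l, fourier_measure q l = (k l)%:C.
Proof.
move=> dkk cdk kB dkB.
have Ik : L1 (leb R) k by apply: L1_decay kB; apply: meas_continuous; exact: is_derive_continuous dkk.
have [IC IS] := L1_CtSt dkk cdk kB dkB.
pose q t : R[i] := ((2 * pi)^-1 * Ct k t) +i* ((2 * pi)^-1 * St k t).
have cq : CL1 (leb R) q by split; exact: L1Z.
have [pi_ Hpi] := cmeasure_density cq.
exists pi_ => l; rewrite /fourier_measure Hpi; last exact: cbm_cisN.
have p0 : 2 * pi != 0 :> R by rewrite mulf_neq0 ?pnatr_eq0// gt_eqF ?pi_gt0.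
apply: complex_eqP => /=.
  rewrite -[RHS](mulKf p0) -(fourier_inversion dkk cdk kB dkB l).
  rewrite -(RintZ _ (L1D (L1_cosM l IC) (L1_sinM l IS))); apply: eq_Rint => t.
  by rewrite /= cosN sinN; ring.
have I1 := L1B (L1_cosM l IS) (L1_sinM l IC).
transitivity ((2 * pi)^-1 * \int[leb R]_t (cos (l * t) * St k t - sin (l * t) * Ct k t)).
  rewrite -(RintZ _ I1); apply: eq_Rint => t; rewrite /= cosN sinN; ring.
rewrite (Rint_odd I1) ?mulr0// => t.
rewrite [St k (- t)](StN _ Ik) [Ct k (- t)]CtN [l * - t]mulrN cosN sinN; ring.
Qed.

(** If a(0) = 0, then a(l)/l is the mean of a'(s l) over s in [0, 1], and
    a'(s l) is the transform of the measure c dilated by s: so b is the transform of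
    a mean of dilated measures. *)
Lemma quotient_measure (a da : R -> R) (c : @cmeasure R) :
  (forall x : R, is_derive x (1 : R) a (da x)) -> a 0 = 0 ->
  (forall l, fourier_measure c l = (da l)%:C) ->
  exists (B : @cmeasure R) (b : R -> R),
    (forall l, fourier_measure B l = (b l)%:C) /\ (forall l, l * b l = a l).
Proof.
move=> ada a0 Fc.
have cda : continuous da.
  have cc := @continuous_fourier_measure R c.
  by rewrite (_ : da = (fun l => Re (fourier_measure c l)))//; apply/funext => l; rewrite Fc.
pose D : R -> R := \1_(`[0, 1]%classic).
have mD : Rmeas D by apply: meas_indic; exact: measurable_itv.
have ID : L1 (leb R) D.
  have := @L1_indic R `[0, 1]%classic (fun=> 1) (measurable_itv _) (continuous_L1_itv _ _ (@cst_continuous _ _ _)).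
  by apply: eq_L1R => t; rewrite mulr1.
have cD : CL1 (leb R) (fun t => (D t)%:C).
  by split => //=; apply: (eq_L1R _ (L1Z 0 ID)) => t; rewrite mul0r.
have [d Hd] := cmeasure_density cD.
have mm : measurable_fun setT (fun z : cR * cR => z.1 * z.2 : cR).
  by apply: measurable_funM; [exact: meas_fst|exact: meas_snd].
have [B HB] := cmeasure_product d c mm.
pose b l := \int[leb R]_(s in `[0, 1]) da (l * s).
have IDa l : L1 (leb R) (fun s => D s * da (l * s)).
  apply: L1_indic; first exact: measurable_itv.
  apply: continuous_L1_itv => s; apply: continuous_comp; last exact: cda.
  by apply: cvgM; [exact: cvg_cst|exact: cvg_id].
exists B, b; split=> l.
  rewrite /fourier_measure HB; last exact: cbm_cisN.
  transitivity (cmint d (fun s => (da (l * s))%:C)).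
    apply: eq_cmint => s; rewrite -Fc; apply: eq_cmint => t /=; congr cis; ring.
  rewrite Hd; last first.
    have [[m1 B1] [m2 B2]] := cbm_fourier_measure c.
    have mls : Rmeas (fun s => l * s) by apply: measurable_funM; [exact: measurable_cst|exact: meas_id].
    have := cbm_comp mls (cbm_fourier_measure c).
    by rewrite (_ : (fun x => _) = (fun s => (da (l * s))%:C))//; apply/funext => s; rewrite Fc.
  apply: complex_eqP => /=.
    rewrite /b Rint_indic; apply: eq_Rint => s /=; by rewrite mul0r subr0.
  transitivity (\int[leb R]_(t in [set: R]) (0 : R)); last by rewrite /Rintegral integral0.
  by apply: eq_Rint => s /=; rewrite mulr0 mul0r addr0.
have dF (s : R) : is_derive s (1 : R) (fun s => a (l * s)) (l * da (l * s)).
  have h1 : is_derive s (1 : R) (fun s : R => l * s) l.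
    by apply: is_derive_eq; rewrite /GRing.scale /=; ring.
  have := @is_derive1_comp _ a (fun s : R => l * s) s _ _ (ada (l * s)) h1.
  by move=> h; apply: is_derive_eq; rewrite mulrC.
rewrite /b Rint_indic -(RintZ l (IDa l)).
transitivity (\int[leb R]_(s in `[0, 1]) (l * da (l * s))).
  by rewrite Rint_indic; apply: eq_Rint => s; rewrite mulrCA.
rewrite (FTC_itv dF) ?ler01//; first by rewrite mulr1 mulr0 a0 subr0.
move=> s; apply: cvgM; first exact: cvg_cst.
apply: continuous_comp; last exact: cda.
by apply: cvgM; [exact: cvg_cst|exact: cvg_id].
Qed.

(** This dominates the Abel means of the integral of sin (t l) exp (- i l s), with
    a mass in t that does not depend on e and s. *)
Definition psym (e t s : R) : R := 2^-1 * (poisson e (t - s) + poisson e (t + s)).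

Lemma meas_psym e : 0 < e -> measurable_fun setT (fun z : cR * cR => psym e z.1 z.2).
Proof.
move=> e0; have mp := meas_continuous (continuous_poisson e0).
apply: measurable_funM; first exact: measurable_cst.
apply: measurable_funD.
  apply: (Rmeas_comp (f := poisson e)) mp _.
  by apply: measurable_funB; [exact: meas_fst|exact: meas_snd].
apply: (Rmeas_comp (f := poisson e)) mp _.
by apply: measurable_funD; [exact: meas_fst|exact: meas_snd].
Qed.

Lemma psym_ge0 e t s : 0 < e -> 0 <= psym e t s.
Proof. by move=> e0; rewrite mulr_ge0 ?invr_ge0// addr_ge0// ltW ?poisson_gt0. Qed.

Lemma int_psym e s : 0 < e -> L1 (leb R) (fun t => psym e t s) /\
  \int[leb R]_t psym e t s = 2 * pi.
Proof.
move=> e0; have [I1 E1] := int_poisson e0.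
have Ia := L1_shift s I1; have Ib := L1_shift (- s) I1.
have IS := L1D Ia Ib.
split.
  by apply: (eq_L1R _ (L1Z 2^-1 IS)) => t; rewrite opprK.
transitivity (2^-1 * \int[leb R]_t (poisson e (t - s) + poisson e (t - - s))).
  by rewrite -(RintZ _ IS); apply: eq_Rint => t; rewrite opprK.
by rewrite (RintD Ia Ib) !(Rint_shift _ I1) E1; field.
Qed.

Lemma psym_bmeas e t : 0 < e -> bmeas (psym e t).
Proof.
move=> e0; have mp := meas_continuous (continuous_poisson e0).
split; first exact: (measurableT_comp (meas_psym e0) (measurable_pair1 t)).
exists (2 / e) => s; rewrite ger0_norm ?psym_ge0//.
have h1 := le_trans (ler_norm _) (poisson_le e0 (t - s)).
have h2 := le_trans (ler_norm _) (poisson_le e0 (t + s)).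
rewrite /psym; lra.
Qed.

Lemma vsum_psym (l : seq (R[i] * fmeas R)) e : 0 < e ->
  L1 (leb R) (fun t => vsum l (psym e t)) /\
  \int[leb R]_t vsum l (psym e t) = 2 * pi * vsum l (fun=> 1).
Proof.
move=> e0.
have base (p : fmeas R) : L1 (leb R) (fun t => \int[p]_s psym e t s) /\
    \int[leb R]_t \int[p]_s psym e t s = 2 * pi * \int[p]_s 1.
  have E y : \int[leb R]_x psym e x y = 2 * pi * 1 by have [_ ->] := int_psym y e0; rewrite mulr1.
  have I1 : L1 p (fun=> 1 : R) by apply: bmeas_L1; exact: bmeas_cst.
  have [|z|x|y||] := @Rtonelli _ _ _ _ R (leb R) p (fun z => psym e z.1 z.2).
  - exact: meas_psym.
  - exact: psym_ge0.
  - by apply: bmeas_L1; exact: psym_bmeas.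
  - by have [] := int_psym y e0.
  - by apply: (eq_L1 _ (L1Z (2 * pi) I1)) => y /=; rewrite E.
  move=> h1 h2; split => //; rewrite h2 -(RintZ _ I1); apply: eq_Rint => y; exact: E.
elim: l => [|cp l [IH1 IH2]].
  have v0 f : vsum [::] f = 0 :> R by rewrite /vsum big_nil.
  split; last by rewrite v0 mulr0 -[RHS](_ : \int[leb R]_(t in [set: R]) (0 : R) = 0);
    [apply: eq_Rint => t; rewrite v0|rewrite /Rintegral integral0].
  by apply: (eq_L1R _ (L1Z 0 (L1_cut R 0))) => t; rewrite v0 mul0r.
have vc f : vsum (cp :: l) f = n1 cp.1 * \int[cp.2]_x f x + vsum l f.
  by rewrite /vsum big_cons.
have [b1 b2] := base cp.2.
have bZ := L1Z (n1 cp.1) b1.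
split; first by apply: (eq_L1R _ (L1D bZ IH1)) => t; rewrite vc.
rewrite vc mulrDr -IH2 mulrCA -b2 -(RintZ _ b1) -(RintD bZ IH1).
by apply: eq_Rint => t; rewrite vc.
Qed.

Lemma int_abel_sinsin e a b : 0 < e ->
  \int[leb R]_t (abel e t * (sin (a * t) * sin (b * t))) =
  2^-1 * (poisson e (a - b) - poisson e (a + b)).
Proof.
move=> e0.
have mc (x : R) : Rmeas (fun t : R => cos (x * t)).
  by apply: meas_cos; apply: measurable_funM; [exact: measurable_cst|exact: meas_id].
have I1 x := L1_abelM e0 (mc x) (fun t => cos_abs _).
rewrite -!(int_abel_cos e0) -(RintB (I1 _) (I1 _)) -(RintZ _ (L1B (I1 _) (I1 _))).
apply: eq_Rint => t; rewrite mulrBl mulrDl cosB cosD; by field.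
Qed.

Lemma int_abel_sincos e a b : 0 < e ->
  \int[leb R]_t (abel e t * (sin (a * t) * cos (b * t))) = 0.
Proof.
move=> e0.
have mc (x : R) : Rmeas (fun t : R => sin (x * t)).
  by apply: meas_sin; apply: measurable_funM; [exact: measurable_cst|exact: meas_id].
have I1 x := L1_abelM e0 (mc x) (fun t => sin_abs _).
transitivity (2^-1 * (\int[leb R]_t (abel e t * sin ((a + b) * t)) + \int[leb R]_t (abel e t * sin ((a - b) * t)))).
  rewrite -(RintD (I1 _) (I1 _)) -(RintZ _ (L1D (I1 _) (I1 _))).
  apply: eq_Rint => t; rewrite mulrBl mulrDl sinB sinD; by field.
by rewrite !(int_abel_sin e0) addr0 mulr0.
Qed.

(** The Abel means of the sine transform of h are bounded by Poisson averages of the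
    measure with transform h, which have a common bound in L1; Fatou's lemma
    concludes. *)
Lemma L1_St_fourier (h : R -> R) (mu : @cmeasure R) : L1 (leb R) h ->
  (forall l, fourier_measure mu l = (h l)%:C) -> L1 (leb R) (St h).
Proof.
move=> Ih Fh; have [L EL] := cmint_rep mu.
pose e (n : nat) : R := n.+1%:R^-1.
have e0 n : 0 < e n by rewrite /e invr_gt0.
have bh : bmeas h.
  have [b1 _] := cbm_fourier_measure mu; apply: eq_bmeas b1 => l; by rewrite Fh.
pose W n t := \int[leb R]_l (abel (e n) l * sin (t * l) * h l).
have abelN n l : abel (e n) l = `|abel (e n) l|.
  by rewrite ger0_norm// ltW// abel_gt0.
have WSt t : W n t @[n --> \oo] --> St h t.
  have ml : Rmeas (fun l => sin (t * l)).
    by apply: meas_sin; apply: measurable_funM; [exact: measurable_cst|exact: meas_id].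
  have mh := L1_meas Ih.
  have [n||l|n l|_ cv] := @Rint_dct _ _ _ (leb R) (fun n l => abel (e n) l * sin (t * l) * h l)
     (fun l => sin (t * l) * h l) (fun l => `|h l|) _ _ _ (L1_abs Ih) _; last exact: cv.
  - by apply: measurable_funM => //; apply: measurable_funM => //; exact: meas_abel.
  - exact: measurable_funM.
  - apply: cvgMl; rewrite -[X in _ --> X]mul1r; apply: cvgMl; exact: abel_cvg1.
  - rewrite !normrM -[leRHS]mul1r ler_wpM2r// -[leRHS]mul1r ler_pM//; [exact: abel_le1|exact: sin_abs].
have Wb n t : `|W n t| <= 2 * vsum L (psym (e n) t).
  have ms (x : R) : Rmeas (fun l : R => sin (x * l)).
    by apply: meas_sin; apply: measurable_funM; [exact: measurable_cst|exact: meas_id].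
  have mc (x : R) : Rmeas (fun l : R => cos (x * l)).
    by apply: meas_cos; apply: measurable_funM; [exact: measurable_cst|exact: meas_id].
  have ma := meas_abel (e n).
  pose G (s l : R) : R[i] := (abel (e n) l * sin (t * l))%:C * cis (- (l * s)).
  have EG s : Cint (leb R) (G s) = 0 +i* - (2^-1 * (poisson (e n) (t - s) - poisson (e n) (t + s))).
    apply: complex_eqP => /=.
      rewrite -[RHS](int_abel_sincos t s (e0 n)); apply: eq_Rint => l.
      by rewrite /G /= mul0r subr0 cosN (mulrC l s) mulrA.
    rewrite -(int_abel_sinsin t s (e0 n)).
    have J : L1 (leb R) (fun l => abel (e n) l * (sin (t * l) * sin (s * l))).
      apply: L1_abelM => //; first exact: measurable_funM.
      by move=> l; rewrite normrM mulr_ile1 ?sin_abs.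
    rewrite -(RintN J); apply: eq_Rint => l.
    by rewrite /G /= mul0r addr0 sinN (mulrC l s) mulrN mulrA.
  have E : (W n t)%:C = csum L (fun s => Cint (leb R) (G s)).
    rewrite -(@csum_fubini _ _ _ (leb R) G (fun l => 2 * abel (e n) l)); last 4 first.
    - apply: (@eq_measurable_fun _ _ _ _ setT (fun z : cR * cR => abel (e n) z.2 * sin (t * z.2) * cos (- (z.2 * z.1)))).
        by move=> z _; rewrite /G ReM /= mul0r subr0.
      apply: measurable_funM; last by apply: meas_cos; cmftac.
      apply: measurable_funM; last by apply: meas_sin; cmftac.
      by apply: (Rmeas_comp (f := abel (e n)) ma); exact: meas_snd.
    - apply: (@eq_measurable_fun _ _ _ _ setT (fun z : cR * cR => abel (e n) z.2 * sin (t * z.2) * sin (- (z.2 * z.1)))).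
        by move=> z _; rewrite /G ImM /= mul0r addr0.
      apply: measurable_funM; last by apply: meas_sin; cmftac.
      apply: measurable_funM; last by apply: meas_sin; cmftac.
      by apply: (Rmeas_comp (f := abel (e n)) ma); exact: meas_snd.
    - move=> s l; rewrite /G; apply: (le_trans (n1M _ _)); rewrite mulrC.
      apply: ler_pM; rewrite ?n1_ge0 ?n1_cis// /n1 /= normr0 addr0 normrM -abelN.
      by rewrite ler_piMr ?sin_abs// abelN.
    - by apply: L1Z; exact: L1_abel.
    rewrite (@eq_Cint _ _ _ (leb R) _ (fun l => (abel (e n) l * sin (t * l) * h l)%:C)); last first.
      move=> l; rewrite /G csumZ; last exact: cbm_cisN.
      by rewrite -EL -/(fourier_measure mu l) Fh -rmorphM.
    apply: complex_eqP => //=.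
    by rewrite /Rintegral integral0.
  have nE : n1 ((W n t)%:C) = `|W n t| by rewrite /n1 /= normr0 addr0.
  rewrite -nE E; apply: csum_le; last 2 first.
  - exact: psym_bmeas.
  - move=> s; rewrite EG /n1 /= normr0 add0r normrN normrM ger0_norm ?invr_ge0// ler_wpM2l ?invr_ge0//.
    apply: (le_trans (ler_normB _ _)); by rewrite !ger0_norm// ltW ?poisson_gt0.
  have mp := meas_continuous (continuous_poisson (e0 n)).
  have m1 : Rmeas (fun s => t - s) by apply: measurable_funB; [exact: measurable_cst|exact: meas_id].
  have m2 : Rmeas (fun s => t + s) by apply: measurable_funD; [exact: measurable_cst|exact: meas_id].
  have bp : bmeas (poisson (e n)) by split => //; exists (2 / e n) => x; exact: poisson_le.
  have bp1 : bmeas (fun s => poisson (e n) (t - s)).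
    by split; [exact: (Rmeas_comp mp m1)|exists (2 / e n) => x; exact: poisson_le].
  have bp2 : bmeas (fun s => poisson (e n) (t + s)).
    by split; [exact: (Rmeas_comp mp m2)|exists (2 / e n) => x; exact: poisson_le].
  rewrite (_ : (fun s => _) = (fun s => 0 +i* - (2^-1 * (poisson (e n) (t - s) - poisson (e n) (t + s))))); last by apply/funext.
  split; first exact: bmeas_cst.
  by apply: bmeasN; apply: bmeasM; [exact: bmeas_cst|apply: bmeasD => //; exact: bmeasN].
have mW n : L1 (leb R) (W n).
  have [J _] := vsum_psym L (e0 n).
  apply: (L1_le _ (L1Z 2 J)); last exact: Wb.
  have JW := L1_bdM (meas_abel (e n)) (abel_le1 (e0 n)) Ih.
  rewrite (_ : W n = St (fun l => abel (e n) l * h l)); last first.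
    by apply/funext => t; apply: eq_Rint => l; rewrite mulrA (mulrC (sin _)).
  exact: ucont_meas (ucont_St JW).
have mS := ucont_meas (ucont_St Ih).
have [||t|n|J _] := @L1_fatou _ _ _ (leb R) (fun n t => `|W n t|) (fun t => `|St h t|) (2 * (2 * pi * vsum L (fun=> 1))) (fun n => L1_abs (mW n)).
- exact: meas_norm.
- by move=> n x.
- by apply: cvg_norm; exact: WSt.
- have [J E] := vsum_psym L (e0 n).
  rewrite -E -(RintZ _ J); apply: (Rint_le (L1_abs (mW n)) (L1Z 2 J)); exact: Wb.
by apply: (L1_le mS J).
Qed.

End SpecialMeasures.

(** * Square integrability of a convolution *)

Section ConvolutionL2.
Variable R : realType.
Notation cR := (measurableTypeR R).

Lemma cutM_cvg (psi : R -> R) (t s : R) : continuous psi ->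
  cut n (t - n.+1%:R^-1 * s) * psi (t - n.+1%:R^-1 * s) @[n --> \oo] --> psi t.
Proof.
move=> cp.
have c1 : t - n.+1%:R^-1 * s @[n --> \oo] --> t.
  have c : t - n.+1%:R^-1 * s @[n --> \oo] --> (t - 0 * s : R).
    by apply: cvgB; [exact: cvg_cst|apply: cvgMl; exact: harmonic0].
  by rewrite mul0r subr0 in c.
rewrite -[X in _ --> X]mul1r; apply: cvgM; last by apply: (cvg_comp _ psi c1); exact: cp.
apply: cvg_near_cst; exists (Num.truncn (`|t| + `|s|)).+1 => // k /= hk; rewrite cutE ifT//.
have h : `|t| + `|s| < k%:R.
  by rewrite (lt_le_trans (truncnS_gt _))// ler_nat.
have hs : `|k.+1%:R^-1 * s| <= `|s|.
  by rewrite normrM ger0_norm ?invr_ge0// ler_piMl// invf_le1// ?ltr0n// ler1n.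
have := ler_norm t; have := ler_norm (- t); rewrite normrN => h1 h2.
have := ler_norm (k.+1%:R^-1 * s); have := ler_norm (- (k.+1%:R^-1 * s)); rewrite normrN => h3 h4.
apply/andP; split.
  move: h hs h1 h2 h3 h4; move: (k.+1%:R^-1 * s) => z; move: (k%:R : R) `|s| `|t| `|z| => a b c d; lra.
move: h hs h1 h2 h3 h4; move: (k.+1%:R^-1 * s) => z; move: (k%:R : R) `|s| `|t| `|z| => a b c d; lra.
Qed.

Variables (mu : @cmeasure R) (ah psi : R -> R) (B C : R).
Hypothesis Fmu : forall l, fourier_measure mu l = (ah l)%:C.
Hypotheses (cpsi : continuous psi) (psiB : forall t, `|psi t| <= B).
Let g n t := cut n t * psi t.
Hypothesis IC : forall n, L1 (leb R) (fun l => ah l ^+ 2 * (Ct (g n) l ^+ 2 + St (g n) l ^+ 2)).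
Hypothesis EC : forall n, \int[leb R]_l (ah l ^+ 2 * (Ct (g n) l ^+ 2 + St (g n) l ^+ 2)) <= C.

Let bpsi : bmeas psi.
Proof. by split; [exact: meas_continuous|exists B]. Qed.

Let Ig n : L1 (leb R) (g n) := L1_cutM n bpsi.
Let e (n : nat) : R := n.+1%:R^-1.
Let e0 n : 0 < e n. Proof. by rewrite /e invr_gt0. Qed.
Let p0 : 0 < 2 * pi :> R. Proof. by rewrite mulr_gt0// pi_gt0. Qed.

Let gB n s : `|g n s| <= B.
Proof. by rewrite /g normrM -[leRHS]mul1r ler_pM// cut_norm. Qed.

(* The truncation of psi, smoothed at scale 1/(n + 1). *)
Let k n t := (2 * pi)^-1 * \int[leb R]_r (g n r * poisson (e n) (t - r)).

Let kpsi t : k n t @[n --> \oo] --> psi t.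
Proof.
have h := @poisson_approx R g B t (psi t) Ig gB (fun s => @cutM_cvg psi t s cpsi).
have h2 : (2 * pi)^-1 * \int[leb R]_r (g n r * poisson (e n) (t - r)) @[n --> \oo] --> (2 * pi)^-1 * (2 * pi * psi t).
  by apply: cvgMr; exact: h.
by rewrite mulKf ?gt_eqF// in h2.
Qed.

Let Ip n t : L1 (leb R) (fun r => poisson (e n) (t - r)).
Proof. by have [I1 _] := int_poisson (e0 n); exact: L1_reflect. Qed.

Let Igp n t : L1 (leb R) (fun r => g n r * poisson (e n) (t - r)).
Proof.
have [mg _] := cutM_bmeas n bpsi.
by apply: (eq_L1R _ (L1_bdM mg (gB n) (Ip n t))) => r.
Qed.

Let kB n t : `|k n t| <= B.
Proof.
rewrite /k normrM [X in X * _]gtr0_norm ?invr_gt0// ler_pdivrMl// [leRHS]mulrC.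
have [I1 E1] := int_poisson (e0 n).
have <- : \int[leb R]_r (B * poisson (e n) (t - r)) = B * (2 * pi).
  by rewrite (RintZ _ (Ip n t)) (Rint_reflect _ I1) E1.
apply: (Rint_norm_le (Igp n t) (L1Z _ (Ip n t))) => r.
have pr := ltW (poisson_gt0 (e0 n) (t - r)).
by rewrite normrM (ger0_norm pr); apply: ler_wpM2r => //; exact: gB.
Qed.

(* The transform of k n, up to the factor 1/(2 pi) of the inversion formula: the
   Abel kernel makes it integrable. *)
Let H n l : R[i] := ((2 * pi)^-1 * (abel (e n) l * Ct (g n) l)) +i*
   - ((2 * pi)^-1 * (abel (e n) l * St (g n) l)).

Let IaC n : L1 (leb R) (fun l => abel (e n) l * Ct (g n) l).
Proof.
have h := L1_bdM (ucont_meas (ucont_Ct (Ig n))) (fun t => Ct_le t (Ig n)) (L1_abel (e0 n)).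
by apply: (eq_L1R _ h) => l; rewrite mulrC.
Qed.
Let IaS n : L1 (leb R) (fun l => abel (e n) l * St (g n) l).
Proof.
have h := L1_bdM (ucont_meas (ucont_St (Ig n))) (fun t => St_le t (Ig n)) (L1_abel (e0 n)).
by apply: (eq_L1R _ h) => l; rewrite mulrC.
Qed.

Let cH n : CL1 (leb R) (H n).
Proof. by split; [exact: L1Z|apply: L1N; exact: L1Z]. Qed.

Let kE n t : (k n t)%:C = Cint (leb R) (fun l => cis (l * t) * H n l).
Proof.
have C1 := L1_cosM t (IaC n); have C2 := L1_cosM t (IaS n).
have S1 := L1_sinM t (IaC n); have S2 := L1_sinM t (IaS n).
apply: complex_eqP => /=.
  rewrite /k -(abel_inversion t (e0 n) (Ig n)).
  have J : L1 (leb R) (fun l => abel (e n) l * (cos (l * t) * Ct (g n) l + sin (l * t) * St (g n) l)).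
    by apply: (eq_L1R _ (L1D C1 S2)) => l /=; rewrite (mulrC l t); ring.
  rewrite -(RintZ _ J); apply: eq_Rint => l; rewrite /=; ring.
have J := L1B S1 C2.
transitivity ((2 * pi)^-1 * \int[leb R]_l (sin (t * l) * (abel (e n) l * Ct (g n) l) - cos (t * l) * (abel (e n) l * St (g n) l))).
  rewrite (Rint_odd J) ?mulr0// => l.
  rewrite [St (g n) (- l)](StN _ (Ig n)) [Ct (g n) (- l)]CtN [t * - l]mulrN cosN sinN.
  rewrite abelN; ring.
rewrite -(RintZ _ J); apply: eq_Rint => l; rewrite /= (mulrC l t); ring.
Qed.

Let q n l := (2 * pi)^-1 * (abel (e n) l * (ah l * Ct (g n) l)).
Let p n l := - ((2 * pi)^-1 * (abel (e n) l * (ah l * St (g n) l))).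

Let bah : bmeas ah.
Proof.
by have [b1 _] := cbm_fourier_measure mu; apply: eq_bmeas b1 => l; rewrite Fmu.
Qed.

Let Iq n : L1 (leb R) (q n).
Proof.
apply: (eq_L1R _ (L1M_bmeas bah (L1Z (2 * pi)^-1 (IaC n)))) => l; rewrite /q; ring.
Qed.

Let Ip' n : L1 (leb R) (p n).
Proof.
apply: (eq_L1R _ (L1N (L1M_bmeas bah (L1Z (2 * pi)^-1 (IaS n))))) => l; rewrite /p; ring.
Qed.

Let kc n t : R[i] := (k n t)%:C.

Let mk n : cbm (kc n).
Proof.
split; last exact: bmeas_cst.
split; last by exists B => t; exact: kB.
rewrite (_ : (fun x => _) = (fun t => Ct (fun l => Re (H n l)) t - St (fun l => Im (H n l)) t)).
  by apply: measurable_funB; [exact: ucont_meas (ucont_Ct (cH n).1)|exact: ucont_meas (ucont_St (cH n).2)].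
apply/funext => t; rewrite /kc kE /= -(RintB (L1_cosM t (cH n).1) (L1_sinM t (cH n).2)).
by apply: eq_Rint => l; rewrite /= (mulrC l t).
Qed.

Let convk n t : mconv mu (kc n) t = (Ct (q n) t - St (p n) t) +i* (St (q n) t + Ct (p n) t).
Proof.
have [L EL] := cmint_rep mu; rewrite /mconv EL.
transitivity (csum L (fun s => Cint (leb R) (fun l => cis (l * (t - s)) * H n l))).
  by apply: eq_csum => s; rewrite /kc kE.
have mHr := L1_meas (cH n).1; have mHi := L1_meas (cH n).2.
have mh1 : measurable_fun setT (fun z : cR * cR => Re (H n z.2)).
  by apply: (Rmeas_comp (f := fun l => Re (H n l)) mHr); exact: meas_snd.
have mh2 : measurable_fun setT (fun z : cR * cR => Im (H n z.2)).
  by apply: (Rmeas_comp (f := fun l => Im (H n l)) mHi); exact: meas_snd.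
rewrite -(@csum_fubini _ _ _ (leb R) (fun s l => cis (l * (t - s)) * H n l) (fun l => 2 * n1 (H n l))); last 4 first.
- apply: (@eq_measurable_fun _ _ _ _ setT (fun z : cR * cR => cos (z.2 * (t - z.1)) * Re (H n z.2) - sin (z.2 * (t - z.1)) * Im (H n z.2))).
    by move=> z _; rewrite ReM.
  by apply: measurable_funB; apply: measurable_funM => //; cmftac.
- apply: (@eq_measurable_fun _ _ _ _ setT (fun z : cR * cR => cos (z.2 * (t - z.1)) * Im (H n z.2) + sin (z.2 * (t - z.1)) * Re (H n z.2))).
    by move=> z _; rewrite ImM.
  by apply: measurable_funD; apply: measurable_funM => //; cmftac.
- by move=> s l; apply: (le_trans (n1M _ _)); rewrite ler_wpM2r ?n1_ge0// n1_cis.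
- by apply: L1Z; exact: L1_n1.
transitivity (Cint (leb R) (fun l => (cis (l * t) * H n l) * (ah l)%:C)).
  apply: eq_Cint => l; rewrite -Fmu /fourier_measure EL -csumZ; last exact: cbm_cisN.
  apply: eq_csum => s; rewrite -mulrA [H n l * _]mulrC mulrA -cis_add.
  by congr (cis _ * _); ring.
have hE x : ((ah x)%:C = ah x +i* 0)%R by [].
apply: complex_eqP => /=.
  rewrite -(RintB (L1_cosM t (Iq n)) (L1_sinM t (Ip' n))); apply: eq_Rint => l.
  by rewrite /q /p (mulrC l t); ring.
rewrite -(RintD (L1_sinM t (Iq n)) (L1_cosM t (Ip' n))); apply: eq_Rint => l.
by rewrite /q /p (mulrC l t); ring.
Qed.

Let cst0 : R := (2 * pi)^-1.

Let qp n : [/\ L1 (leb R) (fun l => q n l ^+ 2), L1 (leb R) (fun l => p n l ^+ 2) &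
  \int[leb R]_l (q n l ^+ 2) + \int[leb R]_l (p n l ^+ 2) <= cst0 ^+ 2 * C].
Proof.
have le1 (x y : R) l : x ^+ 2 <= y -> (cst0 * (abel (e n) l * x)) ^+ 2 <= cst0 ^+ 2 * y.
  move=> xy; rewrite exprMn ler_wpM2l ?sqr_ge0//; apply: le_trans xy.
  rewrite exprMn ler_piMl ?sqr_ge0//.
  by rewrite -[_ ^+ 2]real_normK ?num_real// expr_le1// abel_le1.
have IZ := L1Z (cst0 ^+ 2) (IC n).
have qle l : `|q n l ^+ 2| <= cst0 ^+ 2 * (ah l ^+ 2 * (Ct (g n) l ^+ 2 + St (g n) l ^+ 2)).
  rewrite ger0_norm ?sqr_ge0//; apply: le1.
  by rewrite exprMn ler_wpM2l ?sqr_ge0// lerDl sqr_ge0.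
have ple l : `|p n l ^+ 2| <= cst0 ^+ 2 * (ah l ^+ 2 * (Ct (g n) l ^+ 2 + St (g n) l ^+ 2)).
  rewrite ger0_norm ?sqr_ge0// sqrrN; apply: le1.
  by rewrite exprMn ler_wpM2l ?sqr_ge0// lerDr sqr_ge0.
have mq := L1_meas (Iq n); have mp := L1_meas (Ip' n).
have Iq2 : L1 (leb R) (fun l => q n l ^+ 2) by apply: (L1_le (measurable_funX 2 mq) IZ).
have Ip2 : L1 (leb R) (fun l => p n l ^+ 2) by apply: (L1_le (measurable_funX 2 mp) IZ).
split => //.
apply: (@le_trans _ _ (cst0 ^+ 2 * \int[leb R]_l (ah l ^+ 2 * (Ct (g n) l ^+ 2 + St (g n) l ^+ 2)))); last first.
  by rewrite ler_wpM2l ?sqr_ge0//; exact: EC.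
rewrite -(RintZ _ (IC n)) -(RintD Iq2 Ip2).
apply: (Rint_le (L1D Iq2 Ip2) IZ) => l.
rewrite /q /p sqrrN -/cst0 !exprMn -mulrDr -mulrDr -mulrDr.
rewrite ler_wpM2l ?sqr_ge0// ler_piMl//; first by rewrite mulr_ge0 ?addr_ge0 ?sqr_ge0.
by rewrite -[_ ^+ 2]real_normK ?num_real// expr_le1// abel_le1.
Qed.

(** Formally the transform of mu * psi is ah times that of psi. As psi is not
    integrable, it is replaced by k n, its truncation smoothed by a Poisson kernel:
    k n is the inverse transform of an integrable function, so that mu * k n is
    the inverse transform of ah times this function, bounded in L2 by the
    hypothesis and Plancherel. Fatou's lemma passes to the limit. *)
Lemma conv_L2 : L1 (leb R) (fun t => Re (mconv mu (fun s => (psi s)%:C) t) ^+ 2) /\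
  L1 (leb R) (fun t => Im (mconv mu (fun s => (psi s)%:C) t) ^+ 2).
Proof.
pose u t := mconv mu (fun s => (psi s)%:C) t.
have bpc : cbm (fun s => (psi s)%:C) by split; [exact: bpsi|exact: bmeas_cst].
have bu : cbm u by exact: cbm_conv.
have cv t : n1 (mconv mu (kc n) t - u t) @[n --> \oo] --> (0 : R).
  have [L EL] := cmint_rep mu; rewrite /u /mconv.
  under eq_cvg do rewrite !EL.
  apply: (@csum_dct _ _ (fun n s => kc n (t - s)) (fun s => (psi (t - s))%:C) (B + B)).
  - by move=> n; apply: (cbm_reflect t (mk n)).
  - exact: (cbm_reflect t bpc).
  - move=> n s; rewrite /n1 /kc /= subr0 normr0 addr0; apply: (le_trans (ler_normB _ _)).
    by rewrite lerD//; exact: kB.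
  - move=> s; rewrite /n1 /kc /=.
    have c : `|k n (t - s) - psi (t - s)| @[n --> \oo] --> (`|psi (t - s) - psi (t - s)| : R).
      by apply: cvg_norm; apply: cvgB; [exact: kpsi|exact: cvg_cst].
    rewrite subrr normr0 in c; under eq_cvg do rewrite subrr normr0 addr0; exact: c.
pose D n t := 2 * (Ct (q n) t ^+ 2 + St (q n) t ^+ 2) + 2 * (Ct (p n) t ^+ 2 + St (p n) t ^+ 2).
have HD n : L1 (leb R) (D n) /\ \int[leb R]_t D n t <= 4 * pi * (cst0 ^+ 2 * C).
  have [Q2 P2 QP] := qp n.
  have [A1 A2] := plancherel (Iq n) Q2; have [B1 B2] := plancherel (Ip' n) P2.
  have [A1' B1'] := (L1Z 2 A1, L1Z 2 B1).
  split; first exact: L1D.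
  rewrite /D (RintD A1' B1') (RintZ _ A1) (RintZ _ B1).
  have pi0 := @pi_ge0 R.
  have := ler_wpM2l pi0 QP.
  move: A2 B2; set a := Rintegral _ _ _; set b := Rintegral _ _ _; set x := Rintegral _ _ _; set y := Rintegral _ _ _.
  move=> h1 h2; rewrite mulrDr => h3.
  have e1 : 2 * pi * b = 2 * (pi * b) by ring.
  have e2 : 2 * pi * y = 2 * (pi * y) by ring.
  have e3 : 4 * pi * (cst0 ^+ 2 * C) = 4 * (pi * (cst0 ^+ 2 * C)) by ring.
  lra.
have core (F : nat -> R -> R) (f : R -> R) : (forall n, Rmeas (F n)) -> Rmeas f ->
    (forall n t, F n t ^+ 2 <= D n t) -> (forall t, F n t @[n --> \oo] --> f t) ->
    L1 (leb R) (fun t => f t ^+ 2).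
  move=> mF mf FD cF.
  have IF n : L1 (leb R) (fun t => F n t ^+ 2).
    apply: (L1_le (measurable_funX 2 (mF n)) (HD n).1) => t.
    by rewrite ger0_norm ?sqr_ge0//; exact: FD.
  have [||t|n|//] := @L1_fatou _ _ _ (leb R) (fun n t => F n t ^+ 2) (fun t => f t ^+ 2) (4 * pi * (cst0 ^+ 2 * C)) IF.
  - exact: measurable_funX.
  - by move=> n t; exact: sqr_ge0.
  - by rewrite expr2; under eq_cvg do rewrite expr2; apply: cvgM; exact: cF.
  - by apply: le_trans (HD n).2; apply: (Rint_le (IF n) (HD n).1) => t; exact: FD.
have [[mu1 _] [mu2 _]] := bu.
have aux (a b c : R) : 0 <= a ^+ 2 + 2 * b ^+ 2 + 2 * c ^+ 2.
  by have := sqr_ge0 a; have := sqr_ge0 b; have := sqr_ge0 c; lra.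
have mq n := ucont_meas (ucont_Ct (Iq n)); have mq' n := ucont_meas (ucont_St (Iq n)).
have mp n := ucont_meas (ucont_Ct (Ip' n)); have mp' n := ucont_meas (ucont_St (Ip' n)).
split.
- apply: (core (fun n t => Ct (q n) t - St (p n) t)) => //.
  + by move=> n; exact: measurable_funB.
  + move=> n t; rewrite -subr_ge0 /D.
    rewrite (_ : _ - _ = (Ct (q n) t + St (p n) t) ^+ 2 + 2 * St (q n) t ^+ 2 + 2 * Ct (p n) t ^+ 2); last by ring.
    exact: aux.
  + move=> t; apply/cvgrPdist_le => eps eps0; move/cvgr0Pnorm_le : (cv t) => /(_ _ eps0).
    apply: filterS => n; rewrite convk; apply: le_trans.
    rewrite (ger0_norm (n1_ge0 _)) distrC /n1 !ReIm /=.
    by rewrite lerDl.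
- apply: (core (fun n t => St (q n) t + Ct (p n) t)) => //.
  + by move=> n; exact: measurable_funD.
  + move=> n t; rewrite -subr_ge0 /D.
    rewrite (_ : _ - _ = (St (q n) t - Ct (p n) t) ^+ 2 + 2 * Ct (q n) t ^+ 2 + 2 * St (p n) t ^+ 2); last by ring.
    exact: aux.
  + move=> t; apply/cvgrPdist_le => eps eps0; move/cvgr0Pnorm_le : (cv t) => /(_ _ eps0).
    apply: filterS => n; rewrite convk; apply: le_trans.
    rewrite (ger0_norm (n1_ge0 _)) distrC /n1 !ReIm /=.
    by rewrite lerDr.
Qed.

End ConvolutionL2.

(** * The retarded response *)

Section Response.
Variable R : realType.
Notation cR := (measurableTypeR R).

(** The kernel of the integral from 0 to t, signed as in the fundamental theorem
    of calculus when t < 0. *)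
Definition sgi (t s : R) : R := \1_(`[0, t[%classic) s - \1_(`[t, 0[%classic) s.

Lemma sgiE t s : sgi t s = if (0 <= s) && (s < t) then 1 else
   if (t <= s) && (s < 0) then -1 else 0.
Proof.
rewrite /sgi !indicE; case: ifP => h1.
  rewrite mem_set ?memNset ?subr0//= in_itv/= ?h1//.
  by case/andP: h1 => h1 h2; apply/negP; rewrite negb_and -!ltNge h2.
rewrite memNset/=; last by rewrite in_itv/= h1.
case: ifP => h2; first by rewrite mem_set ?sub0r//= in_itv.
by rewrite memNset/= ?subr0// in_itv/= h2.
Qed.

Lemma meas_sgi t : Rmeas (sgi t).
Proof. by apply: measurable_funB; apply: meas_indic; exact: measurable_itv. Qed.

Lemma sgi_le1 t s : `|sgi t s| <= 1.
Proof. by rewrite sgiE; case: ifP => _; [|case: ifP => _]; rewrite ?normrN ?normr1 ?normr0. Qed.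

Lemma L1_sgi t : L1 (leb R) (sgi t).
Proof.
apply: L1B; first by apply: (@L1_indic_itv _ _ 0 t) => x /=; rewrite !in_itv/= => /andP[-> /ltW ->].
by apply: (@L1_indic_itv _ _ t 0) => x /=; rewrite !in_itv/= => /andP[-> /ltW ->].
Qed.

Lemma L1_sgiM t f : bmeas f -> L1 (leb R) (fun s => sgi t s * f s).
Proof.
move=> [mf [B fB]]; have := L1_bdM mf fB (L1_sgi t).
by apply: eq_L1R => s; rewrite mulrC.
Qed.

Lemma cut_sgi n (s : R) : cut n s = sgi n%:R s - sgi (- n%:R) s.
Proof.
rewrite cutE !sgiE; have n0 : 0 <= n%:R :> R by [].
case: (leP 0 s) => s0 /=.
  rewrite !andbF; case: (ltP s n%:R) => sn; rewrite ?andbT ?andbF ?(le_trans _ s0) ?oppr_le0 ?subr0//.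
    by rewrite ltNge (le_trans _ s0) ?oppr_le0//= subr0.
  by rewrite ltNge (le_trans _ s0) ?oppr_le0//= subr0.
rewrite !andbT (lt_le_trans s0 n0) andbT [n%:R <= s]leNgt (lt_le_trans s0 n0)/= sub0r.
by case: ifP => _; rewrite ?opprK ?oppr0.
Qed.

Lemma int_sgi_dist t t' : t' <= t -> \int[leb R]_r `|sgi t r - sgi t' r| <= t - t'.
Proof.
move=> tt'.
have I1 : L1 (leb R) (\1_(`[t', t]%classic) : R -> R) by exact: (@L1_indic_itv _ _ t' t).
have E : \int[leb R]_r (\1_(`[t', t]%classic) r * 1) = t - t'.
  rewrite -(@Rint_indic R `[t', t]%classic (fun=> 1)).
  apply: (@FTC_itv R (fun=> 1) id) => //; last exact: cst_continuous.
rewrite -E.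
apply: Rint_le; first exact: L1_abs (L1B (L1_sgi t) (L1_sgi t')).
  by apply: (eq_L1R _ I1) => r; rewrite mulr1.
move=> r; rewrite mulr1 indicE.
case: (boolP (r \in _)) => [_|].
  rewrite !sgiE; case: (leP 0 r) => r0 /=.
    by rewrite !andbF; case: ifP => _; case: ifP => _; rewrite ?subrr ?subr0 ?sub0r ?normrN ?normr1 ?normr0.
  by rewrite !andbT; case: ifP => _; case: ifP => _; rewrite ?opprK ?addNr ?subr0 ?sub0r ?normrN ?normr1 ?normr0// ?add0r ?normr1.
rewrite notin_setE/= in_itv/= => /negP; rewrite negb_and -!ltNge => h.
have -> : sgi t r = sgi t' r; last by rewrite subrr normr0.
rewrite !sgiE; case: (leP 0 r) => r0 /=.
  rewrite !andbF; case/orP: h => h; first by rewrite h (lt_le_trans h tt').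
  by rewrite !ltNge (ltW h) (le_trans tt' (ltW h)).
rewrite !andbT; case/orP: h => h; first by rewrite !leNgt h (lt_le_trans h tt').
by rewrite (ltW h) (le_trans tt' (ltW h)).
Qed.

(** Integrated over frequencies, the forced oscillations sin ((t - s) l) add up to
    the response kernel St h (t - s). *)
Lemma wave_fubini (h g : R -> R) (t : R) : L1 (leb R) h -> L1 (leb R) g ->
  \int[leb R]_l (h l * (sin (t * l) * Ct g l - cos (t * l) * St g l)) =
  \int[leb R]_s (g s * St h (t - s)).
Proof.
move=> Ih Ig; have mh := L1_meas Ih; have mg := L1_meas Ig.
transitivity (\int[leb R]_l \int[leb R]_s (h l * g s * sin ((t - s) * l))).
  apply: eq_Rint => l.
  rewrite /Ct /St -(RintZ _ (L1_cosM l Ig)) -(RintZ (cos (t * l)) (L1_sinM l Ig)).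
  have I1 := L1Z (sin (t * l)) (L1_cosM l Ig); have I2 := L1Z (cos (t * l)) (L1_sinM l Ig).
  rewrite -(RintB I1 I2) -(RintZ _ (L1B I1 I2)); apply: eq_Rint => s.
  by rewrite mulrBl sinB (mulrC s l); ring.
rewrite (@Rfubini _ _ _ _ R (leb R) (leb R) (fun z => h z.1 * g z.2 * sin ((t - z.2) * z.1)) (fun l => `|h l|) (fun s => `|g s|)).
- apply: eq_Rint => s.
  rewrite /St -(RintZ _ (L1_sinM (t - s) Ih)); apply: eq_Rint => l /=; ring.
- apply: measurable_funM; last by apply: meas_sin; cmftac.
  apply: measurable_funM; first by apply: (Rmeas_comp mh); exact: meas_fst.
  by apply: (Rmeas_comp mg); exact: meas_snd.
- exact: L1_abs.
- exact: L1_abs.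
- by move=> l s /=; rewrite !normrM -[leRHS]mulr1 ler_wpM2l ?mulr_ge0// sin_abs.
Qed.

Lemma ae_eq_off2 (a b : R) (f g : R -> R) : Rmeas f -> Rmeas g ->
  (forall x, x != a -> x != b -> f x = g x) -> \int[leb R]_x f x = \int[leb R]_x g x.
Proof.
move=> mf mg fg; apply: ae_eq_Rint => //.
exists ([set a] `|` [set b]); split.
- by apply: measurableU; exact: measurable_set1.
- apply/eqP; rewrite -measure_le0 (le_trans (measureU2 _ _ _))//= ?lebesgue_measure_set1 ?adde0//; exact: measurable_set1.
- move=> x /= h; have [->|xa] := eqVneq x a; first by left.
  have [->|xb] := eqVneq x b; first by right.
  by exfalso; apply: h; exact: fg.
Qed.

Lemma bmeas_reflect (f : R -> R) t : bmeas f -> bmeas (fun s => f (t - s)).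
Proof.
move=> [mf [B fB]]; split; last by exists B => s; exact: fB.
apply: (Rmeas_comp mf); by apply: measurable_funB; [exact: measurable_cst|exact: meas_id].
Qed.

Section Convolution.
Variables (W psi : R -> R) (M B : R).
Hypotheses (IW : L1 (leb R) W) (WM : forall r, `|W r| <= M) (W0 : W 0 = 0).
Hypotheses (up : ucont psi) (psiB : forall t, `|psi t| <= B).

Let bp : bmeas psi. Proof. by split; [exact: ucont_meas|exists B]. Qed.
Let bW : bmeas W. Proof. by split; [exact: (L1_meas IW)|exists M]. Qed.

(** The response at time t to psi acting from time 0 to t, integrated over the
    delay r. *)
Definition retarded t := \int[leb R]_r (sgi t r * W r * psi (t - r)).

Let I1 t t' : L1 (leb R) (fun r => sgi t r * W r * psi (t' - r)).
Proof.
have := L1_sgiM t (bmeasM bW (bmeas_reflect t' bp)).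
by apply: eq_L1R => r; rewrite mulrA.
Qed.

Lemma retardedE t : \int[leb R]_s (sgi t s * psi s * W (t - s)) = retarded t.
Proof.
have I2 : L1 (leb R) (fun s => sgi t s * psi s * W (t - s)).
  have := L1_sgiM t (bmeasM bp (bmeas_reflect t bW)).
  by apply: eq_L1R => r; rewrite mulrA.
rewrite -(Rint_reflect t I2).
apply: (@ae_eq_off2 0 t); [exact: (L1_meas (L1_reflect t I2))|exact: (L1_meas (I1 t t))|].
move=> r r0 rt; have -> : t - (t - r) = r by ring.
have -> : sgi t (t - r) = sgi t r; last by ring.
rewrite !sgiE subr_ge0 ltrBlDr ltrDl lerBrDr gerDl subr_lt0.
have -> : (r <= t) = (r < t) by rewrite le_eqVlt (negbTE rt).
have -> : (t <= r) = (t < r) by rewrite le_eqVlt eq_sym (negbTE rt).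
have -> : (r <= 0) = (r < 0) by rewrite le_eqVlt (negbTE r0).
have -> : (0 <= r) = (0 < r) by rewrite le_eqVlt eq_sym (negbTE r0).
by rewrite andbC [(r < 0) && _]andbC.
Qed.

(** The increment splits in two: the interval of integration changes, where the
    integrand is bounded; and psi is translated, which its modulus of continuity
    and the L1 norm of W control. *)
Lemma ucont_retarded : ucont retarded.
Proof.
move=> e e0.
pose N := \int[leb R]_r `|W r|.
have N0 : 0 <= N by apply: Rint_ge0.
have M0 : 0 <= M by apply: le_trans (WM 0).
have B0 : 0 <= B by apply: le_trans (psiB 0).
have [|d1 d10 H1] := up (e := e / 2 / (N + 1)).
  by rewrite !divr_gt0// ltr_wpDl.
pose d2 := e / 2 / (M * B + 1).
have d20 : 0 < d2 by rewrite !divr_gt0// ltr_wpDl// mulr_ge0.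
exists (Num.min d1 d2); first by rewrite lt_min d10.
have wlog_ s t : t <= s -> `|s - t| < Num.min d1 d2 -> `|retarded s - retarded t| < e.
  move=> ts; rewrite lt_min => /andP[h1 h2].
  have Ia := L1_abs (L1B (L1_sgi s) (L1_sgi t)).
  have bound : `|retarded s - retarded t| <=
    (M * B) * (s - t) + e / 2 / (N + 1) * N.
    rewrite /retarded -(RintB (I1 s s) (I1 t t)).
    apply: (@le_trans _ _ (\int[leb R]_r (M * B * `|sgi s r - sgi t r| + e / 2 / (N + 1) * `|W r|))).
      apply: (Rint_norm_le (L1B (I1 s s) (I1 t t)) (L1D (L1Z _ Ia) (L1Z _ (L1_abs IW)))) => r.
      have -> : sgi s r * W r * psi (s - r) - sgi t r * W r * psi (t - r) =
        (W r * psi (s - r)) * (sgi s r - sgi t r) + (sgi t r * (psi (s - r) - psi (t - r))) * W r by ring.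
      apply: (le_trans (ler_normD _ _)); rewrite !normrM; apply: lerD.
        by rewrite ler_wpM2r// ler_pM.
      rewrite ler_wpM2r// -[leRHS]mul1r ler_pM// ?sgi_le1// ltW//; apply: H1.
      by rewrite (_ : s - r - (t - r) = s - t)//; ring.
    rewrite (RintD (L1Z _ Ia) (L1Z _ (L1_abs IW))) (RintZ _ Ia) (RintZ _ (L1_abs IW)) lerD//.
    by rewrite ler_wpM2l ?mulr_ge0// int_sgi_dist.
  apply: (le_lt_trans bound).
  rewrite [ltRHS](_ : e = e / 2 + e / 2); last by field.
  apply: ltr_leD.
    rewrite ger0_norm ?subr_ge0// in h2.
    apply: (@le_lt_trans _ _ ((M * B + 1) * (s - t))).
      by rewrite ler_wpM2r ?subr_ge0// lerDl.
    by rewrite mulrC -ltr_pdivlMr ?ltr_wpDl ?mulr_ge0.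
  rewrite -mulrA ler_piMr ?divr_ge0 ?ltW//.
  by rewrite mulrC ltr_pdivrMr ?ltr_wpDl// mul1r ltrDl.
move=> s t; case: (leP t s) => [|/ltW] st h; first exact: wlog_.
by rewrite distrC; apply: wlog_ => //; rewrite distrC.
Qed.

Variable sg : R.
Hypothesis sgE : sg = 1 \/ sg = -1.

(** The causal half of W for sg = 1. For sg = -1 it is the opposite of the
    anticausal half, since sgi t is -1 on negative times. *)
Definition half r := if 0 < sg * r then sg * W r else 0.

Lemma L1_half : L1 (leb R) half.
Proof.
apply: (L1_le _ (L1_abs IW)); last first.
  move=> r; rewrite /half; case: ifP => _; last by rewrite normr0.
  by case: sgE => ->; rewrite ?mul1r ?mulN1r ?normrN.
rewrite (_ : half = (fun r => \1_[set x | 0 < sg * x] r * (sg * W r))); last first.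
  apply/funext => r; rewrite /half indicE; case: ifP => h.
    by rewrite mem_set// mul1r.
  by rewrite memNset ?mul0r//= h.
apply: measurable_funM; last by apply: measurable_funM; [exact: measurable_cst|exact: (L1_meas IW)].
apply: meas_indic.
have ms : Rmeas (fun x => sg * x) by apply: measurable_funM; [exact: measurable_cst|exact: meas_id].
have := ms measurableT `]0, +oo[%classic (measurable_itv _); rewrite setTI.
by congr measurable; apply/seteqP; split => x /=; rewrite in_itv/= andbT.
Qed.

(** Once sg t >= n, the two integrands agree for |r| < n. *)
Lemma retarded_half t n : n%:R <= sg * t ->
  `|retarded t - \int[leb R]_r (half r * psi (t - r))| <=
  B * \int[leb R]_r ((1 - cut n r) * `|W r|).
Proof.
move=> nt.
have br := bmeas_reflect t bp.
have I2 : L1 (leb R) (fun r => half r * psi (t - r)).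
  by have := L1M_bmeas br L1_half.
have I3 : L1 (leb R) (fun r => (1 - cut n r) * `|W r|).
  apply: (L1_bdM (B := 1)) (L1_abs IW); first by apply: measurable_funB; [exact: measurable_cst|exact: meas_cut].
  move=> x; have /andP[c0 c1] := cut01 n x.
  by rewrite ger0_norm ?subr_ge0// gerBl.
rewrite /retarded -(RintB (I1 t t) I2) -(RintZ _ I3).
apply: (Rint_norm_le (L1B (I1 t t) I2) (L1Z _ I3)) => r.
rewrite -mulrBl normrM mulrC ler_pM//.
have n0 : 0 <= n%:R :> R by [].
rewrite /half cutE sgiE; case: sgE nt => -> nt; rewrite ?mul1r ?mulN1r in nt *.
  case: (ltgtP 0 r) => r0 /=.
  - rewrite andbF; have -> /= : - n%:R <= r by lra.
    case: (ltP r t) => rt; first by rewrite mul1r subrr normr0 mulr_ge0//; case: ifP; rewrite ?subrr ?subr0.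
    by rewrite ltNge (le_trans nt rt)/= mul0r sub0r normrN subr0 mul1r.
  - have -> /= : (t <= r) = false by apply/negbTE; rewrite -ltNge (lt_le_trans r0)// (le_trans _ nt).
    by rewrite mul0r subrr normr0 mulr_ge0//; case: ifP; rewrite ?subrr ?subr0.
  - by rewrite -r0 W0 !mulr0 subrr normr0 mulr0.
rewrite oppr_gt0; case: (ltgtP 0 r) => r0 /=.
- have -> /= : (r < t) = false by apply/negbTE; rewrite -leNgt (le_trans _ (ltW r0))// -oppr_ge0 (le_trans _ nt).
  by rewrite andbF mul0r subrr normr0 mulr_ge0//; case: ifP; rewrite ?subrr ?subr0.
- rewrite andbT; have rn : r < n%:R by lra.
  rewrite rn andbT; case: (leP t r) => tr.
    by rewrite mulN1r subrr normr0 mulr_ge0//; case: ifP; rewrite ?subrr ?subr0.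
  have -> : (- n%:R <= r) = false by apply/negbTE; rewrite -ltNge; lra.
  by rewrite mul0r sub0r opprK subr0 mul1r.
- by rewrite -r0 W0 !mulr0 subrr normr0 mulr0.
Qed.

Lemma half_measure : exists mu : @cmeasure R,
  fourier_measure mu = fourier (fun t => (half t)%:C) /\
  forall t, mconv mu (fun s => (psi s)%:C) t = (\int[leb R]_r (half r * psi (t - r)))%:C.
Proof.
have ch : CL1 (leb R) (fun t => (half t)%:C).
  by split; [exact: L1_half|apply: (eq_L1R _ (L1Z 0 L1_half)) => t; rewrite mul0r].
have [mu Hmu] := cmeasure_density ch.
exists mu; split.
  apply/funext => l; rewrite /fourier_measure Hmu; last exact: cbm_cisN.
  by congr cint; apply/funext => t; rewrite mulrC.
move=> t; rewrite /mconv Hmu; last first.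
  by split; [exact: bmeas_reflect|exact: bmeas_cst].
apply: complex_eqP => /=; first by apply: eq_Rint => r /=; rewrite mul0r subr0.
transitivity (\int[leb R]_(t in [set: R]) (0 : R)); last by rewrite /Rintegral integral0.
by apply: eq_Rint => s /=; rewrite mulr0 mul0r addr0.
Qed.

End Convolution.

Lemma cabs_real (x : R) : cabs (x%:C : R[i]) = `|x|.
Proof.
apply/eqP; rewrite -(@eqrXn2 _ 2)//; last exact: cabs_ge0.
by rewrite cabs_sq /= real_normK ?num_real// expr0n/= addr0.
Qed.

Lemma Cb_real (f : R -> R) (B : R) : ucont f -> (forall t, `|f t| <= B) ->
  Cb (fun t => (f t)%:C : R[i]).
Proof.
move=> uf fB; split; first by exists B => t; rewrite cabs_real.
move=> e e0; have [d d0 H] := uf e e0; exists d => // s t st.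
by rewrite -rmorphB cabs_real; exact: H.
Qed.

Lemma ucontD (f g : R -> R) : ucont f -> ucont g -> ucont (fun t => f t + g t).
Proof.
move=> uf ug e e0; have e2 : 0 < e / 2 by rewrite divr_gt0.
have [d d0 H] := uf _ e2; have [d' d0' H'] := ug _ e2.
exists (Num.min d d'); first by rewrite lt_min d0.
move=> s t; rewrite lt_min => /andP[h h'].
have -> : f s + g s - (f t + g t) = (f s - f t) + (g s - g t) by ring.
apply: (le_lt_trans (ler_normD _ _)).
by rewrite [ltRHS](_ : e = e / 2 + e / 2); [apply: ltrD; [exact: H|exact: H']|field].
Qed.

Lemma ucontN (f : R -> R) : ucont f -> ucont (fun t => - f t).
Proof.
move=> uf e e0; have [d d0 H] := uf _ e0; exists d => // s t h.
by rewrite -opprD normrN; exact: H.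
Qed.

Section Thermostat.
Variables (psi phi ah b a0 b0 : R -> R) (mu : @cmeasure R) (B : R).
Hypotheses (up : ucont psi) (psiB : forall t, `|psi t| <= B).
Hypotheses (bah : bmeas ah) (mb : Rmeas b) (ma0 : Rmeas a0) (mb0 : Rmeas b0).
Hypotheses (ah2 : L1 (leb R) (fun l => ah l ^+ 2)) (b2 : L1 (leb R) (fun l => b l ^+ 2)).
Hypotheses (a02 : L1 (leb R) (fun l => a0 l ^+ 2)) (b02 : L1 (leb R) (fun l => b0 l ^+ 2)).
Hypothesis Fmu : forall l, fourier_measure mu l = (b l * ah l)%:C.
Let g t s := sgi t s * psi s.
(** The motions of the oscillators, with initial amplitudes a0 and b0 and driven by
    psi, weighted by b. *)
Hypothesis phiE : forall t, phi t = \int[leb R]_l (b l *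
  (sin (t * l) * (a0 l + ah l * Ct (g t) l) + cos (t * l) * (b0 l - ah l * St (g t) l))).

Let h l := b l * ah l.
Let mah : Rmeas ah := bah.1.
Let Ih : L1 (leb R) h. Proof. exact: L1_sqM. Qed.
Let Iba : L1 (leb R) (fun l => b l * a0 l). Proof. exact: L1_sqM. Qed.
Let Ibb : L1 (leb R) (fun l => b l * b0 l). Proof. exact: L1_sqM. Qed.
Let W := St h.
Let IW : L1 (leb R) W. Proof. exact: L1_St_fourier Fmu. Qed.
Let WM r : `|W r| <= \int[leb R]_s `|h s|. Proof. exact: St_le. Qed.
Let W0 : W 0 = 0.
Proof.
transitivity (\int[leb R]_(t in [set: R]) (0 : R)); last by rewrite /Rintegral integral0.
by apply: eq_Rint => s /=; rewrite mul0r sin0 mul0r.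
Qed.
Let bpsi : bmeas psi. Proof. by split; [exact: ucont_meas|exists B]. Qed.

Let phiE2 t : phi t = St (fun l => b l * a0 l) t + Ct (fun l => b l * b0 l) t + retarded W psi t.
Proof.
have Ig : L1 (leb R) (g t) by exact: L1_sgiM.
rewrite -(retardedE IW WM up psiB) -(wave_fubini t Ih Ig) phiE.
have I1 := L1_sinM t Iba; have I2 := L1_cosM t Ibb.
have bC : bmeas (Ct (g t)).
  by split; [exact: ucont_meas (ucont_Ct Ig)|eexists => x; exact: Ct_le].
have bS : bmeas (St (g t)).
  by split; [exact: ucont_meas (ucont_St Ig)|eexists => x; exact: St_le].
have I3 : L1 (leb R) (fun l => h l * (sin (t * l) * Ct (g t) l - cos (t * l) * St (g t) l)).
  have := L1B (L1M_bmeas bC (L1_sinM t Ih)) (L1M_bmeas bS (L1_cosM t Ih)).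
  by apply: eq_L1R => l; ring.
rewrite [St _ t]/St [Ct _ t]/Ct -(RintD I1 I2) -(RintD (L1D I1 I2) I3); apply: eq_Rint => l.
rewrite /h; ring.
Qed.

Variable sg : R.
Hypothesis sgE : sg = 1 \/ sg = -1.

(** Besides the convolution with the half kernel, the response consists of a free
    motion, small by the Riemann-Lebesgue lemma, and of the difference between
    the retarded integral and the convolution, a tail of a convergent integral. *)
Lemma response_split : exists (nu : @cmeasure R) (theta : R -> R[i]),
  [/\ fourier_measure nu = fourier (fun t => (half W sg t)%:C), Cb theta, vanish sg theta &
    forall t, (phi t)%:C = mconv nu (fun s => (psi s)%:C) t + theta t].
Proof.
have [nu [Fnu cnu]] := half_measure IW up psiB sgE.
have cbp : Cb (fun s => (psi s)%:C) := Cb_real up psiB.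
pose cv t := \int[leb R]_r (half W sg r * psi (t - r)).
have Ccv := Cb_conv nu cbp.
have ucv : ucont cv.
  have := Cb_Re Ccv; rewrite (_ : (fun t => _) = cv)//.
  by apply/funext => t; rewrite cnu.
have ur := ucont_retarded IW WM up psiB.
pose th t := phi t - cv t.
have uphi : ucont phi.
  rewrite (_ : phi = (fun t => St (fun l => b l * a0 l) t + Ct (fun l => b l * b0 l) t + retarded W psi t)); last by apply/funext; exact: phiE2.
  by apply: ucontD => //; apply: ucontD; [exact: ucont_St|exact: ucont_Ct].
have uth : ucont th by apply: ucontD => //; exact: ucontN.
have bphi : exists P, forall t, `|phi t| <= P.
  exists (\int[leb R]_l `|b l * a0 l| + \int[leb R]_l `|b l * b0 l| + \int[leb R]_r (B * `|W r|)) => t.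
  rewrite phiE2; apply: (le_trans (ler_normD _ _)); apply: lerD.
    by apply: (le_trans (ler_normD _ _)); apply: lerD; [exact: St_le|exact: Ct_le].
  have bW : bmeas W by split; [exact: (L1_meas IW)|eexists; exact: WM].
  have I1 : L1 (leb R) (fun r => sgi t r * W r * psi (t - r)).
    have := L1_sgiM t (bmeasM bW (bmeas_reflect t bpsi)).
    by apply: eq_L1R => r; rewrite mulrA.
  apply: (Rint_norm_le I1 (L1Z _ (L1_abs IW))) => r.
  rewrite !normrM mulrC ler_pM// -[leRHS]mul1r ler_wpM2r//; exact: sgi_le1.
have [P HP] := bphi.
have bcv : exists Q, forall t, `|cv t| <= Q.
  have [[Q HQ] _] := Ccv; exists Q => t.
  by apply: le_trans (HQ t); rewrite cnu cabs_real.
have [Q HQ] := bcv.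
exists nu, (fun t => (th t)%:C); split => //.
- by apply: (Cb_real (B := P + Q)) => // t; apply: (le_trans (ler_normB _ _)); apply: lerD.
- move=> e e0; have e4 : 0 < e / 4 by rewrite divr_gt0.
  have [A1 H1] := riemann_lebesgue Iba e4; have [A2 H2] := riemann_lebesgue Ibb e4.
  have B0 : 0 <= B by apply: le_trans (psiB 0).
  have e5 : 0 < e / 4 / (B + 1) by rewrite divr_gt0// ltr_wpDl.
  have [n _ Hn] := tail_cutoff (L1_abs IW) (fun x => normr_ge0 _) e5.
  exists (Num.max (Num.max A1 A2) n%:R) => t; rewrite !gt_max -andbA => /and3P[h1 h2 h3].
  have st : sg * t <= `|t| by case: sgE => ->; [rewrite mul1r; exact: ler_norm|rewrite mulN1r -(normrN t); exact: ler_norm].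
  rewrite cabs_real.
  have -> : th t = St (fun l => b l * a0 l) t + Ct (fun l => b l * b0 l) t + (retarded W psi t - cv t).
    by rewrite /th phiE2; ring.
  have [_ k1] := H1 t (lt_le_trans h1 st); have [k2 _] := H2 t (lt_le_trans h2 st).
  have k3 := retarded_half IW WM W0 up psiB sgE (ltW h3).
  have k4 := ler_wpM2l B0 (Hn n (leqnn n)).
  have k5 : B * (e / 4 / (B + 1)) <= e / 4.
    have B1 : 0 < B + 1 by rewrite ltr_wpDl.
    by rewrite mulrA ler_pdivrMr// mulrC ler_wpM2l ?lerDl// ltW.
  have k6 := le_trans k3 (le_trans k4 k5).
  apply: (le_lt_trans (ler_normD _ _)).
  have := ler_normD (St (fun l => b l * a0 l) t) (Ct (fun l => b l * b0 l) t).
  move: k1 k2 k6; rewrite -/(cv t).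
  move: (`|St _ _|) (`|Ct _ _|) (`|_ - _|) (`|_ + _|) => x1 x2 x3 x4; lra.
- by move=> t; rewrite cnu -rmorphD /th; congr (_%:C); rewrite /cv; ring.
Qed.

End Thermostat.

End Response.

(** * Local inverses and singular support *)

Section SingularSupport.
Variable R : realType.
Notation cR := (measurableTypeR R).

Lemma C0_pinfty (phi : R -> R[i]) : Cb phi -> vanish 1 phi -> C0 +oo phi.
Proof.
move=> Cphi v; split => //; apply/cvgr0Pnorm_lt => e e0.
have [A HA] := v e e0; exists A; split; first exact: num_real.
by move=> t At; rewrite ger0_norm ?cabs_ge0//; apply: HA; rewrite mul1r.
Qed.

Lemma C0_ninfty (phi : R -> R[i]) : Cb phi -> vanish (-1) phi -> C0 -oo phi.
Proof.
move=> Cphi v; split => //; apply/cvgr0Pnorm_lt => e e0.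
have [A HA] := v e e0; exists (- A); split; first by rewrite num_real.
by move=> t At; rewrite ger0_norm ?cabs_ge0//; apply: HA; rewrite mulN1r ltrNr.
Qed.

Lemma L1_Lfun (f : R -> R) : L1 (leb R) f -> f \in Lfun (leb R) 1.
Proof. by move=> If; apply/Lfun1_integrable. Qed.

Lemma L2_Lfun (f : R -> R) : Rmeas f -> L1 (leb R) (fun x => f x ^+ 2) ->
  f \in Lfun (leb R) 2%:E.
Proof.
move=> mf If; rewrite inE; apply/andP; split; rewrite inE//=.
rewrite /finite_norm unlock /Lnorm poweR_lty//.
have -> : (\int[leb R]_x (`|(EFin \o f) x| `^ 2) = \int[leb R]_x (f x ^+ 2)%:E)%E.
  by apply: eq_integral => x _ /=; rewrite powR_mulrn// real_normK ?num_real.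
by rewrite (Rint_EFin If) ltry.
Qed.

Lemma is_derive_quadratic (f : R -> R) (y d C : R) :
  (forall h, `|f (y + h) - f y - h * d| <= C * h ^+ 2) -> is_derive y (1 : R) f d.
Proof.
move=> H.
have cv : h^-1 *: (f (h *: (1 : R) + y) - f y) @[h --> 0^'] --> d.
  apply/cvgrPdist_le => e e0.
  have C0 : 0 <= C by have := le_trans (normr_ge0 _) (H 1); rewrite expr1n mulr1.
  have e1 : 0 < e / (C + 1) by rewrite divr_gt0// ltr_wpDl.
  near=> h.
  have h0 : h != 0 by near: h; exact: nbhs_dnbhs_neq.
  have hs : `|h| < e / (C + 1).
    by near: h; apply: dnbhs0_lt.
  have -> : d - h^-1 *: (f (h *: (1 : R) + y) - f y) = - h^-1 * (f (y + h) - f y - h * d).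
    by rewrite /GRing.scale /= mulr1 (addrC h y); field.
  rewrite normrM normrN normfV ler_pdivrMl ?normr_gt0//.
  apply: (le_trans (H h)); rewrite -[h ^+ 2]real_normK ?num_real// expr2 mulrCA ler_wpM2l//.
  rewrite ltr_pdivlMr ?ltr_wpDl// in hs.
  by apply: le_trans (ltW hs); rewrite mulrC ler_wpM2l// lerDl.
have D : derivable f y 1 by apply/cvg_ex; exists d.
apply: DeriveDef => //; exact: cvg_lim cv.
Unshelve. all: by end_near.
Qed.

(** Its square is of class C^1, which is regular enough for cut-off functions. *)
Definition pospart (y : R) := (y + `|y|) / 2.

Lemma pospart_ge0 y : 0 <= y -> pospart y = y.
Proof. by move=> y0; rewrite /pospart ger0_norm//; field. Qed.

Lemma pospart_le0 y : y <= 0 -> pospart y = 0.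
Proof. by move=> y0; rewrite /pospart ler0_norm// subrr mul0r. Qed.

Lemma continuous_pospart : continuous pospart.
Proof.
move=> y; apply: cvgMl; apply: cvgD; [exact: cvg_id|exact: norm_continuous].
Qed.

Lemma is_derive_pospart2 (y : R) :
  is_derive y (1 : R) (fun z => pospart z ^+ 2) (2 * pospart y).
Proof.
apply: (is_derive_quadratic (C := 1)) => h; rewrite mul1r.
case: (leP 0 y) => y0; case: (leP 0 (y + h)) => yh.
- rewrite !pospart_ge0// (_ : _ - _ = h ^+ 2) ?ger0_norm ?sqr_ge0//; ring.
- rewrite (pospart_ge0 y0) (pospart_le0 (ltW yh)) ler_norml; apply/andP; split.
    rewrite -subr_ge0 (_ : _ - _ = h ^+ 2 + y * (- (y + h) - h)); last by ring.
    by rewrite addr_ge0 ?sqr_ge0// mulr_ge0//; lra.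
  rewrite -subr_ge0 (_ : _ - _ = (y + h) ^+ 2) ?sqr_ge0//; ring.
- rewrite (pospart_ge0 yh) (pospart_le0 (ltW y0)) expr0n/= mulr0 mulr0 !subr0.
  by rewrite ger0_norm ?sqr_ge0// ler_sqr ?nnegrE//; lra.
- rewrite (pospart_le0 (ltW yh)) (pospart_le0 (ltW y0)) expr0n/= !mulr0 !subr0 normr0 sqr_ge0//.
Qed.

Lemma compact_decay (f : R -> R) (c r : R) : continuous f ->
  (forall x, r <= `|x - c| -> f x = 0) -> exists B, forall x, `|f x| <= B * poisson 1 x.
Proof.
move=> cf f0.
have p0 (x : R) : 0 < poisson 1 x by apply: poisson_gt0.
pose g x := `|f x| / poisson 1 x.
have cg : continuous g.
  move=> x; apply: cvgM; first by apply: cvg_norm; exact: cf.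
  by apply: cvgV; [rewrite gt_eqF|exact: (continuous_poisson ltr01)].
pose r' := Num.max r 0.
have r'0 : c - r' <= c + r' by rewrite lerD2l -subr_ge0 opprK -mulr2n mulrn_wge0// le_max lexx orbT.
have [x1 _ H1] := EVT_max r'0 (continuous_subspaceT (cg)).
exists (g x1) => x.
rewrite -ler_pdivrMr// -/(g x).
case: (boolP (x \in `[c - r', c + r'])) => [|h]; first exact: H1.
have -> : g x = 0.
  rewrite /g f0 ?normr0 ?mul0r//; apply: contraNT h; rewrite -ltNge => h.
  have : `|x - c| <= r' by rewrite le_max (ltW h).
  by rewrite ler_norml in_itv/= => /andP[? ?]; apply/andP; split; lra.
by rewrite /g divr_ge0// ltW.
Qed.

(** Gluing 1 / a to 0: the quotient k = p a / (p a^2 + q) equals 1 / a where q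
    vanishes, and vanishes with p. *)
Lemma local_inverse (a da : R -> R) (l : R) :
  (forall x : R, is_derive x (1 : R) a (da x)) -> continuous da -> a l != 0 ->
  exists (d : R) (k dk : R -> R) (B : R), [/\ 0 < d,
    (forall x : R, is_derive x (1 : R) k (dk x)), continuous dk,
    (forall x, `|k x| <= B * poisson 1 x /\ `|dk x| <= B * poisson 1 x) &
    forall x, `|x - l| < d -> k x * a x = 1].
Proof.
move=> ada cda al0.
have ca : continuous a := is_derive_continuous ada.
have [d d0 Hd] : exists2 d, 0 < d & forall x, `|x - l| < 2 * d -> a x != 0.
  have al : 0 < `|a l| by rewrite normr_gt0.
  move/cvgrPdist_lt : (ca l) => /(_ _ al) /nbhs_ballP[e e0 He].
  exists (e / 2); first by rewrite divr_gt0.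
  move=> x; rewrite mulrCA divff// mulr1 => xl.
  have /= := He x; rewrite /ball/= distrC => /(_ xl) h.
  by apply: contraTneq h => ->; rewrite subr0 ltxx.
(* p is positive exactly where |x - l| < 2d, a region where a does not vanish, and q
   exactly where |x - l| > d: so D is positive everywhere. *)
pose y1 x := 4 * d ^+ 2 - (x - l) ^+ 2; pose y2 x := (x - l) ^+ 2 - d ^+ 2.
pose p x := pospart (y1 x) ^+ 2; pose q x := pospart (y2 x) ^+ 2.
pose dp x := 2 * pospart (y1 x) * (- (2 * (x - l))).
pose dq x := 2 * pospart (y2 x) * (2 * (x - l)).
have py (x : R) : is_derive x (1 : R) p (dp x).
  have h1 : is_derive x (1 : R) y1 (- (2 * (x - l))).
    by apply: is_derive_eq; rewrite /GRing.scale /=; ring.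
  have := @is_derive1_comp _ (fun z => pospart z ^+ 2) y1 x _ _ (is_derive_pospart2 (y1 x)) h1.
  by move=> h; apply: is_derive_eq.
have qy (x : R) : is_derive x (1 : R) q (dq x).
  have h1 : is_derive x (1 : R) y2 (2 * (x - l)).
    by apply: is_derive_eq; rewrite /GRing.scale /=; ring.
  have := @is_derive1_comp _ (fun z => pospart z ^+ 2) y2 x _ _ (is_derive_pospart2 (y2 x)) h1.
  by move=> h; apply: is_derive_eq.
have cy1 : continuous y1.
  by move=> x; apply: is_derive_continuous => z; apply: is_derive_eq; rewrite /GRing.scale /=; reflexivity.
have cy2 : continuous y2.
  by move=> x; apply: is_derive_continuous => z; apply: is_derive_eq; rewrite /GRing.scale /=; reflexivity.
have clin : continuous (fun x : R => 2 * (x - l)).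
  by move=> x; apply: cvgMr; apply: cvgB; [exact: cvg_id|exact: cvg_cst].
have cpp (y : R -> R) : continuous y -> continuous (fun x => 2 * pospart (y x)).
  by move=> cy x; apply: cvgMr; apply: continuous_comp; [exact: cy|exact: continuous_pospart].
have cdp : continuous dp by move=> x; apply: cvgM; [exact: cpp|apply: cvgN; exact: clin].
have cdq : continuous dq by move=> x; apply: cvgM; [exact: cpp|exact: clin].
have cp : continuous p := is_derive_continuous py.
have cq : continuous q := is_derive_continuous qy.
pose N x := p x * a x; pose D x := p x * a x ^+ 2 + q x.
pose dN x := p x * da x + a x * dp x.
pose dD x := p x * (2 * a x * da x) + a x ^+ 2 * dp x + dq x.
have Ny (x : R) : is_derive x (1 : R) N (dN x).
  by apply: is_derive_eq; rewrite /GRing.scale.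
have Dy (x : R) : is_derive x (1 : R) D (dD x).
  by apply: is_derive_eq; rewrite /GRing.scale /= /dD; ring.
have p_ge0 x : 0 <= p x by apply: sqr_ge0.
have q_ge0 x : 0 <= q x by apply: sqr_ge0.
have sqd (x e : R) : 0 < e -> (`|x - l| < e) = ((x - l) ^+ 2 < e ^+ 2).
  by move=> e0; rewrite -[(x - l) ^+ 2]real_normK ?num_real// ltr_pXn2r ?nnegrE// ltW.
have D0 x : 0 < D x.
  case: (ltP `|x - l| (2 * d)) => h.
    apply: ltr_wpDr => //; apply: mulr_gt0; last by rewrite exprn_even_gt0//= Hd.
    have y10 : 0 < y1 x by rewrite sqd ?mulr_gt0// in h; rewrite /y1; lra.
    by rewrite /p pospart_ge0 ?ltW// exprn_gt0.
  apply: ltr_wpDl; first by rewrite mulr_ge0 ?sqr_ge0.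
  have h' : (x - l) ^+ 2 >= (2 * d) ^+ 2 by rewrite leNgt -sqd ?mulr_gt0// -leNgt.
  have d2 : 0 < d ^+ 2 by rewrite exprn_gt0.
  have y20 : 0 < y2 x by rewrite /y2; move: h'; rewrite exprMn; lra.
  by rewrite /q pospart_ge0 ?ltW// exprn_gt0.
pose k x := N x / D x; pose dk x := (dN x * D x - N x * dD x) / D x ^+ 2.
have ky (x : R) : is_derive x (1 : R) k (dk x).
  have Dn0 : D x != 0 by rewrite gt_eqF.
  have h1 := @is_deriveV _ D x _ 1 Dn0 (Dy x).
  have h2 := is_deriveM (Ny x) h1.
  apply: is_derive_eq; rewrite /GRing.scale /= /dk; field; exact: Dn0.
have cN : continuous N := is_derive_continuous Ny.
have cD : continuous D := is_derive_continuous Dy.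
have cdN : continuous dN.
  by move=> x; apply: cvgD; apply: cvgM; [exact: cp|exact: cda|exact: ca|exact: cdp].
have cdD : continuous dD.
  move=> x; apply: cvgD; last exact: cdq.
  apply: cvgD; apply: cvgM; [exact: cp| | |exact: cdp].
    by apply: cvgM; [apply: cvgMr; exact: ca|exact: cda].
  by rewrite expr2; apply: cvgM; exact: ca.
have cdk : continuous dk.
  move=> x; apply: cvgM.
    by apply: cvgB; apply: cvgM; [exact: cdN|exact: cD|exact: cN|exact: cdD].
  apply: cvgV; first by rewrite expf_neq0// gt_eqF.
  by rewrite expr2; apply: cvgM; exact: cD.
have off x : 2 * d <= `|x - l| -> pospart (y1 x) = 0.
  move=> h; apply: pospart_le0.
  have h' : (x - l) ^+ 2 >= (2 * d) ^+ 2 by rewrite leNgt -sqd ?mulr_gt0// -leNgt.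
  by rewrite /y1; move: h'; rewrite exprMn; lra.
have [B1 HB1] : exists B, forall x, `|k x| <= B * poisson 1 x.
  apply: (@compact_decay k l (2 * d)); first exact: is_derive_continuous ky.
  by move=> x /off h; rewrite /k /N /p h expr0n/= !mul0r.
have [B2 HB2] : exists B, forall x, `|dk x| <= B * poisson 1 x.
  apply: (@compact_decay dk l (2 * d) cdk).
  by move=> x /off h; rewrite /dk /dN /N /p /dp h expr0n/= !(mul0r, mulr0, addr0, subr0).
have p0 (x : R) : 0 < poisson 1 x by apply: poisson_gt0.
exists d, k, dk, (`|B1| + `|B2|); split => //.
- move=> x; split; [apply: (le_trans (HB1 x))|apply: (le_trans (HB2 x))]; rewrite ler_pM2r//.
    by apply: (le_trans (ler_norm _)); rewrite lerDl.
  by apply: (le_trans (ler_norm _)); rewrite lerDr.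
- move=> x h; have Dn0 : D x != 0 by rewrite gt_eqF.
  have q0 : q x = 0.
    by rewrite /q pospart_le0 ?expr0n//; rewrite sqd// in h; rewrite /y2; lra.
  have : D x = N x * a x by rewrite /D q0 addr0 /N; ring.
  rewrite /k => e; rewrite mulrAC -e divff//.
Qed.

(** On I the function 1 / a is the transform of a measure, so that h is the product
    of h, a and this transform when its support lies in I: convolution by the
    measure with transform h factors through convolution by mu, and preserves its
    decay. *)
Lemma regular_point (mu : @cmeasure R) (a da : R -> R) (psi : R -> R[i]) (sg l : R) :
  (forall l, fourier_measure mu l = (a l)%:C) ->
  (forall x : R, is_derive x (1 : R) a (da x)) -> continuous da ->
  Cb psi -> sg ^+ 2 = 1 -> vanish sg (mconv mu psi) -> a l != 0 ->
  exists I : set R, [/\ open I, is_interval I, I l &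
    forall h, Mhat h -> supp h `<=` I -> exists nu : @cmeasure R,
      h = fourier_measure nu /\ vanish sg (mconv nu psi)].
Proof.
move=> Fmu ada cda Cpsi sg1 v al.
have [d [k [dk [B [d0 ky cdk kB kI]]]]] := local_inverse ada cda al.
have [q Fq] := bernstein_measure ky cdk (fun x => (kB x).1) (fun x => (kB x).2).
exists (ball l d); split.
- exact: ball_open.
- rewrite ball_itv; exact: interval_is_interval.
- exact: ballxx.
move=> h [mu' _ Fmu'] hI.
have [nu1 [F1 c1]] := fourier_product q mu'.
have [nu [F2 c2]] := fourier_product nu1 mu.
exists nu; split.
  apply/funext => x; rewrite F2 F1 Fq Fmu Fmu'.
  have [h0|hn0] := eqVneq (h x) 0; first by rewrite h0 mulr0 mul0r.
  have xI : ball l d x by apply: hI; apply: subset_closure.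
  rewrite mulrAC -rmorphM kI ?rmorph1 ?mul1r//.
  by rewrite distrC; exact: xI.
rewrite c2; last exact: Cb_cbm.
by apply: vanish_conv => //; exact: Cb_conv.
Qed.

Lemma FT_eqD (f g h : R -> R[i]) : Cb f -> Cb g -> (forall t, h t = f t + g t) ->
  FT h = (fun eta : @schwartz R => FT f eta + FT g eta).
Proof.
move=> Cf Cg H; apply/funext => eta.
have cf := schwartz_fourier_CL1 eta.
rewrite /FT !cintE -CintD.
- by apply: eq_Cint => t; rewrite H mulrDl.
- exact: (CL1M (Cb_cbm Cf) cf).
- exact: (CL1M (Cb_cbm Cg) cf).
Qed.

End SingularSupport.

(** * Uniform continuity along curves of bounded kinetic energy *)

Section QuadraticForms.
Variables (R : realType) (m : nat).
Implicit Types (v : 'rV[R]_m) (G : 'M[R]_m).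

Definition qform G v : R := (v *m G *m v^T) 0 0.
Definition sqn v : R := \sum_i v 0 i ^+ 2.

Lemma qformE G v : qform G v = \sum_i \sum_j v 0 i * G i j * v 0 j.
Proof.
rewrite /qform mxE; under eq_bigr => j _ do rewrite !mxE mulr_suml.
by rewrite exchange_big.
Qed.

Lemma sqn_ge0 v : 0 <= sqn v.
Proof. by apply: sumr_ge0 => i _; exact: sqr_ge0. Qed.

Lemma coord_le_sqn v i : v 0 i ^+ 2 <= sqn v.
Proof. by rewrite /sqn (bigD1 i)//= lerDl sumr_ge0// => j _; exact: sqr_ge0. Qed.

Lemma sqn_eq0 v : sqn v = 0 -> v = 0.
Proof.
move=> h; apply/rowP => i; rewrite mxE; apply/eqP; rewrite -sqrf_eq0 eq_le sqr_ge0 andbT.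
by rewrite -h coord_le_sqn.
Qed.

Lemma sqnZ a v : sqn (a *: v) = a ^+ 2 * sqn v.
Proof. by rewrite /sqn mulr_sumr; apply: eq_bigr => i _; rewrite mxE exprMn. Qed.

Lemma qformZ G a v : qform G (a *: v) = a ^+ 2 * qform G v.
Proof.
rewrite !qformE mulr_sumr; apply: eq_bigr => i _; rewrite mulr_sumr; apply: eq_bigr => j _.
by rewrite !mxE; ring.
Qed.

Lemma continuous_sum (I : finType) (T : topologicalType) (f : I -> T -> R) :
  (forall i, continuous (f i)) -> continuous (fun x => \sum_i f i x).
Proof.
move=> cf; elim: (index_enum I) => [|i r IH].
  by rewrite (_ : (fun x => _) = cst 0); [exact: cst_continuous|apply/funext => x; rewrite big_nil].
rewrite (_ : (fun x => _) = (fun x => f i x + \sum_(i <- r) f i x)); last first.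
  by apply/funext => x; rewrite big_cons.
by move=> x; apply: cvgD; [exact: cf|exact: IH].
Qed.

Lemma continuous_coord (k : 'I_m) : continuous (fun v : 'rV[R]_m => v 0 k).
Proof. exact: (@coord_continuous R 1 m 0 k). Qed.

Lemma continuous_sqn : continuous (sqn : 'rV[R]_m -> R).
Proof.
apply: continuous_sum => i v.
rewrite (_ : (fun v : 'rV[R]_m => _) = (fun v : 'rV[R]_m => v 0 i * v 0 i)); last by apply/funext => w; rewrite expr2.
exact: (cvgM (@continuous_coord i v) (@continuous_coord i v)).
Qed.

Lemma continuous_qform G : continuous (qform G : 'rV[R]_m -> R).
Proof.
rewrite (_ : qform G = (fun v => \sum_i \sum_j v 0 i * G i j * v 0 j)); last by apply/funext => v; exact: qformE.
apply: continuous_sum => i; apply: continuous_sum => j v.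
exact: (cvgM (cvgM (@continuous_coord i v) (cvg_cst (G i j))) (@continuous_coord j v)).
Qed.

Lemma compact_box (p : 'rV[R]_m) (r : R) : compact [set y : 'rV[R]_m | forall k, `|y 0 k - p 0 k| <= r].
Proof.
have := @rV_compact R m (fun k => `[p 0 k - r, p 0 k + r]%classic) (fun k => @segment_compact _ _ _).
rewrite (_ : mkset _ = [set y : 'rV[R]_m | forall k, `|y 0 k - p 0 k| <= r])//.
apply/seteqP; split => y /= h k; have := h k; rewrite in_itv/= ler_norml => /andP[? ?]; apply/andP; split; lra.
Qed.

(** The constant is the minimum of the form on the unit sphere, which is compact. *)
Lemma posdef_bound G : (forall v, v != 0 -> 0 < qform G v) ->
  exists2 c : R, 0 < c & forall v, c * sqn v <= qform G v.
Proof.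
move=> pG.
have scale c : (forall v, sqn v = 1 -> c <= qform G v) -> forall v, c * sqn v <= qform G v.
  move=> H v; have [v0|vn0] := eqVneq (sqn v) 0.
    rewrite v0 mulr0 (sqn_eq0 v0) qformE sumr_ge0// => i _; rewrite sumr_ge0// => j _.
    by rewrite !mxE !mul0r.
  have vp : 0 < sqn v by rewrite lt_neqAle eq_sym vn0 sqn_ge0.
  have s0 : Num.sqrt (sqn v) != 0 by rewrite sqrtr_eq0 -ltNge.
  have s2 : Num.sqrt (sqn v) ^+ 2 = sqn v by rewrite sqr_sqrtr// ltW.
  have := H ((Num.sqrt (sqn v))^-1 *: v).
  rewrite sqnZ exprVn s2 mulVf// => /(_ erefl); rewrite qformZ exprVn s2.
  by rewrite ler_pdivlMl// mulrC.
have [S0|S0] := pselect (exists v, sqn v = 1); last first.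
  by exists 1 => //; apply: scale => v v1; exfalso; apply: S0; exists v.
have cS : compact [set v : 'rV[R]_m | sqn v = 1].
  apply: (subclosed_compact _ (@compact_box 0 1)).
    rewrite (_ : mkset _ = sqn @^-1` [set 1])//.
    by apply: preimage_closed; [move=> x _; exact: continuous_sqn|exact: closed_eq].
  move=> v /= v1 k; rewrite mxE subr0 -(@ler_pXn2r _ 2) ?nnegrE// expr1n real_normK ?num_real//.
  by rewrite -v1 coord_le_sqn.
have [c cS1 cmin] := @compact_EVT_min _ R (qform G) _ S0 cS (continuous_subspaceT (@continuous_qform G)).
rewrite inE/= in cS1.
exists (qform G c).
  by apply: pG; apply/eqP => c0; move: cS1; rewrite c0 /sqn big1 => [/eqP|i _]; rewrite ?mxE ?expr0n// eq_sym oner_eq0.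
by apply: scale => v v1; apply: cmin; rewrite inE.
Qed.

Lemma qform_perturb G G' e v : (forall i j, `|G' i j - G i j| <= e) ->
  qform G v - e * m%:R * sqn v <= qform G' v.
Proof.
move=> H; rewrite lerBlDr -lerBlDl.
rewrite !qformE -sumrB.
apply: (@le_trans _ _ (\sum_i \sum_j e * ((v 0 i ^+ 2 + v 0 j ^+ 2) / 2))).
  apply: ler_sum => i _; rewrite -sumrB; apply: ler_sum => j _.
  rewrite -mulrBl -mulrBr; apply: (le_trans (ler_norm _)).
  have -> : v 0 i * (G i j - G' i j) * v 0 j = (G i j - G' i j) * (v 0 i * v 0 j) by ring.
  rewrite normrM distrC; apply: ler_pM => //.
  rewrite normrM -[v 0 i ^+ 2]real_normK ?num_real// -[v 0 j ^+ 2]real_normK ?num_real//.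
  rewrite -subr_ge0 (_ : _ - _ = (`|v 0 i| - `|v 0 j|) ^+ 2 / 2); last by field.
  by rewrite divr_ge0 ?sqr_ge0.
under eq_bigr => i _ do rewrite -mulr_sumr -mulr_suml big_split/= sumr_const card_ord -/(sqn v).
rewrite -mulr_sumr -mulr_suml big_split/= sumr_const card_ord sumrMnl -/(sqn v).
by rewrite le_eqVlt; apply/orP; left; apply/eqP; rewrite -[sqn v *+ m]mulr_natr; field.
Qed.

End QuadraticForms.

Section ChartBumps.
Variables (R : realType) (m : nat) (M : topologicalType) (S : @smooth_atlas R m M).
Variable A : riemannian_metric S.

Lemma smooth_fun_continuous (g : M -> R) : smooth_fun S g -> continuous g.
Proof.
move=> sg p; have [i ip] := atlas_cover S p.
have [cg _] := sg i 0%N.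
have c1 := cg _ (imageP _ ip).
have c2 := cmap_continuous ip.
have c3 : {for p, continuous ((g \o cinv i) \o cmap i)}.
  by apply: continuous_comp; [exact: c2|exact: c1].
have e : {near p, (g \o cinv i) \o cmap i =1 g}.
  have := open_nbhs_nbhs (conj (dom_open i) ip).
  by apply: filterS => y iy /=; rewrite cmapK.
have c4 : ((g \o cinv i) \o cmap i) y @[y --> p] --> ((g \o cinv i) \o cmap i) p by exact: c3.
rewrite /= cmapK// in c4; exact: cvg_trans (near_eq_cvg e) c4.
Qed.

Lemma is_derive_sqn (q : R -> 'rV[R]_m) (p : 'rV[R]_m) (t : R) : derivable q t 1 ->
  is_derive t (1 : R) (fun s => sqn (q s - p)) (\sum_i 2 * (q t 0 i - p 0 i) * derive1 q t 0 i).
Proof.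
move=> dq.
have dc i : is_derive t (1 : R) (fun s => q s 0 i) (derive1 q t 0 i).
  have di := (derivable_mxP q t 1).1 dq 0 i.
  by apply: DeriveDef => //; rewrite derive1E (derive_mx dq) mxE.
pose h (i : 'I_m) (s : R) := (q s 0 i - p 0 i) ^+ 2.
have dh i : is_derive t (1 : R) (h i) (2 * (q t 0 i - p 0 i) * derive1 q t 0 i).
  by have := dc i => d; apply: is_derive_eq; rewrite /GRing.scale /=; ring.
have := is_derive_sum dh.
rewrite (_ : \sum_(i < m) h i = fun s => sqn (q s - p))//.
by apply/funext => s; rewrite fct_sumE /sqn; apply: eq_bigr => i _; rewrite !mxE.
Qed.

(** The metric is bounded below by the Euclidean form of the coordinates at p, and
    its coefficients are continuous: half the lower bound persists on a box. *)
Lemma chart_box (p : M) (f : M -> R) (e : R) : {for p, continuous f} -> 0 < e ->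
  exists (i : chart S) (r c : R), [/\ dom i p, 0 < r, 0 < c &
    forall y : 'rV[R]_m, (forall k, `|y 0 k - cmap i p 0 k| <= r) -> [/\ (cmap (s := S) i @` dom i) y,
      `|f (cinv i y) - f p| < e & forall v, c * sqn v <= qform (metric A i y) v]].
Proof.
move=> cf e0; have [i ip] := atlas_cover S p.
have [c c0 Hc] : exists2 c : R, 0 < c & forall v, c * sqn v <= qform (metric A i (cmap i p)) v.
  by apply: posdef_bound => v v0; exact: metric_posdef.
pose y0 := cmap i p.
have Uy0 : (cmap (s := S) i @` dom i) y0 by exact: imageP.
have N1 : \forall y \near y0, (cmap (s := S) i @` dom i) y.
  apply: open_nbhs_nbhs; split => //; exact: codom_open.
have N2 : \forall y \near y0, `|f (cinv i y) - f p| < e.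
  have cc : {for y0, continuous (f \o cinv i)}.
    by apply: continuous_comp; [exact: cinv_continuous|rewrite /continuous_at cmapK].
  move/cvgrPdist_lt : cc => /(_ _ e0); rewrite /= /y0 cmapK//.
  by apply: filterS => y; rewrite distrC.
pose d := c / (2 * (m%:R + 1)).
have m1 : 0 < m%:R + 1 :> R by rewrite ltr_wpDl.
have d0 : 0 < d by rewrite divr_gt0// mulr_gt0.
have N3 : \forall y \near y0, forall k : 'I_m * 'I_m, `|metric A i y k.1 k.2 - metric A i y0 k.1 k.2| <= d.
  apply: (@filter_forall _ _ (fun (k : 'I_m * 'I_m) y => `|metric A i y k.1 k.2 - metric A i y0 k.1 k.2| <= d) (nbhs y0)) => -[k l] /=.
  have [cg _] := metric_smooth A i k l 0%N.
  move/cvgrPdist_le : (cg _ Uy0) => /(_ _ d0).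
  by apply: filterS => y; rewrite distrC.
have [r /= r0 Hr] := (nbhs_ballP _ _).1 (filterI N1 (filterI N2 N3)).
exists i, (r / 2), (c / 2); split => //; [by rewrite divr_gt0|by rewrite divr_gt0|].
move=> y yr.
have [|h1 [h2 h3]] := Hr y.
  split => // a b; rewrite (ord1 a) /ball/= distrC (le_lt_trans (yr b))//.
  by rewrite ltr_pdivrMr// ltr_pMr// ltr1n.
split => // v.
apply: le_trans (qform_perturb v (fun a b => h3 (a, b))).
apply: (@le_trans _ _ (c * sqn v - d * m%:R * sqn v)); last by rewrite lerD2r; exact: Hc.
rewrite -mulrBl ler_wpM2r ?sqn_ge0// lerBrDr.
have e' : d * (m%:R + 1) = c / 2 by rewrite /d; field; rewrite gt_eqF.
by rewrite mulrDr mulr1 in e'; lra.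
Qed.

(** Around each point, a bump function of the chart coordinates, extended by 0, is
    Lipschitz along the curve, because the kinetic energy bounds its derivative.
    So a curve that starts where the bump is bounded below stays in the chart for
    a uniform time, and compactness of K makes this time independent of the
    point. *)
Lemma ucont_observable (x : R -> M) (f : M -> R) (K : set M) (C : R) :
  continuous x -> continuous f -> compact K -> (forall t, K (x t)) ->
  (forall i t, dom (s := S) i (x t) -> derivable (cmap i \o x) t 1) ->
  (forall i t, dom (s := S) i (x t) ->
     kinetic A i (cmap i (x t)) (derive1 (cmap i \o x) t) <= C) ->
  ucont (f \o x).
Proof.
move=> cx cf cK Kx dx kC e e0.
have loc (p : M) : K p -> \forall p' \near p & d \near (0 : R)^'+,
    forall s t, x s = p' -> `|s - t| < d -> `|f (x s) - f (x t)| < e.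
  move=> Kp; have e2 : 0 < e / 2 by rewrite divr_gt0.
  have [i [r [c [ip r0 c0 H]]]] := chart_box (cf p) e2.
  pose y0 := cmap i p; pose q := cmap i \o x.
  pose box := [set y : 'rV[R]_m | forall k, `|y 0 k - y0 0 k| <= r].
  pose D := cinv i @` box.
  have boxD y : box y -> exists2 z, dom i z & cmap (s := S) i z = y by move=> /H[[z]]; exists z.
  have domD z : D z -> dom i z /\ box (cmap i z).
    by move=> [y yb <-]; have [z' iz' Ey] := boxD y yb; rewrite -Ey cmapK// Ey.
  have Ddom z : dom i z -> box (cmap i z) -> D z.
    by move=> iz bz; exists (cmap i z) => //; rewrite cmapK.
  have closedD : closed D.
    apply: (compact_closed (atlas_hausdorff S)); apply: continuous_compact; last exact: compact_box.
    apply: continuous_in_subspaceT => y /set_mem /boxD[z iz <-]; exact: cinv_continuous.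
  pose z t := r ^+ 2 - sqn (q t - y0).
  pose h t := if `[<dom i (x t)>] then pospart (z t) ^+ 2 else 0.
  pose dz t := - \sum_k 2 * (q t 0 k - y0 0 k) * derive1 q t 0 k.
  pose dh t := if `[<D (x t)>] then 2 * pospart (z t) * dz t else 0.
  have zbox t : 0 < z t -> box (q t).
    move=> zt k; rewrite -(@ler_pXn2r _ 2) ?nnegrE// ?ltW// real_normK ?num_real//.
    have := coord_le_sqn (q t - y0) k; rewrite !mxE => /le_lt_trans; apply.
    by rewrite -subr_gt0.
  have hder (t : R) : is_derive t (1 : R) h (dh t).
    rewrite /dh; case: asboolP => Dt.
      have [it bt] := domD _ Dt.
      have h1 : is_derive t (1 : R) z (dz t).
        have h0 := is_derive_sqn y0 (dx i t it).
        by have := is_deriveB (is_derive_cst (r ^+ 2) t 1) h0; rewrite sub0r.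
      have h2 := @is_derive1_comp _ (fun z => pospart z ^+ 2) z t _ _ (is_derive_pospart2 (z t)) h1.
      have h3 : is_derive t (1 : R) (fun s => pospart (z s) ^+ 2) (2 * pospart (z t) * dz t).
        by apply: is_derive_eq.
      have nE : \near t, pospart (z t) ^+ 2 = h t.
        have nd : \forall s \near t, dom i (x s) by exact: (cx t _ (open_nbhs_nbhs (conj (dom_open i) it))).
        by apply: filterS nd => s is_; rewrite /h asboolT.
      exact: (near_eq_is_derive nE h3).
    have oD : open (~` D) by exact: closed_openC.
    have nd : \forall s \near t, ~ D (x s) by exact: (cx t _ (open_nbhs_nbhs (conj oD Dt))).
    have h3 : is_derive t (1 : R) (fun s : R => 0 : R) 0 by apply: is_derive_eq.
    have nE : \near t, 0 = h t.
      apply: filterS nd => s nD; rewrite /h; case: asboolP => // is_.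
      rewrite pospart_le0 ?expr0n//; rewrite leNgt; apply/negP => /zbox bs; apply: nD.
      exact: Ddom.
    exact: (near_eq_is_derive nE h3).
  pose L := 1 + 2 * `|C| / c.
  pose B := 2 * r ^+ 2 * (m%:R * (2 * r * L)) + 1.
  have zle t : pospart (z t) <= r ^+ 2.
    case: (leP 0 (z t)) => z0; last by rewrite pospart_le0 ?sqr_ge0// ltW.
    by rewrite pospart_ge0// /z gerBl sqn_ge0.
  have pp0 y : 0 <= pospart y :> R.
    by case: (leP 0 y) => y0'; [rewrite pospart_ge0|rewrite pospart_le0// ltW].
  have hB t : `|dh t| <= B.
    rewrite /dh; case: asboolP => Dt; last first.
      rewrite normr0 addr_ge0//.
      by rewrite !mulr_ge0 ?exprn_ge0// ?ltW// ltr_pwDl// divr_ge0 ?mulr_ge0// ltW.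
    have [it bt] := domD _ Dt.
    apply: (@le_trans _ _ (2 * r ^+ 2 * (m%:R * (2 * r * L)))); last by rewrite lerDl.
    rewrite normrM; apply: ler_pM => //.
      by rewrite normrM (ger0_norm (pp0 _)) (ger0_norm (ler0n _ 2)); apply: ler_wpM2l.
    rewrite /dz normrN; apply: (le_trans (ler_norm_sum _ _ _)).
    rewrite mulr_natl -[X in _ <= _ *+ X]card_ord -sumr_const; apply: ler_sum => k _.
    have [_ _ Hq] := H _ bt.
    have kin : c * sqn (derive1 q t) <= 2 * C.
      apply: (le_trans (Hq (derive1 q t))); have := kC i t it; rewrite /kinetic -/(qform _ _).
      by rewrite ler_pdivrMl.
    have sq : sqn (derive1 q t) <= 2 * `|C| / c.
      rewrite ler_pdivlMr// mulrC; apply: (le_trans kin); rewrite ler_wpM2l//; exact: ler_norm.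
    have cq := le_trans (coord_le_sqn (derive1 q t) k) sq.
    rewrite !normrM; apply: ler_pM => //; first by rewrite (ger0_norm (ler0n _ 2)); apply: ler_wpM2l => //; exact: bt.
    rewrite /L; apply: le_trans (lerD (lexx 1) cq).
    rewrite -[_ ^+ 2]real_normK ?num_real//.
    have := sqr_ge0 (`|derive1 q t 0 k| - 2^-1); set a := `|_|; rewrite sqrrB; lra.
  have B0 : 0 < B.
    apply: ltr_wpDl => //.
    by rewrite !mulr_ge0 ?exprn_ge0// ?ltW// ltr_pwDl// divr_ge0 ?mulr_ge0// ltW.
  have r2 : 0 < r ^+ 2 / 2 by rewrite divr_gt0// exprn_gt0.
  pose d0 := (r ^+ 2 / 2) ^+ 2 / B.
  have d00 : 0 < d0 by rewrite divr_gt0// exprn_gt0.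
  exists ([set y | dom i y /\ sqn (cmap i y - y0) < r ^+ 2 / 2], [set d : R | d < d0]); first split => /=.
  - apply: filterI; first exact: open_nbhs_nbhs (conj (dom_open i) ip).
    have c1 : {for p, continuous (fun y => sqn (cmap i y - y0))}.
      have c0' : cmap i y - y0 @[y --> p] --> cmap i p - y0.
        by apply: cvgB; [exact: cmap_continuous|exact: cvg_cst].
      exact: (cvg_comp _ (@sqn R m) c0' (@continuous_sqn R m _)).
    move/cvgrPdist_lt : c1 => /(_ _ r2); apply: filterS => y.
    rewrite subrr (_ : sqn 0 = 0); last by rewrite /sqn big1// => k _; rewrite mxE expr0n.
    by rewrite sub0r normrN ger0_norm ?sqn_ge0.
  - exact: nbhs_right_lt.
  move=> [y d] /= [[iy ylt] dlt] s t xs st.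
  have fcl u : 0 < h u -> `|f (x u) - f p| < e / 2.
    rewrite /h; case: asboolP => [iu|_]; last by rewrite ltxx.
    move=> zu; have z0 : 0 < z u.
      by rewrite ltNge; apply: contraTN zu => zu; rewrite pospart_le0// expr0n ltxx.
    by have [_ + _] := H _ (zbox u z0); rewrite /q /= cmapK.
  have hs : (r ^+ 2 / 2) ^+ 2 < h s.
    rewrite /h asboolT ?xs//.
    have zs : r ^+ 2 / 2 < z s by rewrite /z /q /= xs; lra.
    have zs0 : 0 < z s by apply: lt_trans zs.
    by rewrite pospart_ge0 ?ltW// ltr_pXn2r ?nnegrE// ltW.
  have ht : 0 < h t.
    have := abs_sub_le s t hder hB => hb.
    have hb2 : B * `|s - t| < (r ^+ 2 / 2) ^+ 2.
      by rewrite mulrC -ltr_pdivlMr//; apply: lt_trans dlt.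
    have := ler_norm (h s - h t); move: hs hb hb2.
    move: (h s) (h t) (`|h s - h t|) (B * _) (_ ^+ 2) => a1 a2 a3 a4 a5; lra.
  have k1 := fcl _ ht; have k2 : `|f (x s) - f p| < e / 2.
    by apply: fcl; apply: lt_trans hs; rewrite exprn_gt0.
  have -> : f (x s) - f (x t) = (f (x s) - f p) - (f (x t) - f p) by ring.
  apply: (le_lt_trans (ler_normB _ _)).
  by rewrite [ltRHS](_ : e = e / 2 + e / 2); [exact: ltrD|field].
have [cov _] := compact_near_coveringP K.
have near0 := cov cK _ _ _ (at_right_proper_filter (0 : R)) loc.
have [d [d0 Hd]] : exists d : R, 0 < d /\ forall p, K p -> forall s t, x s = p -> `|s - t| < d -> `|f (x s) - f (x t)| < e.
  have := filter_ex (filterI (nbhs_right_gt (0 : R)) near0).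
  by move=> [d [/= d0 Hd]]; exists d; split => // p Kp; exact: Hd.
exists d => // s t st; exact: (Hd (x s)).
Qed.

End ChartBumps.

(** * Quotients by the density of oscillators *)

Section ExtendedQuotients.
Variable R : realType.

Lemma ae_imp (P Q : R -> Prop) : (forall x, P x -> Q x) ->
  {ae leb R, forall x, P x} -> {ae leb R, forall x, Q x}.
Proof.
move=> PQ [N [mN N0 H]]; exists N; split => // x /= nQ.
by apply: H => /= Px; apply: nQ; exact: PQ.
Qed.

Lemma ae_and (P Q : R -> Prop) : {ae leb R, forall x, P x} ->
  {ae leb R, forall x, Q x} -> {ae leb R, forall x, P x /\ Q x}.
Proof.
move=> hP hQ; apply: (negligibleS _ (negligibleU hP hQ)) => x /= nPQ.
have [Px|nP] := pselect (P x); last by left.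
by right => Qx; apply: nPQ.
Qed.

Lemma ae_neq (a : R) : {ae leb R, forall x, x <> a}.
Proof.
exists [set a]; split; [exact: measurable_set1|exact: lebesgue_measure_set1|].
by move=> x /= /contrapT.
Qed.

(** A finite integral forces u to vanish almost everywhere with r, where the
    extended quotient and the real one agree. *)
Lemma quotient_integrable (u r : R -> R) : Rmeas u -> Rmeas r ->
  (forall x, 0 <= u x) -> (forall x, 0 <= r x) ->
  (\int[leb R]_x ((u x)%:E / (r x)%:E) < +oo)%E ->
  [/\ {ae leb R, forall x, r x = 0 -> u x = 0}, L1 (leb R) (fun x => u x / r x) &
    fine (\int[leb R]_x ((u x)%:E / (r x)%:E))%E = \int[leb R]_x (u x / r x)].
Proof.
move=> mu mr u0 r0 fin.
pose F x := ((u x)%:E / (r x)%:E)%E.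
have FE x : F x = if r x == 0 then ((u x)%:E * +oo)%E else (u x / r x)%:E.
  by rewrite /F /inve; case: ifP.
have mur : Rmeas (fun x => u x / r x) by apply: measurable_funM => //; exact: meas_inv.
have mF : measurable_fun [set: measurableTypeR R] F.
  rewrite (_ : F = fun x => if r x == 0 then ((u x)%:E * +oo)%E else (u x / r x)%:E); last by apply/funext.
  apply: measurable_fun_ifT.
  - by apply: measurable_fun_eqr => //; exact: measurable_cst.
  - by apply: emeasurable_funM; [exact/measurable_EFinP|exact: measurable_cst].
  - exact/measurable_EFinP.
have F0 x : (0 <= F x)%E.
  rewrite FE; case: ifP => _; first by rewrite mule_ge0// lee_fin.
  by rewrite lee_fin divr_ge0.
have IF : (leb R).-integrable [set: measurableTypeR R] F.
  apply/integrableP; split => //; apply: le_lt_trans fin.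
  by under eq_integral => x _ do rewrite gee0_abs//.
have aefin := integrable_ae measurableT IF.
have ae0 : {ae leb R, forall x, r x = 0 -> u x = 0}.
  apply: ae_imp aefin => x /(_ I); rewrite FE => h rx0; move: h; rewrite rx0 eqxx.
  have [->//|un0] := eqVneq (u x) 0.
  by rewrite gt0_muley// lte_fin lt_neqAle eq_sym un0 u0.
have aeE : {ae leb R, forall x, F x = (u x / r x)%:E}.
  apply: ae_imp ae0 => x h; rewrite FE; case: eqP => [rx0|//].
  by rewrite (h rx0) mul0e mul0r.
have E : (\int[leb R]_x F x = \int[leb R]_x (u x / r x)%:E)%E.
  apply: ae_eq_integral => //; first exact/measurable_EFinP.
  by apply: ae_imp aeE => x h _.
have I1 : L1 (leb R) (fun x => u x / r x).
  apply: L1_ltyP => //; first by move=> x; rewrite divr_ge0.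
  by rewrite -E.
split => //; rewrite -/(F _) in E *; by rewrite E (Rint_EFin I1).
Qed.

Lemma ae_Rint_ge0 (f : R -> R) : Rmeas f -> {ae leb R, forall x, 0 <= f x} ->
  0 <= \int[leb R]_x f x.
Proof.
move=> mf f0; rewrite (@ae_eq_Rint _ _ _ (leb R) f (fun x => `|f x|)) //.
- exact: Rint_ge0.
- exact: meas_norm.
- by apply: ae_imp f0 => x h; rewrite ger0_norm.
Qed.

Lemma sgi_FTC (F f : R -> R) (t : R) : (forall x : R, is_derive x (1 : R) F (f x)) ->
  continuous f -> F t - F 0 = \int[leb R]_s (sgi t s * f s).
Proof.
move=> dF cf; have mf := meas_continuous cf.
have msf : Rmeas (fun s => sgi t s * f s) by apply: measurable_funM => //; exact: meas_sgi.
have mi (a b : R) : Rmeas (\1_(`[a, b]%classic) : R -> R) by apply: meas_indic; exact: measurable_itv.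
case: (leP 0 t) => t0.
  rewrite -(FTC_itv dF cf t0) Rint_indic; apply: (@ae_eq_off2 R 0 t) => //; first exact: measurable_funM.
  move=> x x0 xt; congr (_ * _); rewrite sgiE indicE; case: (boolP (x \in _)).
    rewrite inE/= in_itv/= => /andP[-> xlt]; by rewrite lt_neqAle xt xlt.
  rewrite notin_setE/= in_itv/= => /negP h; case: ifP => h1.
    by case/andP: h1 => h1 h2; rewrite h1 (ltW h2) in h.
  by case: ifP => // /andP[h2 h3]; move: (le_lt_trans t0 (le_lt_trans h2 h3)); rewrite ltxx.
have t0' := ltW t0.
have I1 : L1 (leb R) (fun x => \1_(`[t, 0]%classic) x * f x).
  by apply: L1_indic; [exact: measurable_itv|exact: continuous_L1_itv].
rewrite -opprB -(FTC_itv dF cf t0') Rint_indic -(RintN I1).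
apply: (@ae_eq_off2 R 0 t) => //; first by apply: measurable_funN; exact: measurable_funM.
move=> x x0 xt; rewrite -mulNr; congr (_ * _); rewrite sgiE indicE; case: (boolP (x \in _)).
  rewrite inE/= in_itv/= => /andP[xt1 xlt].
  have x0' : x < 0 by rewrite lt_neqAle x0.
  by rewrite leNgt x0'/= xt1.
rewrite notin_setE/= in_itv/= => /negP h; rewrite oppr0; case: ifP => h1.
  by case/andP: h1 => h1 h2; move: (lt_trans (le_lt_trans h1 h2) t0); rewrite ltxx.
by case: ifP => // /andP[h2 h3]; rewrite h2 (ltW h3) in h.
Qed.

End ExtendedQuotients.

(** * Motion of the oscillators *)

Section Oscillators.
Variables (R : realType) (psi : R -> R).
Hypothesis cpsi : continuous psi.

(** In the frame rotating at frequency nu, the force only displaces the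
    amplitudes. With s = sqrt rho and a = kappa / sqrt rho, the squares of the
    amplitudes X and Y are energies. *)
Lemma oscillator_solution (s nu a : R) (y : R -> R) :
  (forall t, twice_derivable y t) ->
  (forall t, s * (derive1n 2 y t + nu ^+ 2 * y t) = a * psi t) ->
  let g t r := sgi t r * psi r in
  let X t := s * derive1 y 0 + a * Ct (g t) nu in
  let Y t := s * nu * y 0 - a * St (g t) nu in
  forall t, s * derive1 y t = cos (t * nu) * X t - sin (t * nu) * Y t /\
    s * nu * y t = sin (t * nu) * X t + cos (t * nu) * Y t.
Proof.
move=> dy eqy g X Y t.
have d1 (x : R) : is_derive x (1 : R) y (derive1 y x).
  by have [h _] := dy x; rewrite derive1E; exact: derivableP.
have d2 (x : R) : is_derive x (1 : R) (derive1 y) (derive1n 2 y x).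
  by have [_ h] := dy x; rewrite /= derive1E; exact: derivableP.
have dl (x : R) : is_derive x (1 : R) (fun x => x * nu) nu.
  by apply: is_derive_eq; rewrite /GRing.scale /=; ring.
have dc (x : R) : is_derive x (1 : R) (fun x => cos (x * nu)) (- sin (x * nu) * nu).
  by have := @is_derive1_comp _ (@cos R) (fun x => x * nu) x _ _ (is_derive_cos _) (dl x) => h; apply: is_derive_eq.
have ds (x : R) : is_derive x (1 : R) (fun x => sin (x * nu)) (cos (x * nu) * nu).
  by have := @is_derive1_comp _ (@sin R) (fun x => x * nu) x _ _ (is_derive_sin _) (dl x) => h; apply: is_derive_eq.
(* Velocity and position in the rotating frame: primitives of the force. *)
pose F x := cos (x * nu) * (s * derive1 y x) + sin (x * nu) * (s * nu * y x).
pose G x := cos (x * nu) * (s * nu * y x) - sin (x * nu) * (s * derive1 y x).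
have dF (x : R) : is_derive x (1 : R) F (a * (psi x * cos (x * nu))).
  have := eqy x; have hc := dc x; have hs := ds x; have h1 := d1 x; have h2 := d2 x => e.
  apply: is_derive_eq; rewrite /GRing.scale /=.
  rewrite [a * _]mulrA -e -[derive1 (derive1 y) x]/(derive1n 2 y x); ring.
have dG (x : R) : is_derive x (1 : R) G (- (a * (psi x * sin (x * nu)))).
  have := eqy x; have hc := dc x; have hs := ds x; have h1 := d1 x; have h2 := d2 x => e.
  apply: is_derive_eq; rewrite /GRing.scale /=.
  rewrite [a * _]mulrA -e -[derive1 (derive1 y) x]/(derive1n 2 y x); ring.
have cc : continuous (fun x : R => psi x * cos (x * nu)).
  by move=> x; apply: cvgM; [exact: cpsi|exact: (is_derive_continuous dc)].
have cs : continuous (fun x : R => psi x * sin (x * nu)).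
  by move=> x; apply: cvgM; [exact: cpsi|exact: (is_derive_continuous ds)].
have loc (f : R -> R) : continuous f -> L1 (leb R) (fun r => sgi t r * f r).
  move=> cf; have mf := meas_continuous cf.
  have bd (u v : R) : L1 (leb R) (fun r => \1_(`[u, v]%classic) r * f r).
    by apply: L1_indic; [exact: measurable_itv|exact: continuous_L1_itv].
  apply: (L1_le _ (L1D (L1_abs (bd 0 t)) (L1_abs (bd t 0)))).
    by apply: measurable_funM => //; exact: meas_sgi.
  move=> r; rewrite !normrM -mulrDl ler_wpM2r// /sgi; apply: (le_trans (ler_normB _ _)).
  have mono (i j : interval R) : [set` i] `<=` [set` j] -> `|\1_[set` i] r| <= `|\1_[set` j] r| :> R.
    move=> ij; rewrite !indicE; case: (boolP (r \in [set` i])) => [|_]; last by rewrite normr0.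
    by rewrite inE => /ij h; rewrite mem_set.
  by apply: lerD; apply: mono => z /=; rewrite !in_itv/= => /andP[-> /ltW ->].
have F0 : F 0 = s * derive1 y 0 by rewrite /F mul0r cos0 sin0; ring.
have G0 : G 0 = s * nu * y 0 by rewrite /G mul0r cos0 sin0; ring.
have FX : F t = X t.
  apply: (@addIr _ (- F 0)); rewrite (sgi_FTC t dF); last by move=> x; apply: cvgMr; exact: cc.
  rewrite /X F0 addrAC subrr add0r /Ct -(RintZ _ _); last first.
    by apply: (eq_L1R _ (loc _ cc)) => r; rewrite /g (mulrC r nu); ring.
  by apply: eq_Rint => r; rewrite /g (mulrC r nu); ring.
have GY : G t = Y t.
  apply: (@addIr _ (- G 0)); rewrite (sgi_FTC t dG); last by move=> x; apply: cvgN; apply: cvgMr; exact: cs.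
  have Is : L1 (leb R) (fun r => sin (nu * r) * g t r).
    by apply: (eq_L1R _ (loc _ cs)) => r; rewrite /g (mulrC r nu); ring.
  rewrite /Y G0 addrAC subrr add0r /St -(RintZ _ Is) -(RintN (L1Z a Is)).
  by apply: eq_Rint => r; rewrite /g (mulrC r nu); ring.
rewrite -FX -GY /F /G.
have cs1 := cos2Dsin2 (t * nu).
set c := cos _ in cs1 *; set d := sin _ in cs1 *.
split.
  rewrite -[LHS]mul1r -cs1; ring.
rewrite -[LHS]mul1r -cs1; ring.
Qed.

End Oscillators.

(** * The thermostat *)
Section Thermostat.
Variable R : realType.
Notation C := R[i].

Lemma bounded_funP (f : R -> R) : (exists B, forall t, `|f t| <= B) -> bounded_fun f.
Proof.
move=> [B fB]; exists B; split; first exact: num_real.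
by move=> y By x _; exact: le_trans (fB x) (ltW By).
Qed.

(** Completing the square in the integrands: with n = rho nu^2, the expression
    n xi^2 - 2 f kappa xi + f^2 kappa^2 / n is n (xi - f kappa / n)^2. The second
    bound follows from the same inequality for 2 f in place of f. *)
Lemma oscillator_energy_bound (rho kappa : R -> R) (xi : R -> R -> R) (t f : R)
    (K := fine (int_k2rn rho kappa))
    (Q := \int[leb R]_nu (rho nu * nu ^+ 2 * xi nu t ^+ 2)) :
  Rmeas rho -> Rmeas kappa -> (forall nu, 0 <= rho nu) ->
  (int_k2rn rho kappa < +oo)%E -> finite_oscillator_energy rho kappa xi t ->
  0 <= Q - 2 * f * coupling kappa xi t + K * f ^+ 2 /\
  Q <= 2 * (Q - 2 * f * coupling kappa xi t + K * f ^+ 2) + 2 * f ^+ 2 * K.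
Proof.
move=> mr mk r0 fin [_ IQ Ik].
have mn : Rmeas (fun nu => rho nu * nu ^+ 2) by apply: measurable_funM => //; apply: measurable_funX; exact: meas_id.
have n0 nu : 0 <= rho nu * nu ^+ 2 by rewrite mulr_ge0 ?sqr_ge0.
have [ae0 Ir EK] := quotient_integrable (measurable_funX 2 mk) mn (fun x => sqr_ge0 _) n0 fin.
pose q nu := rho nu * nu ^+ 2 * xi nu t ^+ 2; pose k nu := kappa nu * xi nu t.
pose r nu := kappa nu ^+ 2 / (rho nu * nu ^+ 2).
have Iq : L1 (leb R) q by [].
have Ik' : L1 (leb R) k by [].
have EKr : K = \int[leb R]_x r x by exact: EK.
have key (c : R) : 0 <= Q - c * coupling kappa xi t + (c / 2) ^+ 2 * K.
  have I1 := L1Z c Ik'; have I2 := L1Z ((c / 2) ^+ 2) Ir.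
  rewrite EKr /coupling /Q -(RintZ c Ik') -(RintZ ((c / 2) ^+ 2) Ir) -(RintB Iq I1) -(RintD (L1B Iq I1) I2).
  apply: ae_Rint_ge0; first exact: (L1_meas (L1D (L1B Iq I1) I2)).
  apply: ae_imp ae0 => nu h; rewrite /q /k /r.
  have [z|nz] := eqVneq (rho nu * nu ^+ 2) 0.
    have k0 : kappa nu = 0 by apply/eqP; rewrite -sqrf_eq0 h.
    by rewrite z k0 expr0n/= !(mul0r, mulr0) subr0 addr0.
  have -> : rho nu * nu ^+ 2 * xi nu t ^+ 2 - c * (kappa nu * xi nu t) + (c / 2) ^+ 2 * (kappa nu ^+ 2 / (rho nu * nu ^+ 2))
     = (rho nu * nu ^+ 2 * xi nu t - c / 2 * kappa nu) ^+ 2 / (rho nu * nu ^+ 2).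
    move: nz; move: (rho nu * nu ^+ 2) => n nz; field; exact: nz.
  by rewrite divr_ge0 ?sqr_ge0.
split.
  have := key (2 * f); rewrite (_ : 2 * f / 2 = f); last by field.
  by rewrite (mulrC (f ^+ 2)).
have := key (4 * f); rewrite (_ : 4 * f / 2 = 2 * f); last by field.
rewrite exprMn -/Q; move: (coupling _ _ _) => w.
have -> : 2 ^+ 2 * f ^+ 2 * K = 4 * (f ^+ 2 * K) by ring.
have -> : 4 * f * w = 4 * (f * w) by ring.
have -> : 2 * (Q - 2 * f * w + K * f ^+ 2) + 2 * f ^+ 2 * K = 2 * Q - 4 * (f * w) + 4 * (f ^+ 2 * K) by ring.
lra.
Qed.

Section Motion.
Variables (rho kappa ahat xi0 xidot0 psi : R -> R) (xi : R -> R -> R) (B E0 : R).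
Hypotheses (mrho : Rmeas rho) (mkappa : Rmeas kappa) (mxi0 : Rmeas xi0) (mxidot0 : Rmeas xidot0).
Hypothesis aeah : {ae leb R, forall nu, ahat nu = kappa nu / Num.sqrt (rho nu)}.
Hypothesis rho0 : forall nu, 0 <= rho nu.
Hypotheses (fin1 : (int_k2r rho kappa < +oo)%E) (fin2 : (int_k2rn rho kappa < +oo)%E).
Hypothesis Iinit : L1 (leb R) (fun nu => rho nu * (xidot0 nu ^+ 2 + nu ^+ 2 * xi0 nu ^+ 2)).
Variables (a c : @cmeasure R).
Hypothesis Fa : forall l, fourier_measure a l = (ahat l)%:C.
Hypothesis dah : forall nu, derivable ahat nu 1.
Hypothesis Fc : forall l, fourier_measure c l = (derive1 ahat l)%:C.
Hypothesis ah0 : ahat 0 = 0.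
Hypotheses (up : ucont psi) (psiB : forall t, `|psi t| <= B).
Hypothesis osc : oscillators rho kappa psi xi.
Hypothesis fen : forall t, finite_oscillator_energy rho kappa xi t.
Hypothesis enb : forall t, \int[leb R]_nu (rho nu * derive1 (xi nu) t ^+ 2)
  + \int[leb R]_nu (rho nu * nu ^+ 2 * xi nu t ^+ 2) <= E0.
Hypothesis init : {ae leb R, forall nu, xi nu 0 = xi0 nu /\ derive1 (xi nu) 0 = xidot0 nu}.

Let bah : bmeas ahat.
Proof. by have [b1 _] := cbm_fourier_measure a; apply: eq_bmeas b1 => l; rewrite Fa. Qed.

Let ada (x : R) : is_derive x (1 : R) ahat (derive1 ahat x).
Proof. by rewrite derive1E; exact: derivableP. Qed.

Let cda : continuous (derive1 ahat).
Proof.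
have cc := @continuous_fourier_measure R c.
by rewrite (_ : derive1 ahat = (fun l => Re (fourier_measure c l)))//; apply/funext => l; rewrite Fc.
Qed.

Let msqrt : Rmeas (fun nu => Num.sqrt (rho nu)).
Proof. by apply: (Rmeas_comp _ mrho); apply: meas_continuous; exact: sqrt_continuous. Qed.

Let sqrt2 nu : Num.sqrt (rho nu) ^+ 2 = rho nu.
Proof. by rewrite sqr_sqrtr. Qed.

Let ah2 : L1 (leb R) (fun l => ahat l ^+ 2).
Proof.
have [_ I1 _] := quotient_integrable (measurable_funX 2 mkappa) mrho (fun x => sqr_ge0 _) rho0 fin1.
apply: (@ae_eq_L1 _ _ _ (leb R) _ _ (L1_meas I1) (measurable_funX 2 bah.1) _ I1).
by apply: ae_imp aeah => nu ->; rewrite expr_div_n sqrt2.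
Qed.

Let a0 nu := Num.sqrt (rho nu) * xidot0 nu.
Let b0 nu := Num.sqrt (rho nu) * nu * xi0 nu.

Let ma0 : Rmeas a0. Proof. exact: measurable_funM. Qed.
Let mb0 : Rmeas b0.
Proof. by apply: measurable_funM => //; apply: measurable_funM => //; exact: meas_id. Qed.

Let a02 : L1 (leb R) (fun l => a0 l ^+ 2).
Proof.
apply: (L1_le (measurable_funX 2 ma0) Iinit) => l.
by rewrite ger0_norm ?sqr_ge0// exprMn sqrt2 ler_wpM2l// lerDl mulr_ge0 ?sqr_ge0.
Qed.

Let b02 : L1 (leb R) (fun l => b0 l ^+ 2).
Proof.
apply: (L1_le (measurable_funX 2 mb0) Iinit) => l.
by rewrite ger0_norm ?sqr_ge0// !exprMn sqrt2 -mulrA ler_wpM2l// lerDr sqr_ge0.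
Qed.

Let bpsi : bmeas psi. Proof. by split; [exact: ucont_meas|exists B]. Qed.
Let g t s := sgi t s * psi s.
Let Ig t : L1 (leb R) (g t) := L1_sgiM t bpsi.
Let X t l := a0 l + ahat l * Ct (g t) l.
Let Y t l := b0 l - ahat l * St (g t) l.

Let mX t : Rmeas (X t).
Proof.
apply: measurable_funD => //; apply: measurable_funM; first exact: bah.1.
exact: ucont_meas (ucont_Ct (Ig t)).
Qed.
Let mY t : Rmeas (Y t).
Proof.
apply: measurable_funB => //; apply: measurable_funM; first exact: bah.1.
exact: ucont_meas (ucont_St (Ig t)).
Qed.

Let motion : {ae leb R, forall nu, forall t,
  Num.sqrt (rho nu) * derive1 (xi nu) t = cos (t * nu) * X t nu - sin (t * nu) * Y t nu /\
  Num.sqrt (rho nu) * nu * xi nu t = sin (t * nu) * X t nu + cos (t * nu) * Y t nu}.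
Proof.
apply: ae_imp (ae_and aeah (ae_and osc init)) => nu [ea [eo [i1 i2]]].
have cpsi : continuous psi := ucont_continuous up.
have := @oscillator_solution R psi cpsi (Num.sqrt (rho nu)) nu (ahat nu) (xi nu) (fun t => (eo t).1).
rewrite i1 i2; apply => t.
have [r0|rn0] := eqVneq (rho nu) 0; first by rewrite ea r0 sqrtr0 invr0 mulr0 !mul0r.
have s0 : Num.sqrt (rho nu) != 0 by rewrite sqrtr_eq0 -ltNge lt_neqAle eq_sym rn0 rho0.
apply: (mulfI s0); rewrite mulrA -expr2 sqrt2 (eo t).2 ea.
by field.
Qed.

(* Rotations preserve the energy, which bounds the amplitudes in the rotating
   frame at all times, past and future. *)
Let XY t : L1 (leb R) (fun l => X t l ^+ 2 + Y t l ^+ 2) /\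
  \int[leb R]_l (X t l ^+ 2 + Y t l ^+ 2) <= E0.
Proof.
have [I1 I2 _] : [/\ L1 (leb R) (fun nu => rho nu * derive1 (xi nu) t ^+ 2),
  L1 (leb R) (fun nu => rho nu * nu ^+ 2 * xi nu t ^+ 2) & True] by have [] := fen t.
have I12 : L1 (leb R) (fun nu => rho nu * derive1 (xi nu) t ^+ 2 + rho nu * nu ^+ 2 * xi nu t ^+ 2).
  exact: (L1D I1 I2).
have mXY : Rmeas (fun l => X t l ^+ 2 + Y t l ^+ 2).
  by apply: measurable_funD; exact: measurable_funX.
have ae : {ae leb R, forall nu, rho nu * derive1 (xi nu) t ^+ 2 + rho nu * nu ^+ 2 * xi nu t ^+ 2 = X t nu ^+ 2 + Y t nu ^+ 2}.
  apply: ae_imp motion => nu /(_ t) [h1 h2].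
  rewrite -{1 2}(sqrt2 nu) -!exprMn h1 h2.
  have := cos2Dsin2 (t * nu); set x := cos _; set y := sin _ => e.
  rewrite -[RHS]mul1r -e; ring.
split; first exact: (ae_eq_L1 (L1_meas I12) mXY ae I12).
rewrite -(ae_eq_Rint (L1_meas I12) mXY ae).
rewrite (RintD I1 I2); exact: enb.
Qed.

(* Subtracting the amplitudes at times n and -n eliminates the initial data. *)
Let XY2 n : L1 (leb R) (fun l => ahat l ^+ 2 *
     (Ct (fun t => cut n t * psi t) l ^+ 2 + St (fun t => cut n t * psi t) l ^+ 2)) /\
  \int[leb R]_l (ahat l ^+ 2 *
     (Ct (fun t => cut n t * psi t) l ^+ 2 + St (fun t => cut n t * psi t) l ^+ 2)) <= 4 * E0.
Proof.
pose p := n%:R : R.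
have gE s : cut n s * psi s = g p s - g (- p) s by rewrite cut_sgi mulrBl.
have CE l : Ct (fun t => cut n t * psi t) l = Ct (g p) l - Ct (g (- p)) l.
  rewrite /Ct -(RintB (L1_cosM l (Ig p)) (L1_cosM l (Ig (- p)))); apply: eq_Rint => s.
  by rewrite gE mulrBr.
have SE l : St (fun t => cut n t * psi t) l = St (g p) l - St (g (- p)) l.
  rewrite /St -(RintB (L1_sinM l (Ig p)) (L1_sinM l (Ig (- p)))); apply: eq_Rint => s.
  by rewrite gE mulrBr.
have [I1 e1] := XY p; have [I2 e2] := XY (- p).
have [J1 J2] := (L1Z 2 I1, L1Z 2 I2).
have le1 l : ahat l ^+ 2 * (Ct (fun t => cut n t * psi t) l ^+ 2 + St (fun t => cut n t * psi t) l ^+ 2)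
    <= 2 * (X p l ^+ 2 + Y p l ^+ 2) + 2 * (X (- p) l ^+ 2 + Y (- p) l ^+ 2).
  rewrite CE SE -subr_ge0.
  rewrite (_ : _ - _ = (X p l + X (- p) l) ^+ 2 + (Y p l + Y (- p) l) ^+ 2); last by rewrite /X /Y; ring.
  by rewrite addr_ge0 ?sqr_ge0.
have mc : Rmeas (fun l => ahat l ^+ 2 *
     (Ct (fun t => cut n t * psi t) l ^+ 2 + St (fun t => cut n t * psi t) l ^+ 2)).
  have Ic := L1_cutM n bpsi.
  apply: measurable_funM; first by apply: measurable_funX; exact: bah.1.
  by apply: measurable_funD; apply: measurable_funX;
    [exact: ucont_meas (ucont_Ct Ic)|exact: ucont_meas (ucont_St Ic)].
have I3 : L1 (leb R) (fun l => ahat l ^+ 2 *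
     (Ct (fun t => cut n t * psi t) l ^+ 2 + St (fun t => cut n t * psi t) l ^+ 2)).
  apply: (L1_le mc (L1D J1 J2)) => l.
  rewrite ger0_norm; first exact: le1.
  by rewrite mulr_ge0 ?addr_ge0 ?sqr_ge0.
split => //; apply: (le_trans (Rint_le I3 (L1D J1 J2) le1)).
rewrite (RintD J1 J2) (RintZ _ I1) (RintZ _ I2).
move: e1 e2; move: (Rintegral _ _ _) (Rintegral _ _ _) => x y; lra.
Qed.

Let psic t : C := (psi t)%:C.
Let Cpsi : Cb psic := Cb_real up psiB.
Let u := mconv a psic.
Let Cu : Cb u := Cb_conv a Cpsi.

Let u2 : L1 (leb R) (fun t => Re (u t) ^+ 2) /\ L1 (leb R) (fun t => Im (u t) ^+ 2).
Proof.
apply: (@conv_L2 R a ahat psi B (4 * E0) Fa (ucont_continuous up) psiB).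
  by move=> n; have [] := XY2 n.
by move=> n; have [] := XY2 n.
Qed.

Let vanish_u sg : sg ^+ 2 = 1 -> vanish sg u.
Proof.
move=> sg1 e e0; have e2 : 0 < e / 2 by rewrite divr_gt0.
have [A1 H1] := ucont_L2_vanish (Cb_Re Cu) u2.1 e2.
have [A2 H2] := ucont_L2_vanish (Cb_Im Cu) u2.2 e2.
exists (Num.max A1 A2) => t; rewrite gt_max => /andP[h1 h2].
have st : sg * t <= `|t|.
  apply: (le_trans (ler_norm _)); rewrite normrM.
  suff -> : `|sg| = 1 by rewrite mul1r.
  by apply/eqP; rewrite -(@eqrXn2 _ 2)// real_normK ?num_real// sg1 expr1n.
have k1 := H1 t (lt_le_trans h1 st); have k2 := H2 t (lt_le_trans h2 st).
apply: (le_lt_trans (cabs_le _)).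
by rewrite [ltRHS](_ : e = e / 2 + e / 2); [exact: ltrD|field].
Qed.

Lemma motion_L2 : hat_prod_in (fun nu => (ahat nu)%:C) (FT psic) (Lhat 2%:E).
Proof.
have [gg [m1 m2 g1 g2 H]] := FT_conv_L2 (Cb_cbm Cu) u2.1 u2.2.
exists (FT u).
  exists a, psic; split => //; by apply/funext => l; rewrite Fa.
(* The Dirac measure at 0 turns the formula for convolutions into one for u. *)
exists gg; split; [exact: L2_Lfun|exact: L2_Lfun|].
move=> eta; have [dl Hd] := @cmeasure_dirac0 R.
have cd : mconv dl u = u.
  apply/funext => t; rewrite /mconv Hd; first by rewrite subr0.
  by apply: cbm_reflect; exact: Cb_cbm.
rewrite -[in LHS]cd H; congr cint; apply/funext => l.
rewrite /fourier_measure Hd; last exact: cbm_cisN.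
by rewrite mulr0 oppr0 cis0 mul1r.
Qed.

Lemma motion_singsupp : singsupp (FT psic) `&` [set s | ahat s != 0] = set0.
Proof.
apply/seteqP; split => // l /= [[h|h] al]; apply: h.
  have [I [oI iI Il HI]] := regular_point Fa ada cda Cpsi (expr1n _ 2) (vanish_u (expr1n _ 2)) al.
  exists I; split => // h Mh hI; have [nu [Fnu v]] := HI h Mh hI.
  exists (FT (mconv nu psic)); first by exists nu, psic.
  by exists (mconv nu psic) => //; apply: C0_pinfty => //; exact: Cb_conv.
have s1 : (-1 : R) ^+ 2 = 1 by rewrite sqrrN expr1n.
have [I [oI iI Il HI]] := regular_point Fa ada cda Cpsi s1 (vanish_u s1) al.
exists I; split => // h Mh hI; have [nu [Fnu v]] := HI h Mh hI.
exists (FT (mconv nu psic)); first by exists nu, psic.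
by exists (mconv nu psic) => //; apply: C0_ninfty => //; exact: Cb_conv.
Qed.

Variables (Bq : @cmeasure R) (b : R -> R).
Hypotheses (FB : forall l, fourier_measure Bq l = (b l)%:C) (bE : forall l, l * b l = ahat l).

Let bb : bmeas b.
Proof. by have [b1 _] := cbm_fourier_measure Bq; apply: eq_bmeas b1 => l; rewrite FB. Qed.

Let b2 : L1 (leb R) (fun l => b l ^+ 2).
Proof.
have mn : Rmeas (fun nu => rho nu * nu ^+ 2) by apply: measurable_funM => //; apply: measurable_funX; exact: meas_id.
have n0 nu : 0 <= rho nu * nu ^+ 2 by rewrite mulr_ge0 ?sqr_ge0.
have [_ I1 _] := quotient_integrable (measurable_funX 2 mkappa) mn (fun x => sqr_ge0 _) n0 fin2.
apply: (@ae_eq_L1 _ _ _ (leb R) _ _ (L1_meas I1) (measurable_funX 2 bb.1) _ I1).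
apply: ae_imp (ae_and aeah (@ae_neq R 0)) => nu [ea /eqP nu0].
have -> : b nu = ahat nu / nu by rewrite -bE mulrAC divff// mul1r.
by rewrite ea !expr_div_n sqrt2 invfM mulrA.
Qed.

Let h l := b l * ahat l.
Let Ih : L1 (leb R) h. Proof. by apply: L1_sqM => //; [exact: bb.1|exact: bah.1]. Qed.

Let whatE l : what ahat l = (0 +i* - (2 * pi)) * (h l)%:C.
Proof.
rewrite /what /h; have [->|l0] := eqVneq l 0; first by rewrite ah0 expr0n/= !mulr0 mul0r.
have -> : ahat l = l * b l by rewrite bE.
have il0 : (0 +i* l) != 0 :> C by rewrite eq_complex/= eqxx.
apply: (mulIf il0); rewrite divfK//.
by apply: complex_eqP; rewrite !ReIm /=; ring.
Qed.

Let wE t : wfun ahat t = St h t +i* - Ct h t.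
Proof.
have p0 : 2 * pi != 0 :> R by rewrite mulf_neq0 ?pnatr_eq0// gt_eqF ?pi_gt0.
rewrite /wfun (_ : (fun l => cis (l * t) * what ahat l) =
  (fun l => cis (l * t) * ((0 +i* - (2 * pi)) * (h l)%:C))); last by apply/funext => l; rewrite whatE.
have -> : cint (fun l => cis (l * t) * ((0 +i* - (2 * pi)) * (h l)%:C)) = (2 * pi * St h t) +i* (- (2 * pi * Ct h t)).
  apply: complex_eqP => /=.
    rewrite /St -(RintZ _ (L1_sinM t Ih)); apply: eq_Rint => l.
    by rewrite /= (mulrC l t); ring.
  rewrite /Ct -(RintZ _ (L1_cosM t Ih)) -(RintN (L1Z _ (L1_cosM t Ih))); apply: eq_Rint => l.
  by rewrite /= (mulrC l t); ring.
by apply: complex_eqP; rewrite !ReIm /= mul0r ?subr0 ?addr0 ?mulrN mulKf.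
Qed.

(** what is - 2 pi i b ahat, where b and ahat psihat are in L2. *)
Lemma motion_L1 : hat_prod_in (what ahat) (FT psic) (Lhat 1%:E).
Proof.
have [gg [m1 m2 g1 g2 H]] := FT_conv_L2 (Cb_cbm Cu) u2.1 u2.2.
have [Bs [FBs cBs]] := fourier_scale (0 +i* - (2 * pi)) Bq.
have [pi_ [Fpi cpi]] := fourier_product Bs a.
exists (FT (mconv pi_ psic)).
  exists pi_, psic; split => //; apply/funext => l.
  by rewrite whatE Fpi FBs FB Fa /h -mulrA rmorphM.
rewrite (cpi _ (Cb_cbm Cpsi)).
exists (fun l => fourier_measure Bs l * gg l).
have FBsE l : fourier_measure Bs l = 0 +i* (- (2 * pi) * b l).
  by rewrite FBs FB; apply: complex_eqP; rewrite !ReIm /=; ring.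
split.
- apply: L1_Lfun; apply: (eq_L1R _ (L1Z (2 * pi) (L1_sqM bb.1 m2 b2 g2))) => l.
  by rewrite FBsE ReM /=; ring.
- apply: L1_Lfun; apply: (eq_L1R _ (L1Z (- (2 * pi)) (L1_sqM bb.1 m1 b2 g1))) => l.
  by rewrite FBsE ImM /=; ring.
- by move=> eta; rewrite H; congr cint; apply/funext => l; rewrite mulrA.
Qed.

Let phi := coupling kappa xi.

Let phiE t : phi t = \int[leb R]_l (b l *
  (sin (t * l) * (a0 l + ahat l * Ct (g t) l) + cos (t * l) * (b0 l - ahat l * St (g t) l))).
Proof.
have Ik : L1 (leb R) (fun nu => kappa nu * xi nu t) by have [] := fen t.
have mtl : Rmeas (fun l => t * l) by apply: measurable_funM; [exact: measurable_cst|exact: meas_id].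
apply: ae_eq_Rint.
- exact: (L1_meas Ik).
- apply: measurable_funM; first exact: bb.1.
  apply: measurable_funD; apply: measurable_funM; [exact: meas_sin|exact: mX|exact: meas_cos|exact: mY].
have [aer _ _] := quotient_integrable (measurable_funX 2 mkappa) mrho (fun x => sqr_ge0 _) rho0 fin1.
apply: ae_imp (ae_and motion (ae_and aeah (ae_and (@ae_neq R 0) aer))) => nu [mo [ea [/eqP nu0 er]]].
have [_ e2] := mo t; rewrite -/(X t nu) -/(Y t nu) -e2.
have [r0|rn0] := eqVneq (rho nu) 0.
  have k0 : kappa nu = 0 by apply/eqP; rewrite -sqrf_eq0 er.
  by rewrite r0 sqrtr0 k0 !mul0r mulr0.
have s0 : Num.sqrt (rho nu) != 0 by rewrite sqrtr_eq0 -ltNge lt_neqAle eq_sym rn0 rho0.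
have -> : b nu = ahat nu / nu by rewrite -bE mulrAC divff// mul1r.
by rewrite ea; field; rewrite s0 nu0.
Qed.

Let FBa : exists mu : @cmeasure R, forall l, fourier_measure mu l = (b l * ahat l)%:C.
Proof.
have [pi_ [Fpi _]] := fourier_product Bq a.
by exists pi_ => l; rewrite Fpi FB Fa rmorphM.
Qed.

Let split_ sg : sg = 1 \/ sg = -1 -> exists (nu : @cmeasure R) (theta : R -> C),
  [/\ fourier_measure nu = fourier (fun t => (half (St h) sg t)%:C), Cb theta, vanish sg theta &
    forall t, (phi t)%:C = mconv nu psic t + theta t].
Proof.
move=> sgE; have [mu Fmu] := FBa.
exact: (@response_split R psi phi ahat b a0 b0 mu B up psiB bah bb.1 ma0 mb0 ah2 b2 a02 b02 Fmu phiE sg sgE).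
Qed.

Lemma motion_bounded : exists P, forall t, `|phi t| <= P.
Proof.
have [nu [theta [_ Ct_ _ pE]]] := split_ (or_introl erefl).
have [[P1 h1] _] := Cb_conv nu Cpsi; have [[P2 h2] _] := Ct_.
exists (P1 + P2) => t.
have -> : phi t = Re (mconv nu psic t) + Re (theta t) by rewrite -ReD -pE.
apply: (le_trans (ler_normD _ _)); apply: lerD; exact: le_trans (cabs_Re _) _.
Qed.

(** wfun is the sum of St h, which is odd, and of an even function: its
    antisymmetrization is St h. *)
Lemma motion_plus : exists P theta, [/\ hat_prod (fourier (wdiamond_plus (wfun ahat))) (FT psic) P,
  C0hat +oo theta & FT (fun t => (phi t)%:C) = fun eta => P eta + theta eta].
Proof.
have [nu [theta [Fnu Cth v pE]]] := split_ (or_introl erefl).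
exists (FT (mconv nu psic)), (FT theta); split.
- exists nu, psic; split => //; rewrite Fnu; congr fourier; apply/funext => t.
  rewrite /wdiamond_plus /half mul1r; case: ifP => // _; rewrite !wE (StN _ Ih) CtN.
  by apply: complex_eqP; rewrite !ReIm /=; field.
- by exists theta => //; exact: C0_pinfty.
- exact: (FT_eqD (Cb_conv nu Cpsi) Cth pE).
Qed.

Lemma motion_minus : exists P theta, [/\ hat_prod (fourier (wdiamond_minus (wfun ahat))) (FT psic) P,
  C0hat -oo theta & FT (fun t => (phi t)%:C) = fun eta => P eta + theta eta].
Proof.
have [nu [theta [Fnu Cth v pE]]] := split_ (or_intror erefl).
exists (FT (mconv nu psic)), (FT theta); split.
- exists nu, psic; split => //; rewrite Fnu; congr fourier; apply/funext => t.
  rewrite /wdiamond_minus /half mulN1r oppr_gt0; case: ifP => // _; rewrite !wE (StN _ Ih) CtN.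
  by apply: complex_eqP; rewrite !ReIm /=; field.
- by exists theta => //; exact: C0_ninfty.
- exact: (FT_eqD (Cb_conv nu Cpsi) Cth pE).
Qed.

End Motion.

End Thermostat.

Theorem theorem2 (R : realType) (m : nat) (M : topologicalType)
    (S : @smooth_atlas R m M) (A : riemannian_metric S) (V0 f : M -> R)
    (rho kappa ahat : R -> R) (xi0 xidot0 : R -> R)
    (x0 : M) (i0 : chart S) (xdot0 : 'rV[R]_m)
    (x : R -> M) (xi : R -> R -> R) (E : R)
    (K := fine (int_k2rn rho kappa))
    (V := fun y : M => V0 y - K * f y ^+ 2 / 2)
    (psi := f \o x) (phi := coupling kappa xi)
    (psihat := FT (fun t => (psi t)%:C)) (phihat := FT (fun t => (phi t)%:C))
    (w := wfun ahat) :
  measurable_fun setT rho -> measurable_fun setT kappa ->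
  measurable_fun setT xi0 -> measurable_fun setT xidot0 ->
  (* ahat = kappa / sqrt rho, extended by zero (x / 0 = 0), up to a null set *)
  {ae leb R, forall nu, ahat nu = kappa nu / Num.sqrt (rho nu)} ->
  (* (i) *)
  smooth_fun S V0 -> smooth_fun S f ->
  (forall nu, 0 <= rho nu) -> supp kappa `<=` supp rho ->
  (* (ii) *)
  (int_k2r rho kappa < +oo)%E -> (int_k2rn rho kappa < +oo)%E ->
  (* (iii) *)
  (exists c, forall y, c <= V y) ->
  (exists c, forall y, `|f y| <= c) \/
    (forall B, exists c, forall y, c < `|f y| -> B < V y) ->
  (forall E0, compact [set y | V y <= E0]) ->
  (* (iv) *)
  (leb R).-integrable setT
    (fun nu => (rho nu * (xidot0 nu ^+ 2 + nu ^+ 2 * xi0 nu ^+ 2))%:E) ->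
  (* (v) *)
  Mhat (fun nu => (ahat nu)%:C) ->
  (forall nu, derivable ahat nu 1) -> Mhat (fun nu => (derive1 ahat nu)%:C) ->
  ahat 0 = 0 -> cabs (what ahat nu) @[nu --> 0^'] --> (0 : R) ->
  (* solution *)
  euler_lagrange A V0 f x phi ->
  oscillators rho kappa psi xi ->
  (forall t, finite_oscillator_energy rho kappa xi t) ->
  (forall i t, dom i (x t) -> energy A V0 f rho kappa x xi i t = E) ->
  x 0 = x0 -> dom i0 x0 -> derive1 (cmap i0 \o x) 0 = xdot0 ->
  {ae leb R, forall nu, xi nu 0 = xi0 nu /\ derive1 (xi nu) 0 = xidot0 nu} ->
  [/\ bounded_fun psi /\ bounded_fun phi,
      [/\ hat_prod_in (fun nu => (ahat nu)%:C) psihat (Lhat 2%:E),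
          hat_prod_in (what ahat) psihat (Lhat 1%:E) &
          singsupp psihat `&` [set s | ahat s != 0] = set0],
      (exists P theta, [/\ hat_prod (fourier (wdiamond_plus w)) psihat P,
         C0hat +oo theta & phihat = fun eta => P eta + theta eta]) &
      (exists P theta, [/\ hat_prod (fourier (wdiamond_minus w)) psihat P,
         C0hat -oo theta & phihat = fun eta => P eta + theta eta])].
Proof.
move=> /RmeasW mrho /RmeasW mkappa /RmeasW mxi0 /RmeasW mxd aeah _ sf r0 _ fin1 fin2 [cV HcV] _ Kc init0
  [a _ Fa'] dah [c _ Fc'] ah0 _ [cx EL] osc fen en _ _ _ init.
have Fa l : fourier_measure a l = (ahat l)%:C by rewrite Fa'.
have Fc l : fourier_measure c l = (derive1 ahat l)%:C by rewrite Fc'.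
pose P t := \int[leb R]_nu (rho nu * derive1 (xi nu) t ^+ 2).
pose Q t := \int[leb R]_nu (rho nu * nu ^+ 2 * xi nu t ^+ 2).
(* Twice the potential energy of the oscillators and of the coupling, measured from
   its minimum at given x. *)
pose Z t := Q t - 2 * psi t * phi t + K * psi t ^+ 2.
have P0 t : 0 <= P t by apply: Rint_ge0 => nu; rewrite mulr_ge0 ?sqr_ge0.
have QZ t : 0 <= Z t /\ Q t <= 2 * Z t + 2 * psi t ^+ 2 * K.
  by have := oscillator_energy_bound (psi t) mrho mkappa r0 fin2 (fen t).
have kin0 i t : dom (s := S) i (x t) -> 0 <= kinetic A i (cmap i (x t)) (derive1 (cmap i \o x) t).
  move=> it; rewrite /kinetic mulr_ge0 ?invr_ge0//.
  have [->|v0] := eqVneq (derive1 (cmap i \o x) t) 0; last by rewrite ltW// metric_posdef.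
  by rewrite !mul0mx mxE.
have bal i t : dom (s := S) i (x t) ->
    kinetic A i (cmap i (x t)) (derive1 (cmap i \o x) t) + P t / 2 + V (x t) + Z t / 2 = E.
  move=> it; rewrite -(en i t it) /energy /V /Z -/(P t) -/(Q t) -/(phi t) /psi /=; by field.
have VE t : V (x t) <= E.
  have [i it] := atlas_cover S (x t).
  have := bal i t it; have := kin0 i t it; have := P0 t; have [] := QZ t.
  move: (kinetic _ _ _ _) (P t) (Z t) (V (x t)) => k p z v; lra.
have cf := smooth_fun_continuous sf.
have cK := Kc E.
have [B psiB] : exists B, forall t, `|psi t| <= B.
  have cn : continuous (fun y => `|f y|) by move=> y; apply: cvg_norm; exact: cf.
  have ne : [set y | V y <= E] !=set0 by exists (x 0); exact: VE.
  have [y0 _ H] := compact_EVT_max ne cK (continuous_subspaceT cn).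
  by exists (`|f y0|) => t; apply: H; rewrite inE; exact: VE.
have kinE i t : dom (s := S) i (x t) ->
    kinetic A i (cmap i (x t)) (derive1 (cmap i \o x) t) <= E - cV.
  move=> it; have := bal i t it; have := P0 t; have [] := QZ t; have := HcV (x t).
  rewrite -/(V (x t)); move: (kinetic _ _ _ _) (P t) (Z t) (V (x t)) => k p z v; lra.
have up : ucont psi.
  apply: (ucont_observable (A := A) cx cf cK VE (C := E - cV)) => // i t it.
  by have [[]] := EL i t it.
have enb t : P t + Q t <= 6 * (E - cV) + 2 * (B ^+ 2 * `|K|).
  have [i it] := atlas_cover S (x t).
  have := bal i t it; have := P0 t; have [] := QZ t; have := HcV (x t); have := kin0 i t it.
  have : psi t ^+ 2 * K <= B ^+ 2 * `|K|.
    apply: (@le_trans _ _ (psi t ^+ 2 * `|K|)); first by rewrite ler_wpM2l ?sqr_ge0// ler_norm.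
    rewrite ler_wpM2r// -[psi t ^+ 2]real_normK ?num_real// ler_pXn2r ?nnegrE//.
    exact: le_trans (psiB t).
  rewrite -/(V (x t)) -[2 * _ * K]mulrA; move: (kinetic _ _ _ _) (P t) (Z t) (V (x t)) (psi t ^+ 2 * K) (_ * `|K|) (Q t) => k1 p1 z1 v1 y1 w1 q1; lra.
have ada (l : R) : is_derive l (1 : R) ahat (derive1 ahat l).
  by rewrite derive1E; exact: derivableP.
have [Bq [b [FB bE]]] := quotient_measure ada ah0 Fc.
split.
- split; first by apply: bounded_funP; exists B.
  apply: bounded_funP.
  exact: (motion_bounded mrho mkappa mxi0 mxd aeah r0 fin1 fin2 init0 Fa up psiB osc fen init FB bE).
- split.
  + exact: (motion_L2 mrho mxi0 mxd aeah r0 Fa up psiB osc fen enb init).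
  + exact: (motion_L1 mrho mkappa mxi0 mxd aeah r0 fin2 Fa ah0 up psiB osc fen enb init FB bE).
  + exact: (motion_singsupp mrho mxi0 mxd aeah r0 Fa dah Fc up psiB osc fen enb init).
- exact: (motion_plus mrho mkappa mxi0 mxd aeah r0 fin1 fin2 init0 Fa ah0 up psiB osc fen init FB bE).
- exact: (motion_minus mrho mkappa mxi0 mxd aeah r0 fin1 fin2 init0 Fa ah0 up psiB osc fen init FB bE).
Qed.
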